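(* Let $q\in L^1(\mathbb{R})$ be complex-valued and let $\operatorname{supp}q\subset[0,\gamma]$ for some $\gamma>0$. Write $\|q\|=\int_{\mathbb{R}}|q|\,dx$. Then the number $\mathcal{N}(\rho)$ of zeros of $w$ (counted with multiplicity) in the disk $\{z\in\mathbb{C}:|z-2i\|q\||<\rho\}$ with center $2i\|q\|$ and radius $\rho>0$, $\rho\ge\sqrt2\,\|q\|$, satisfies $$\mathcal{N}(\rho)\le1+\frac{4}{\log2}\left(\frac{\gamma\rho}{\pi}+\frac{\|q\|}{\rho}\right).$$ In particular, the number $\mathcal{N}_+$ of zeros of $w$ (counted with multiplicity) in $\overline{\mathbb{C}}_+$ satisfies $$\mathcal{N}_+\le C_1+C_2\gamma\|q\|,$$ where the constants $C_1,C_2\le5$; more precisely $C_1=1+\frac{8}{\sqrt{17}\log2}+\varepsilon_1$ and $C_2=\frac{2\sqrt{17}}{\pi\log2}+\varepsilon_2$ for any small $\varepsilon_1,\varepsilon_2>0$.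
   Context: $\overline{\mathbb{C}}_+=\{\operatorname{Im}z\ge0\}$. $f_\pm(x,k)$ are the Jost solutions of $-f''+qf=k^2f$ on $\mathbb{R}$, with $f_\pm(x,k)=e^{\pm ixk}$ for $\pm x$ large; $w(k)=f_-(0,k)f_+'(0,k)-f_-'(0,k)f_+(0,k)$ is their Wronskian. Since $q$ has compact support, $w$ is an entire function of $k$. *)

(* Defs.v *)
From mathcomp Require Import all_boot all_order all_algebra.
From mathcomp Require Import all_classical all_reals all_analysis.
From mathcomp Require Export complex.

Set Implicit Arguments.
Unset Strict Implicit.
Unset Printing Implicit Defensive.

Import Order.TTheory GRing.Theory Num.Theory.
Import numFieldNormedType.Exports.

Local Open Scope classical_set_scope.
Local Open Scope ring_scope.
Local Open Scope complex_scope.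

Section ComplexValued.
Variable R : realType.
Implicit Types (q f : R -> R[i]) (x y : R) (z k : R[i]).

Local Notation mu := (@lebesgue_measure R).

Definition cexp z : R[i] :=
  (expR (complex.Re z))%:C * (cos (complex.Im z) +i* sin (complex.Im z)).

(* R[i] is not a normed module over R in the libraries, so differentiation
   and integration with respect to a real variable are done componentwise. *)
Definition re_part f : R -> R := fun x => complex.Re (f x).
Definition im_part f : R -> R := fun x => complex.Im (f x).

Definition cderivable f x :=
  derivable (re_part f) x 1 /\ derivable (im_part f) x 1.

Definition cderive f x : R[i] := derive1 (re_part f) x +i* derive1 (im_part f) x.

Definition cintegral (D : set R) f : R[i] :=
  Rintegral mu D (re_part f) +i* Rintegral mu D (im_part f).

Definition cintegrable (D : set R) f :=
  mu.-integrable D (EFin \o re_part f) /\ mu.-integrable D (EFin \o im_part f).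

Definition clocally_integrable f :=
  locally_integrable setT (re_part f) /\ locally_integrable setT (im_part f).

Definition L1norm q : R := Rintegral mu setT (fun x => Normc.normc (q x)).

(* The support of an element of L^1 (a class modulo a.e. equality): the
   complement of the largest open set on which q vanishes a.e. *)
Definition ess_supp q : set R :=
  [set x | ~ exists U : set R,
     [/\ open U, U x & {ae mu, forall y, U y -> q y = 0}]].

(* -f'' + q f = k^2 f for q merely integrable: f is differentiable, f' is
   locally absolutely continuous, i.e. the primitive of a locally integrable
   function f'', and the equation holds a.e. *)
Definition schrodinger_solution q k f :=
  (forall x, cderivable f x) /\
  exists f2 : R -> R[i],
    [/\ clocally_integrable f2,
        forall a b, a <= b ->
          cderive f b - cderive f a = cintegral `[a, b] f2 &
        {ae mu, forall x, - f2 x + q x * f x = k ^+ 2 * f x}].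

Definition jost_plus q k f :=
  schrodinger_solution q k f /\
  \forall x \near +oo, f x = cexp ((0 +i* x) * k).

Definition jost_minus q k f :=
  schrodinger_solution q k f /\
  \forall x \near -oo, f x = cexp (- ((0 +i* x) * k)).

Definition jost_wronskian (fm fp : R -> R[i] -> R[i]) k : R[i] :=
  fm 0 k * cderive (fp ^~ k) 0 - cderive (fm ^~ k) 0 * fp 0 k.

(* The order of vanishing at z of w, assumed holomorphic near z: the least n
   such that the n-th complex derivative of w does not vanish at z, and +oo if
   there is none. *)
Definition zero_order (w : R[i] -> R[i]) z : \bar R :=
  ereal_inf [set n%:R%:E | n in
    [set n : nat | derive1n n (w : R[i]^o -> R[i]^o) z != 0]].

(* The value is +oo if there are infinitely many zeros. *)
Definition nb_zeros (w : R[i] -> R[i]) (D : set R[i]) : \bar R :=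
  \esum_(z in [set z | D z /\ w z = 0]) zero_order w z.

Definition open_disk z (r : R) : set R[i] := [set y | Normc.normc (y - z) < r].

Definition closed_upper_half_plane : set R[i] := [set z | 0 <= complex.Im z].

End ComplexValued.

Arguments closed_upper_half_plane R : clear implicits.

(* Main.v *)
Require Import Defs.
From mathcomp Require Import all_boot all_order all_algebra.
From mathcomp Require Import all_classical all_reals all_analysis.
From mathcomp Require Import measurable_realfun ring lra.

(** The Wronskian w is a perturbation of 2 i k. The Volterra equation for the Jost
    solution f_+ gives
      |w(k) - 2 i k| <= |q|_1 (1 + beta exp (2 eta gamma) / (1 - beta)),
      beta = |q|_1 / |k| < 1, eta = max (0, - Im k)
    (wronskian_bound). So w is comparable to 2 |k| in the upper half-plane and
    grows like exp (2 gamma |Im k|) in the lower one, and Jensen's inequality on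
    a circle whose centre lies on the positive imaginary axis bounds the number
    of zeros inside. On such a circle the exponent is a multiple of the negative
    part of sin t, whose mean is 1 / pi; this is the origin of the term
    gamma rho / pi.

    In units of rho, put a = gamma rho and b = |q|_1 / rho. The bound for w is
    additive in exp (2 eta gamma); an inequality for log-convex functions
    (log_mean_exp_chord) makes it 2 |k| A exp (s ln B) with s the negative part
    of sin t, where B - 1 is of order b ^ 2 exp (2 a R) on the circle of radius R
    around i y. The zeros being in the circle of radius r, Jensen's inequality
    becomes (wronskian_jensen)
      G ^ 2 (R / r) ^ (2 N) <= (y ^ 2 + R ^ 2) A ^ 2 B ^ (2 / pi),
    with G a lower bound for |w| / 2 at the centre. For R = 3 and r slightly larger
    than 1 one has (R / r) ^ 2 >= 2 ^ R, which is what the constant 4 / ln 2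
    requires: taking logarithms, the term in a is exactly 4 a / (pi ln 2), and the
    rest of the bound, 1 + 4 b / ln 2, covers the factors depending on b, since
    B ^ (2 / pi) contains the small factor b ^ (4 / pi) (many_zeros_bound). This
    needs b ^ 2 exp (6 a) to be large. If it is not, three zeros at most are
    possible, and since N is an integer only the cases where the bound is below 3
    remain; there b ^ 2 exp (10 a) is under control, and the circle of radius 5
    around i excludes two, resp. three, zeros (count_le).

    The zeros in the closed upper half-plane satisfy 2 |k| <= |q|_1: for such a zero
    f_+ solves an integral equation with kernel bounded by 1 / (2 |k|)
    (zeros_upper_half_plane). They lie in the disk of centre 2 i |q|_1 and radius
    sqrt 17 / 2 |q|_1, and the second statement is the first one for a slightly
    larger radius.

    Complex analysis is reduced to polynomials: a function is called entire if it
    is a uniform limit of polynomials on every disk. The mean value property over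
    the vertices of regular polygons gives the maximum principle, hence the
    division by zeros and Jensen's inequality. That w is entire follows from the
    convergence of the Euler scheme, whose steps are polynomial in k
    (wronskian_entire). As q is merely integrable, f' is only absolutely
    continuous; identities for f are obtained from increments that are small to
    second order (constant_of_increments) instead of by differentiation. *)

Set Implicit Arguments.
Unset Strict Implicit.
Unset Printing Implicit Defensive.

Import Order.TTheory GRing.Theory Num.Theory.
Import numFieldNormedType.Exports.

Local Open Scope classical_set_scope.
Local Open Scope ring_scope.
Local Open Scope complex_scope.

Import Normc.

(** * Modulus of a complex number *)

Section Modulus.
Variable R : realType.
Implicit Types (z w : R[i]) (x y : R).

Lemma normc_ge0 z : 0 <= normc z.
Proof. by case: z => a b; exact: sqrtr_ge0. Qed.

Lemma normcE z : `|z| = (normc z)%:C.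
Proof. by case: z. Qed.

Lemma normcD z w : normc (z + w) <= normc z + normc w.
Proof. exact: le_normcD. Qed.

Lemma normc_opp z : normc (- z) = normc z.
Proof. exact: normcN. Qed.

Lemma normcBC z w : normc (z - w) = normc (w - z).
Proof. by rewrite -normc_opp opprB. Qed.

Lemma normcB z w : normc (z - w) <= normc z + normc w.
Proof. by rewrite -(normc_opp w) normcD. Qed.

Lemma normcB_ge z w : normc z - normc w <= normc (z - w).
Proof. by rewrite lerBlDr -{1}(subrK w z) normcD. Qed.

Lemma normc_eq0 z : (normc z == 0) = (z == 0).
Proof.
by apply/eqP/eqP => [|->]; [exact: eq0_normc|exact: normc0].
Qed.

Lemma normc_gt0 z : (0 < normc z) = (z != 0).
Proof. by rewrite lt_neqAle normc_ge0 andbT eq_sym normc_eq0. Qed.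

Lemma normcX z n : normc (z ^+ n) = normc z ^+ n.
Proof.
by elim: n => [|n ih]; rewrite ?expr0 ?normc1// !exprS normcM ih.
Qed.

Lemma normc_prod (I : Type) (r : seq I) (P : pred I) (F : I -> R[i]) :
  normc (\prod_(i <- r | P i) F i) = \prod_(i <- r | P i) normc (F i).
Proof.
by apply: (big_morph (@normc R)); [exact: normcM|exact: normc1].
Qed.

Lemma normc_sum (I : Type) (r : seq I) (P : pred I) (F : I -> R[i]) :
  normc (\sum_(i <- r | P i) F i) <= \sum_(i <- r | P i) normc (F i).
Proof.
elim/big_rec2: _ => [|i y x _ yx]; first by rewrite normc0.
by rewrite (le_trans (normcD _ _))// lerD2l.
Qed.

Lemma sqr_normc z : normc z ^+ 2 = complex.Re z ^+ 2 + complex.Im z ^+ 2.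
Proof. by case: z => a b /=; rewrite sqr_sqrtr ?addr_ge0 ?sqr_ge0. Qed.

Lemma normc_real x : normc x%:C = `|x|.
Proof. by rewrite /normc/= expr0n/= addr0 sqrtr_sqr. Qed.

Lemma normc_imag x : normc (0 +i* x) = `|x|.
Proof. by rewrite /normc/= expr0n/= add0r sqrtr_sqr. Qed.

Lemma normc_nat n : normc (n%:R : R[i]) = n%:R.
Proof. by rewrite -(rmorph_nat (real_complex R)) normc_real normr_nat. Qed.

Lemma normc_Re z : `|complex.Re z| <= normc z.
Proof.
by case: z => a b /=; rewrite -sqrtr_sqr ler_sqrt ?lerDl ?sqr_ge0 ?addr_ge0 ?sqr_ge0.
Qed.

Lemma normc_Im z : `|complex.Im z| <= normc z.
Proof.
by case: z => a b /=; rewrite -sqrtr_sqr ler_sqrt ?lerDr ?sqr_ge0 ?addr_ge0 ?sqr_ge0.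
Qed.

Lemma normc_leD z : normc z <= `|complex.Re z| + `|complex.Im z|.
Proof.
have {1}-> : z = (complex.Re z)%:C + (0 +i* complex.Im z).
  by case: z => a b; simpc.
by rewrite (le_trans (normcD _ _))// normc_real normc_imag.
Qed.

Lemma cReD z w : complex.Re (z + w) = complex.Re z + complex.Re w.
Proof. by case: z; case: w. Qed.
Lemma cImD z w : complex.Im (z + w) = complex.Im z + complex.Im w.
Proof. by case: z; case: w. Qed.
Lemma cReN z : complex.Re (- z) = - complex.Re z.
Proof. by case: z. Qed.
Lemma cImN z : complex.Im (- z) = - complex.Im z.
Proof. by case: z. Qed.
Lemma cReM z w : complex.Re (z * w) =
  complex.Re z * complex.Re w - complex.Im z * complex.Im w.
Proof. by case: z; case: w. Qed.
Lemma cImM z w : complex.Im (z * w) =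
  complex.Re z * complex.Im w + complex.Im z * complex.Re w.
Proof. by case: z => a b; case: w => c d /=; rewrite addrC. Qed.

Lemma complex_eq z w : complex.Re z = complex.Re w ->
  complex.Im z = complex.Im w -> z = w.
Proof. by case: z => a b; case: w => c d /= -> ->. Qed.

Lemma normc_arbitrarily_small z : (forall e, 0 < e -> normc z <= e) -> z = 0.
Proof.
move=> h; apply: eq0_normc; apply/eqP; rewrite eq_le normc_ge0 andbT.
by apply/ler_addgt0Pl => e e0; rewrite addr0 h.
Qed.

Lemma arch_bound x : exists2 n : nat, (0 < n)%N & x <= n%:R.
Proof.
exists (Num.truncn `|x|).+1 => //; rewrite (le_trans (ler_norm x))// ltW//.
by rewrite truncnS_gt.
Qed.

End Modulus.

(** * Complex exponential *)

Section ComplexExponential.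
Variable R : realType.
Implicit Types (z w : R[i]) (x y : R).

Lemma cexpD z w : cexp (z + w) = cexp z * cexp w.
Proof.
case: z => a b; case: w => c d; rewrite /cexp /= expRD sinD cosD.
by apply: complex_eq; rewrite /= ; ring.
Qed.

Lemma cexp0 : cexp (0 : R[i]) = 1.
Proof. by rewrite /cexp /= expR0 cos0 sin0 mul1r. Qed.

Lemma normc_cexp z : normc (cexp z) = expR (complex.Re z).
Proof.
by rewrite /cexp normcM normc_real ger0_norm ?expR_ge0//= cos2Dsin2 sqrtr1 mulr1.
Qed.

Lemma cexpN z : cexp z * cexp (- z) = 1.
Proof. by rewrite -cexpD subrr cexp0. Qed.

Lemma cexpMn z n : cexp (z *+ n) = cexp z ^+ n.
Proof. by elim: n => [|n ih]; rewrite ?cexp0// mulrS cexpD ih exprS. Qed.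

Lemma cexp_neq0 z : cexp z != 0.
Proof. by rewrite -normc_gt0 normc_cexp expR_gt0. Qed.

Definition cis (t : R) : R[i] := cos t +i* sin t.

Lemma cisD x y : cis (x + y) = cis x * cis y.
Proof. by rewrite /cis cosD sinD; apply: complex_eq => /=; ring. Qed.

Lemma normc_cis x : normc (cis x) = 1.
Proof. by rewrite /cis/= cos2Dsin2 sqrtr1. Qed.

Lemma cisMn x n : cis (x *+ n) = cis x ^+ n.
Proof.
elim: n => [|n ih]; first by rewrite /cis mulr0n cos0 sin0 expr0.
by rewrite mulrS cisD ih exprS.
Qed.

Lemma cis_pi : cis pi = - 1.
Proof. by rewrite /cis cospi sinpi; apply: complex_eq => //=; rewrite oppr0. Qed.

Lemma cis_neq1 x : 0 < x < pi *+ 2 -> cis x != 1.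
Proof.
move=> /andP[x0 xpi]; apply/eqP => -[cx _].
have s0 : 0 < sin (x / 2).
  apply: sin_gt0_pi; rewrite divr_gt0//=.
  by rewrite ltr_pdivrMr// mulr_natr.
have : cos (x / 2 *+ 2) = 1 by rewrite -mulr_natr mulfVK.
rewrite cos_mulr2n cos2sin2 => h.
have : sin (x / 2) ^+ 2 = 0 by move: h; rewrite mulr2n; lra.
by move/eqP; rewrite sqrf_eq0 gt_eqF.
Qed.

End ComplexExponential.

(** * Entire functions as limits of polynomials *)

Section Entire.
Variable R : realType.
Implicit Types (p : {poly R[i]}) (f g : R[i] -> R[i]) (z w k c : R[i]) (x y r : R).

Lemma sum_cis_root (n i : nat) : (0 < i < n)%N ->
  \sum_(j < n) (cis (pi *+ 2 / n%:R) ^+ i) ^+ j = 0 :> R[i].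
Proof.
move=> /andP[i0 ltin]; have n0 : (0 < n)%N by apply: leq_trans ltin.
have nR : 0 < n%:R :> R by rewrite ltr0n.
set v := _ ^+ i; have v1 : v - 1 != 0.
  rewrite subr_eq0 /v -cisMn; apply: cis_neq1; rewrite -[_ *+ i]mulr_natr.
  have p2 : 0 < pi *+ 2 :> R by rewrite mulrn_wgt0// pi_gt0.
  rewrite mulr_gt0 ?divr_gt0 ?ltr0n//= -mulrA gtr_pMr//.
  by rewrite mulrC ltr_pdivrMr// mul1r ltr_nat.
have vn : v ^+ n = 1.
  rewrite /v -exprM mulnC exprM -cisMn -[_ *+ n]mulr_natr divfK ?gt_eqF//.
  by rewrite /cis cos2pi sin2pi expr1n.
by have := subrX1 v n; rewrite vn subrr => /esym/eqP; rewrite mulf_eq0 (negbTE v1) => /eqP.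
Qed.

(** The mean value property over the vertices of a regular n-gon is exact for
    polynomials of degree less than n. *)
Lemma poly_mean p (n : nat) z : (0 < n)%N -> (size p <= n)%N ->
  \sum_(j < n) p.[z * cis (pi *+ 2 / n%:R) ^+ j] = n%:R * p.[0].
Proof.
move=> n0 sp.
under eq_bigr do rewrite (horner_coef_wide _ sp).
rewrite exchange_big/=.
case: n n0 sp => // n _ sp.
rewrite big_ord_recl/= [X in _ + X]big1 ?addr0.
  under eq_bigr do rewrite expr0 mulr1.
  by rewrite sumr_const card_ord horner_coef0 mulr_natl.
move=> i _.
under eq_bigr do rewrite exprMn mulrA -exprM mulnC exprM.
by rewrite -mulr_sumr sum_cis_root ?mulr0// /bump/= add1n ltnS ltn_ord.
Qed.

Lemma poly_max_principle p c (r K : R) :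
  (forall t, normc p.[c + r%:C * cis t] <= K) -> normc p.[c] <= K.
Proof.
move=> h; set P := p \Po ('X + c%:P).
have hP z : P.[z] = p.[c + z] by rewrite horner_comp !hornerE addrC.
have n0 : (0 < (size P).+1)%N by [].
have /(congr1 (@normc R)) := poly_mean r%:C n0 (leqnSn (size P)).
rewrite normcM hP addr0 normc_nat => h1.
have : (size P).+1%:R * normc p.[c] <= (size P).+1%:R * K.
  rewrite -h1 (le_trans (normc_sum _ _ _))// mulr_natl.
  have -> : K *+ (size P).+1 = \sum_(j < (size P).+1) K by rewrite sumr_const card_ord.
  rewrite ler_sum// => j _.
  by rewrite hP -cisMn.
by rewrite ler_pM2l ?ltr0n.
Qed.

(** Uniform limits of polynomials on every disk. With this encoding the maximum
    principle and the closure properties are inherited from polynomials, without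
    contour integrals or power series. *)
Definition entire f := forall (r e : R), 0 < e ->
  exists p, forall k, normc k <= r -> normc (f k - p.[k]) <= e.

Lemma entire_poly p : entire (fun k => p.[k]).
Proof. by move=> r e e0; exists p => k _; rewrite subrr normc0 ltW. Qed.

Lemma entire_ext f g : f =1 g -> entire f -> entire g.
Proof. by move=> fg h r e e0; have [p hp] := h r e e0; exists p => k; rewrite -fg; exact: hp. Qed.

Lemma entire_bounded f r : entire f -> exists2 K, 0 <= K & forall k, normc k <= r -> normc (f k) <= K.
Proof.
move=> /(_ r 1 ltr01)[p hp].
have [K K0 hK] : exists2 K, 0 <= K & forall k, normc k <= r -> normc p.[k] <= K.
  elim/poly_ind: p {hp} => [|p c [K K0 hK]].
    by exists 0 => // k _; rewrite horner0 normc0.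
  exists (K * `|r| + normc c); first by rewrite addr_ge0 ?mulr_ge0 ?normc_ge0.
  move=> k kr; rewrite hornerMXaddC (le_trans (normcD _ _))// lerD2r normcM.
  by rewrite ler_pM ?normc_ge0 ?hK// (le_trans kr)// ler_norm.
exists (1 + K); first by rewrite addr_ge0.
move=> k kr; rewrite -(subrK p.[k] (f k)) (le_trans (normcD _ _))// lerD ?hp ?hK//.
Qed.

Lemma entireD f g : entire f -> entire g -> entire (fun k => f k + g k).
Proof.
move=> hf hg r e e0; have e2 : 0 < e / 2 by rewrite divr_gt0.
have [p hp] := hf r _ e2; have [q hq] := hg r _ e2.
exists (p + q) => k kr; rewrite hornerD opprD addrACA.
by rewrite (le_trans (normcD _ _))// [leRHS]splitr lerD ?hp ?hq.
Qed.

Lemma entireM f g : entire f -> entire g -> entire (fun k => f k * g k).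
Proof.
move=> hf hg r e e0.
have [K K0 hK] := entire_bounded r hg.
have e1 : 0 < e / (2 * (1 + K)) by rewrite divr_gt0// mulr_gt0//; lra.
have [p hp] := hf r _ e1.
have [L L0 hL] := entire_bounded r (entire_poly p).
have e2 : 0 < e / (2 * (1 + L)) by rewrite divr_gt0// mulr_gt0//; lra.
have [q hq] := hg r _ e2.
exists (p * q) => k kr; rewrite hornerM.
have -> : f k * g k - p.[k] * q.[k] = (f k - p.[k]) * g k + p.[k] * (g k - q.[k]) by ring.
rewrite (le_trans (normcD _ _))// [leRHS]splitr !normcM lerD//.
  have -> : e / 2 = e / (2 * (1 + K)) * (1 + K) by field; lra.
  by rewrite ler_pM ?normc_ge0 ?hp// (le_trans (hK _ kr))//; lra.
have -> : e / 2 = (1 + L) * (e / (2 * (1 + L))) by field; lra.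
by rewrite ler_pM ?normc_ge0 ?hq// (le_trans (hL _ kr))//; lra.
Qed.

Lemma entire_cst c : entire (fun=> c).
Proof. by apply: (entire_ext _ (entire_poly c%:P)) => k; rewrite hornerC. Qed.

Lemma entire_id : entire id.
Proof. by apply: (entire_ext _ (entire_poly 'X)) => k; rewrite hornerX. Qed.

Lemma entireX f n : entire f -> entire (fun k => f k ^+ n).
Proof.
move=> hf; elim: n => [|n ih].
  by apply: entire_ext (entire_cst 1) => k; rewrite expr0.
by apply: entire_ext (entireM hf ih) => k; rewrite exprS.
Qed.

Lemma entire_prod (I : Type) (s : seq I) (F : I -> R[i] -> R[i]) :
  (forall i, entire (F i)) -> entire (fun k => \prod_(i <- s) F i k).
Proof.
move=> hF; elim: s => [|i s ih].
  by apply: entire_ext (entire_cst 1) => k; rewrite big_nil.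
by apply: entire_ext (entireM (hF i) ih) => k; rewrite big_cons.
Qed.

Lemma entire_affine f c d : entire f -> entire (fun k => f (c + d * k)).
Proof.
move=> hf r e e0.
have [p hp] := hf (normc c + normc d * r) _ e0.
exists (p \Po (c%:P + d%:P * 'X)) => k kr; rewrite horner_comp !hornerE; apply: hp.
by rewrite (le_trans (normcD _ _))// lerD2l normcM ler_wpM2l ?normc_ge0.
Qed.

Lemma entire_max_principle f c (r K : R) : entire f ->
  (forall t, normc (f (c + r%:C * cis t)) <= K) -> normc (f c) <= K.
Proof.
move=> hf h; apply/ler_addgt0Pl => e e0.
have e2 : 0 < e / 2 by rewrite divr_gt0.
have [p hp] := hf (normc c + `|r|) _ e2.
have hc : normc p.[c] <= K + e / 2.
  apply: (@poly_max_principle _ _ r) => t.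
  rewrite -(subrK (f (c + r%:C * cis t)) p.[_]) (le_trans (normcD _ _))// addrC lerD//.
  by rewrite normcBC hp// (le_trans (normcD _ _))// lerD2l normcM normc_cis mulr1 normc_real.
rewrite -(subrK p.[c] (f c)) (le_trans (normcD _ _))//.
have := hp c _; rewrite lerDl normr_ge0 => /(_ isT); lra.
Qed.

End Entire.

(** * Division of an entire function by its zeros *)

Section EntireDivision.
Variable R : realType.
Implicit Types (p : {poly R[i]}) (f g : R[i] -> R[i]) (z w k c : R[i]) (x y r : R).

Lemma normc_dist w z k : normc (z - k) <= normc (z - w) + normc (w - k).
Proof. by rewrite (le_trans _ (normcD _ _))// addrA subrK. Qed.

Lemma real_cauchy_limit (u : nat -> R) :
  (forall e : R, 0 < e -> exists N, forall m n, (N <= m)%N -> (N <= n)%N -> `|u m - u n| <= e) ->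
  exists l, forall e : R, 0 < e -> exists N, forall n, (N <= n)%N -> `|u n - l| <= e.
Proof.
move=> h; have cu : cvgn u.
  apply/cauchy_cvgP; apply: cauchy_exP => e e0.
  have e2 : 0 < e / 2 by rewrite divr_gt0.
  have [N hN] := h _ e2.
  exists (u N); exists N => // n /= Nn; rewrite /ball/= (le_lt_trans (hN _ _ _ Nn))//.
  by rewrite ltr_pdivrMr// ltr_pMr// ltr1n.
exists (limn u) => e e0.
move/cvgrPdist_le : cu => /(_ _ e0)[N _ hN].
by exists N => n Nn; rewrite distrC; exact: hN.
Qed.

Lemma complex_cauchy_limit (u : nat -> R[i]) :
  (forall e : R, 0 < e -> exists N, forall m n, (N <= m)%N -> (N <= n)%N -> normc (u m - u n) <= e) ->
  exists l, forall e : R, 0 < e -> exists N, forall n, (N <= n)%N -> normc (u n - l) <= e.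
Proof.
move=> h.
have [a ha] : exists l, forall e : R, 0 < e -> exists N, forall n, (N <= n)%N -> `|complex.Re (u n) - l| <= e.
  apply: (@real_cauchy_limit (fun n => complex.Re (u n))) => e /h[N hN]; exists N => m n hm hn.
  by rewrite /= -cReN -cReD (le_trans (normc_Re _))// hN.
have [b hb] : exists l, forall e : R, 0 < e -> exists N, forall n, (N <= n)%N -> `|complex.Im (u n) - l| <= e.
  apply: (@real_cauchy_limit (fun n => complex.Im (u n))) => e /h[N hN]; exists N => m n hm hn.
  by rewrite /= -cImN -cImD (le_trans (normc_Im _))// hN.
exists (a +i* b) => e e0; have e2 : 0 < e / 2 by rewrite divr_gt0.
have [M hM] := ha _ e2; have [N hN] := hb _ e2.
exists (maxn M N) => n; rewrite geq_max => /andP[Mn Nn].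
rewrite (le_trans (normc_leD _))// [leRHS]splitr cReD cImD cReN cImN lerD//=.
  exact: hM.
exact: hN.
Qed.

Lemma poly_slope p z : exists2 q : {poly R[i]}, p = p.[z]%:P + ('X - z%:P) * q & q.[z] = p^`().[z].
Proof.
have /factor_theorem[q hq] : root (p - p.[z]%:P) z by rewrite /root !hornerE subrr.
have e : p = p.[z]%:P + ('X - z%:P) * q by rewrite mulrC -hq addrC subrK.
exists q => //; rewrite (congr1 deriv e) derivD derivC add0r derivM derivB derivX derivC subr0 mul1r.
by rewrite !hornerE subrr mul0r addr0.
Qed.

(** Far from z the slope is bounded by dividing by |k - z| >= 1; near z by the
    maximum principle on a circle of radius 2. *)
Lemma poly_slope_bound p q z (r d : R) :
  (forall k, normc k <= r + normc z + 2 -> normc p.[k] <= d) ->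
  p = p.[z]%:P + ('X - z%:P) * q ->
  forall k, normc k <= r -> normc q.[k] <= 2 * d.
Proof.
move=> hp pq.
have hq k : normc k <= r + normc z + 2 -> 1 <= normc (k - z) -> normc z <= r + normc z + 2 -> normc q.[k] <= 2 * d.
  move=> kr kz zr.
  have e : (k - z) * q.[k] = p.[k] - p.[z] by rewrite (congr1 (fun s => s.[k]) pq) !hornerE; ring.
  have : normc (k - z) * normc q.[k] <= 2 * d.
    by rewrite -normcM e (le_trans (normcB _ _))// mulr_natl mulr2n lerD ?hp.
  by apply: le_trans; rewrite ler_peMl ?normc_ge0.
move=> k kr.
have r0 : 0 <= r by rewrite (le_trans _ kr) ?normc_ge0.
have zr : normc z <= r + normc z + 2 by lra.
have [kz|kz] := leP 1 (normc (k - z)).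
  by apply: hq => //; have := normc_ge0 z; lra.
apply: (@poly_max_principle _ _ _ 2) => t; apply: hq => //.
  rewrite (le_trans (normcD _ _))// normcM normc_cis mulr1 normc_real ger0_norm//.
  have := normc_ge0 z; lra.
have : normc (k + 2%:C * cis t - k) <= normc (k + 2%:C * cis t - z) + normc (k - z).
  by rewrite [X in _ <= _ + X]normcBC normc_dist.
rewrite addrC addKr normcM normc_cis mulr1 normc_real ger0_norm//; lra.
Qed.

(** The difference quotient of an entire function is entire: the slopes of the
    polynomial approximants form a uniform Cauchy sequence on disks. *)
Lemma entire_slope f z : entire f ->
  exists2 g, entire g & forall k, f k = f z + (k - z) * g k.
Proof.
move=> hf.
have e0 n : 0 < n.+1%:R^-1 :> R by rewrite invr_gt0 ltr0n.
have /choice[P hP] : forall n : nat, exists p, forall k, normc k <= n%:R -> normc (f k - p.[k]) <= n.+1%:R^-1.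
  by move=> n; exact: hf.
have /choice[Q hQ] : forall n, exists q, P n = (P n).[z]%:P + ('X - z%:P) * q.
  by move=> n; have [q h _] := poly_slope (P n) z; exists q.
have QC r N m n k : r + normc z + 2 <= N%:R -> (N <= m)%N -> (N <= n)%N -> normc k <= r ->
    normc ((Q m).[k] - (Q n).[k]) <= 4 * N.+1%:R^-1.
  move=> rN Nm Nn kr.
  have -> : (Q m).[k] - (Q n).[k] = (Q m - Q n).[k] by rewrite !hornerE.
  have -> : 4 * N.+1%:R^-1 = 2 * (2 * N.+1%:R^-1) :> R by rewrite mulrA -natrM.
  apply: (@poly_slope_bound (P m - P n) _ z r) => //.
    move=> u ur.
    have hh j : (N <= j)%N -> normc (f u - (P j).[u]) <= N.+1%:R^-1.
      move=> Nj; rewrite (le_trans (hP _ _ _))//.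
        by rewrite (le_trans ur)// (le_trans rN)// ler_nat.
      by rewrite lef_pV2 ?posrE ?ltr0n// ler_nat.
    rewrite !hornerE.
    have -> : (P m).[u] - (P n).[u] = (f u - (P n).[u]) - (f u - (P m).[u]) by ring.
    by rewrite (le_trans (normcB _ _))// mulr_natl mulr2n lerD// hh.
  by rewrite {1}hQ {1}(hQ n) !hornerE polyCB mulrBr opprD addrACA.
have arch2 (x e : R) : 0 < e -> exists N : nat, x <= N%:R /\ 4 * N.+1%:R^-1 <= e.
  move=> e1; have [N1 _ h1] := arch_bound x; have [N2 _ h2] := arch_bound (4 / e).
  exists (maxn N1 N2); split; first by rewrite (le_trans h1)// ler_nat leq_maxl.
  rewrite ler_pdivrMr ?ltr0n// mulrC -ler_pdivrMr// (le_trans h2)// ler_nat.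
  by rewrite (leq_trans (leq_maxr N1 N2)).
have /choice[g hg] : forall k, exists l, forall e : R, 0 < e -> exists N, forall n, (N <= n)%N -> normc ((Q n).[k] - l) <= e.
  move=> k; apply: complex_cauchy_limit => e e1.
  have [N [N1 N2]] := arch2 (normc k + normc z + 2) e e1.
  exists N => m n Nm Nn; rewrite (le_trans _ N2)//.
  exact: (@QC (normc k)).
have gQ r N n k : r + normc z + 2 <= N%:R -> (N <= n)%N -> normc k <= r ->
    normc (g k - (Q n).[k]) <= 4 * N.+1%:R^-1.
  move=> rN Nn kr; apply/ler_addgt0Pl => e e1.
  have [M hM] := hg k _ e1.
  have := hM (maxn M N) (leq_maxl _ _) => h1.
  have := @QC r N (maxn M N) n k rN (leq_maxr _ _) Nn kr => h2.
  have -> : g k - (Q n).[k] = (g k - (Q (maxn M N)).[k]) + ((Q (maxn M N)).[k] - (Q n).[k]) by ring.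
  by rewrite (le_trans (normcD _ _))// lerD// normcBC.
exists g.
  move=> r e e1.
  have [N [N1 N2]] := arch2 (r + normc z + 2) e e1.
  by exists (Q N) => k kr; rewrite (le_trans _ N2)//; exact: (gQ r).
move=> k; apply/eqP; rewrite -subr_eq0; apply/eqP; apply: normc_arbitrarily_small => e e1.
set d := e / (2 + normc (k - z)).
have kz := normc_ge0 (k - z).
have d0 : 0 < d by rewrite divr_gt0//; lra.
have [N [N1 N2]] := arch2 (normc k + normc z + 2) d d0.
have NN : N.+1%:R^-1 <= d by rewrite (le_trans _ N2)// ler_peMl ?ler1n// ltW.
have -> : f k - (f z + (k - z) * g k) = (f k - (P N).[k]) - (f z - (P N).[z]) - (k - z) * (g k - (Q N).[k]).
  have := congr1 (fun p => p.[k]) (hQ N); rewrite !hornerE => ->; ring.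
have hk : normc (f k - (P N).[k]) <= d by rewrite (le_trans (hP _ _ _))//; have := normc_ge0 z; lra.
have hz : normc (f z - (P N).[z]) <= d by rewrite (le_trans (hP _ _ _))//; have := normc_ge0 k; lra.
have hgk : normc (g k - (Q N).[k]) <= d by rewrite (le_trans (gQ (normc k) N N k _ _ _)).
have -> : e = d + d + normc (k - z) * d by rewrite /d; field; lra.
rewrite (le_trans (normcB _ _))// lerD//.
  by rewrite (le_trans (normcB _ _))// lerD.
by rewrite normcM ler_wpM2l.
Qed.

Lemma entire_locally_lipschitz f z : entire f ->
  exists2 K, 0 < K & forall k, normc (k - z) <= 1 -> normc (f k - f z) <= K * normc (k - z).
Proof.
move=> hf; have [g hg e] := entire_slope z hf.
have [K K0 hK] := entire_bounded (normc z + 1) hg.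
exists (1 + K); first by lra.
move=> k kz; rewrite e addrC addKr normcM mulrC ler_wpM2r ?normc_ge0//.
apply: le_trans (_ : K <= _); last by lra.
by apply: hK; rewrite -(subrK z k) addrC (le_trans (normcD _ _))// lerD2l.
Qed.

Lemma derive1_slope f g z : entire g -> (forall k, f k = f z + (k - z) * g k) ->
  derive1 (f : R[i]^o -> R[i]^o) z = g z.
Proof.
move=> hg e; rewrite derive1E; apply/cvg_lim => //=.
have [K K0 hK] := entire_locally_lipschitz z hg.
apply/cvgrPdist_le => /= eps; rewrite ltcE => /andP[/eqP ime ree].
move: ime ree; case: eps => a b /= -> a0; rewrite complexr0.
near=> h.
have h0 : h != 0 by near: h; exact: (@nbhs_dnbhs_neq R[i]^o).
have hd : `|h| <= (Num.min 1 (a / K))%:C.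
  near: h; apply: (@dnbhs0_le _ (R[i]^o : normedModType R[i])).
  by rewrite ltcR lt_min ltr01 divr_gt0.
move: hd; rewrite normcE lecR le_min => /andP[h1 h2].
rewrite [h *: _]mulr1.
have -> : g z - h^-1 *: (f (h + z) - f z : R[i]^o) = - (g (h + z) - g z).
  have -> : f (h + z) - f z = h * g (h + z) by rewrite (e (h + z)); ring.
  by rewrite -[_ *: _]/(h^-1 * _) mulKf// opprB.
rewrite normcE lecR normc_opp.
have := hK (h + z); rewrite addrK => /(_ h1) h3; rewrite (le_trans h3)//.
by rewrite mulrC -ler_pdivlMr.
Unshelve. all: by end_near. Qed.

(** The derivative of f is uniformly approximated by the derivatives of its
    polynomial approximants, by the maximum principle on a circle of radius 1
    for the difference quotient of the error. *)
Lemma entire_derive1 f : entire f ->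
  entire (derive1 (f : R[i]^o -> R[i]^o)).
Proof.
move=> hf r e e0; have e2 : 0 < e / 2 by rewrite divr_gt0.
have [p hp] := hf (r + 1) _ e2; exists p^`() => z zr.
have [g hg eg] := entire_slope z hf.
have [q eq <-] := poly_slope p z.
rewrite (derive1_slope hg eg).
have hgq : entire (fun k => g k + - 1 * q.[k]).
  by apply: entireD => //; apply: entireM; [exact: entire_cst|exact: entire_poly].
rewrite -mulN1r; apply: (entire_max_principle (r := 1) hgq) => t.
set k := z + _.
have kz : normc (k - z) = 1.
  by rewrite addrC addKr normcM normc_cis normc_real normr1 mulr1.
have kr : normc k <= r + 1.
  by rewrite -(subrK z k) addrC (le_trans (normcD _ _))// lerD ?kz.
have zr1 : normc z <= r + 1 by lra.
rewrite -[leLHS]mul1r -kz -normcM.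
have -> : (k - z) * (g k + - 1 * q.[k]) = (f k - p.[k]) - (f z - p.[z]).
  rewrite (eg k) (congr1 (fun s => s.[k]) eq) !hornerE; ring.
by rewrite [leRHS]splitr (le_trans (normcB _ _))// lerD// hp.
Qed.

Lemma derive1_entireM f g z : entire f -> entire g ->
  derive1 ((fun k => f k * g k) : R[i]^o -> R[i]^o) z =
  derive1 (f : R[i]^o -> R[i]^o) z * g z + f z * derive1 (g : R[i]^o -> R[i]^o) z.
Proof.
move=> hf hg; have [a ha fa] := entire_slope z hf; have [b hb gb] := entire_slope z hg.
rewrite (derive1_slope ha fa) (derive1_slope hb gb).
apply: (@derive1_slope _ (fun k => a k * g k + f z * b k)).
  by apply: entireD; apply: entireM => //; exact: entire_cst.
move=> k; rewrite (fa k) (gb k); ring.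
Qed.

Lemma derive1_linear_pow z m k :
  derive1 ((fun k => (k - z) ^+ m.+1) : R[i]^o -> R[i]^o) k = m.+1%:R * (k - z) ^+ m.
Proof.
have hl : entire (fun k => k - z) by apply: entireD; [exact: entire_id|exact: entire_cst].
have d1 : derive1 ((fun k => k - z) : R[i]^o -> R[i]^o) k = 1.
  apply: (@derive1_slope _ (fun=> 1)); first exact: entire_cst.
  by move=> u; ring.
elim: m => [|m ih].
  by rewrite expr0 mulr1 -d1; congr derive1.
have -> : (fun k : R[i]^o => (k - z) ^+ m.+2 : R[i]^o) = fun k => (k - z) * (k - z) ^+ m.+1.
  by apply/funext => u; rewrite exprS.
rewrite derive1_entireM//; last exact: entireX.
by rewrite d1 ih mul1r !exprS -[in RHS]natr1; ring.
Qed.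

Lemma derive1_pow_mul g z m : entire g ->
  exists2 h, entire h & h z = m.+1%:R * g z /\
   derive1 ((fun k => (k - z) ^+ m.+1 * g k) : R[i]^o -> R[i]^o) = fun k => (k - z) ^+ m * h k.
Proof.
move=> hg.
have hl : entire (fun k => k - z) by apply: entireD; [exact: entire_id|exact: entire_cst].
exists (fun k => m.+1%:R * g k + (k - z) * derive1 (g : R[i]^o -> R[i]^o) k).
  apply: entireD; apply: entireM => //; first exact: entire_cst.
  exact: entire_derive1.
split; first by rewrite subrr mul0r addr0.
apply/funext => k; rewrite derive1_entireM//; last exact: entireX.
by rewrite derive1_linear_pow exprS; ring.
Qed.

Lemma derive1n_pow_mul g z m : entire g ->
  derive1n m ((fun k => (k - z) ^+ m * g k) : R[i]^o -> R[i]^o) z = m`!%:R * g z.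
Proof.
elim: m g => [|m ih] g hg; first by rewrite derive1n0 expr0 fact0.
have [h hh [hz e]] := derive1_pow_mul z m hg.
by rewrite derive1Sn e ih// hz mulrA -natrM mulnC -factS.
Qed.

(** One factor at a time: if f = (k - z) ^ m * g, then the m-th derivative of f at
    z is m! g z, so g has a slope factor when that derivative vanishes. *)
Lemma entire_divides f z m : entire f ->
  (forall j, (j < m)%N -> derive1n j (f : R[i]^o -> R[i]^o) z = 0) ->
  exists2 g, entire g & f = fun k => (k - z) ^+ m * g k.
Proof.
move=> hf; elim: m => [_|m ih h].
  by exists f => //; apply/funext => k; rewrite expr0 mul1r.
have [j jm|g hg e] := ih; first by apply: h; rewrite ltnW.
have := h m (leqnn _); rewrite e derive1n_pow_mul// => /eqP.
rewrite mulf_eq0 pnatr_eq0 gtn_eqF ?fact_gt0//= => /eqP g0.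
have [g1 hg1 e1] := entire_slope z hg.
exists g1 => //; apply/funext => k.
by rewrite e1 g0 add0r exprSr mulrA.
Qed.

(** The factors k - a do not vanish at z, so the zero of order m belongs to g. After
    j factors k - z have been taken out of g, the identity divided by (k - z) ^ j
    holds for k != z, and the maximum principle extends it to k = z. *)
Lemma entire_divides_prod g h (s : seq R[i]) z m : entire g -> entire h ->
  z \notin s ->
  (fun k => \prod_(a <- s) (k - a) * g k) = (fun k => (k - z) ^+ m * h k) ->
  exists2 g', entire g' & g = fun k => (k - z) ^+ m * g' k.
Proof.
move=> hg hh zs e.
have pz : \prod_(a <- s) (z - a) != 0.
  rewrite prodf_seq_neq0; apply/allP => a ain /=; rewrite subr_eq0.
  by apply: contraNneq zs => ->.
suff : forall j, (j <= m)%N -> exists2 g', entire g' & g = fun k => (k - z) ^+ j * g' k.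
  by apply.
elim=> [_|j ih jm].
  by exists g => //; apply/funext => k; rewrite expr0 mul1r.
have [g' hg' eg] := ih (ltnW jm).
have [g1 hg1 e1] := entire_slope z hg'.
suff g0 : g' z = 0.
  by exists g1 => //; rewrite eg; apply/funext => k; rewrite e1 g0 add0r exprSr mulrA.
set P := fun k => \prod_(a <- s) (k - a).
have hP : entire P.
  by apply: entire_prod => a; apply: entireD; [exact: entire_id|exact: entire_cst].
set D := fun k => P k * g' k + - 1 * ((k - z) ^+ (m - j) * h k).
have hD : entire D.
  apply: entireD; apply: entireM => //; first exact: entire_cst.
  apply: entireM => //; apply: entireX.
  by apply: entireD; [exact: entire_id|exact: entire_cst].
have D0 k : k != z -> D k = 0.
  move=> kz; have k0 : (k - z) ^+ j != 0 by rewrite expf_neq0// subr_eq0.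
  apply: (mulfI k0); rewrite mulr0 /D.
  have := congr1 (fun f => f k) e; rewrite /= eg -/(P k) -{1}(subnKC (ltnW jm)) exprD => e2.
  have -> : (k - z) ^+ j * (P k * g' k + -1 * ((k - z) ^+ (m - j) * h k)) =
    P k * ((k - z) ^+ j * g' k) - (k - z) ^+ j * (k - z) ^+ (m - j) * h k by ring.
  by rewrite e2 subrr.
have : normc (D z) <= 0.
  apply: (entire_max_principle (r := 1) hD) => t.
  rewrite D0 ?normc0// -subr_eq0 addrC addKr -normc_gt0 normcM normc_cis normc_real.
  by rewrite normr1 mulr1.
rewrite /D subrr expr0n subn_eq0 leqNgt jm/= mul0r mulr0 addr0 => h0.
apply: eq0_normc; apply/eqP; rewrite eq_le normc_ge0 andbT.
have : 0 < normc (P z) by rewrite normc_gt0.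
by move: h0; rewrite normcM => h0 P0; rewrite -(pmulr_rle0 _ P0).
Qed.

End EntireDivision.

(** * Real inequalities *)

Section RealInequalities.
Variable R : realType.
Implicit Types (x y t s h : R).

Lemma sin_le_id x : 0 <= x -> sin x <= x.
Proof.
rewrite le_eqVlt => /predU1P[<-|x0]; first by rewrite sin0.
have [|c _] := @MVT R (@sin R) (@cos R) 0 x x0.
- by apply: continuous_subspaceT => y; exact: continuous_sin.
- by rewrite sin0 !subr0 => ->; apply: ler_piMl; [exact: ltW|exact: cos_le1].
Qed.

Lemma cos_ge_parabola x : 0 <= x -> 1 - x ^+ 2 / 2 <= cos x.
Proof.
move=> x0; have e : cos x = 1 - 2 * sin (x / 2) ^+ 2.
  have -> : cos x = cos (x / 2 *+ 2) by rewrite -[_ *+ 2]mulr_natr divfK.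
  by rewrite cos_mulr2n cos2sin2; ring.
have hs : `|sin (x / 2)| <= x / 2.
  have [xp|xp] := leP x 2.
    rewrite ger0_norm ?sin_le_id ?divr_ge0//.
    have [->|x0'] := eqVneq x 0; first by rewrite mul0r sin0.
    apply: ltW; apply: sin2_gt0; rewrite divr_gt0 ?lt0r ?x0'//=; lra.
  by rewrite (le_trans (sin_max _))//; lra.
have : sin (x / 2) ^+ 2 <= (x / 2) ^+ 2.
  by rewrite -[leLHS]real_normK ?num_real// ler_pXn2r// ?nnegrE ?divr_ge0.
rewrite e; nra.
Qed.

Lemma sin_ge_cubic x : 0 <= x -> x - x ^+ 3 / 6 <= sin x.
Proof.
rewrite le_eqVlt => /predU1P[<-|x0]; first by rewrite sin0; lra.
have [||c c0] := @MVT R (fun x => sin x - x + x ^+ 3 / 6) (fun x => cos x - 1 + x ^+ 2 / 2) 0 x x0.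
- move=> y _; apply: is_derive_eq.
  by rewrite /GRing.scale/=; field.
- apply: continuous_subspaceT => y; apply: cvgD; first apply: cvgB => //.
  + exact: continuous_sin.
  + by apply: cvgMl; apply: exprn_continuous.
- rewrite sin0 !subr0 expr0n/= mul0r addr0 subr0 => e.
  have : 0 <= cos c - 1 + c ^+ 2 / 2.
    have := @cos_ge_parabola c; move: c0; rewrite in_itv/= => /andP[c0 _] /(_ (ltW c0)); lra.
  by move=> h; have := mulr_ge0 h (ltW x0); rewrite -e; lra.
Qed.

Lemma sum_sin_telescope (m : nat) (x h : R) :
  (\sum_(j < m) sin (x + j%:R * h)) * (2 * sin (h / 2)) =
  cos (x - h / 2) - cos (x + m%:R * h - h / 2).
Proof.
elim: m => [|m ih]; first by rewrite big_ord0 mul0r mul0r addr0 subrr.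
have -> : x + m.+1%:R * h - h / 2 = (x + m%:R * h) + h / 2 by rewrite -natr1; field.
rewrite big_ord_recr/= [LHS]mulrDl ih.
by rewrite cosB (cosD (x + m%:R * h) (h / 2)) cosB; ring.
Qed.

(** Replacing x by x + pi / m permutes the terms, as |sin| has period pi; hence
    x may be taken in [0, pi / m], where the sines are nonnegative and the sum
    telescopes. Divided by m this is the discrete form of the fact that |sin| has
    mean 2 / pi. *)
Lemma sum_abs_sin (m : nat) (x : R) : (0 < m)%N ->
  (\sum_(j < m) `|sin (x + j%:R * (pi / m%:R))|) * sin (pi / m%:R / 2) <= 1.
Proof.
move=> m0; set h := pi / m%:R.
have mR : 0 < m%:R :> R by rewrite ltr0n.
have h0 : 0 < h by rewrite divr_gt0 ?pi_gt0.
have mh : m%:R * h = pi by rewrite /h mulrC divfK ?gt_eqF.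
pose S x := \sum_(j < m) `|sin (x + j%:R * h)|.
have hle : h <= pi by rewrite /h ler_pdivrMr// ler_peMr ?pi_ge0// ler1n.
have sh0 : 0 < sin (h / 2) by apply: sin_gt0_pi; rewrite divr_gt0//=; lra.
have shift y : S (y + h) = S y.
  rewrite /S; case: m m0 mR @h h0 mh @S hle sh0 => // m _ mR h h0 mh S hle sh0.
  rewrite big_ord_recr big_ord_recl/= addrC; congr (_ + _).
    have -> : y + h + m%:R * h = y + pi by rewrite -mh -natr1; ring.
    by rewrite sinDpi normrN mul0r addr0.
  apply: eq_bigr => i _; congr (`|sin _|); rewrite /bump/= add1n -natr1; ring.
have shiftn n y : S (y + n%:R * h) = S y.
  elim: n => [|n ih]; first by rewrite mul0r addr0.
  by rewrite -natr1 mulrDl mul1r addrA shift.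
have base y : 0 <= y <= h -> S y * sin (h / 2) <= 1.
  move=> /andP[y0 yh].
  have -> : S y = \sum_(j < m) sin (y + j%:R * h).
    apply: eq_bigr => j _; rewrite ger0_norm// sin_ge0_pi//.
    have jh0 : 0 <= j%:R * h by apply: mulr_ge0 => //; exact: ltW.
    rewrite addr_ge0//= -mh (_ : m%:R = m.-1%:R + 1); last by rewrite natr1 prednK.
    by rewrite mulrDl mul1r addrC lerD// ler_pM2r// ler_nat -ltnS prednK.
  have := sum_sin_telescope m y h; rewrite mh.
  have -> : y + pi - h / 2 = (y - h / 2) + pi by ring.
  rewrite cosDpi opprK => e.
  have := cos_le1 (y - h / 2); lra.
rewrite -/(S x).
have [n [y [yh e]]] : exists n : nat, exists y, 0 <= y <= h /\ (x = y + n%:R * h \/ y = x + n%:R * h).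
  pose N := Num.floor (x / h).
  have := floor_itv (x / h); rewrite -/N => /andP[N1 N2].
  exists `|N|%N; exists (x - N%:~R * h).
  have -> : (0 <= x - N%:~R * h <= h).
    rewrite subr_ge0 -ler_pdivlMr// N1/= lerBlDr.
    have -> : h + N%:~R * h = (N + 1)%:~R * h by rewrite intrD; ring.
    by rewrite -ler_pdivrMr// ltW.
  split=> //; case: N {N1 N2} => n /=; [left|right].
    by rewrite subrK.
  by rewrite NegzE mulrNz mulNr opprK.
have := base y yh; case: e => [->|e]; first by rewrite shiftn.
by rewrite e shiftn.
Qed.

(** The tangent of exp at t * x lies below exp at x and at 0. *)
Lemma expR_chord t x : 0 <= t <= 1 -> expR (t * x) <= t * expR x + (1 - t).
Proof.
move=> /andP[t0 t1].
have h1 : expR (t * x) * (1 + (1 - t) * x) <= expR x.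
  have -> : expR x = expR (t * x) * expR ((1 - t) * x) by rewrite -expRD; congr expR; ring.
  by rewrite ler_pM2l ?expR_gt0// expR_ge1Dx.
have h2 : expR (t * x) * (1 - t * x) <= 1.
  rewrite -[leRHS](_ : expR (t * x) * expR (- (t * x)) = 1); last by rewrite -expRD subrr expR0.
  by rewrite ler_pM2l ?expR_gt0// expR_ge1Dx.
have t1' : 0 <= 1 - t by lra.
have := ler_wpM2l t0 h1; have := ler_wpM2l t1' h2.
set E := expR (t * x); lra.
Qed.

(** As a function of t the logarithm of 1 - p + p * exp (t * s) is convex and
    vanishes at 0, hence lies below its chord on [0, 1]. This turns an additive
    bound into an exponential one with a rate that is linear in t. *)
Lemma log_mean_exp_chord t s (p : R) : 0 <= t <= 1 -> 0 <= p <= 1 -> 0 <= s ->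
  1 + p * (expR (t * s) - 1) <= expR (t * ln (1 + p * (expR s - 1))).
Proof.
move=> t01 /andP[p0 p1] s0.
set B := 1 + p * (expR s - 1).
have B0 : 0 < B.
  by rewrite /B ltr_pwDl// mulr_ge0// subr_ge0 -expR0 ler_expR.
have eB : expR (ln B) = B by rewrite lnK.
have q0 : 0 <= 1 - p by lra.
have h1 := expR_chord (- ln B) t01.
have h2 := expR_chord (s - ln B) t01.
have := lerD (ler_wpM2l q0 h1) (ler_wpM2l p0 h2).
have -> : (1 - p) * (t * expR (- ln B) + (1 - t)) + p * (t * expR (s - ln B) + (1 - t)) = 1.
  rewrite expRD !expRN eB /B; field.
  by rewrite gt_eqF// -/B.
have -> : (1 - p) * expR (t * - ln B) + p * expR (t * (s - ln B)) =
   (1 + p * (expR (t * s) - 1)) * expR (- (t * ln B)).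
  by rewrite mulrN mulrBr expRD; ring.
by rewrite expRN ler_pdivrMr ?expR_gt0// mul1r.
Qed.

End RealInequalities.

(** * Jensen's inequality *)

Section Jensen.
Variable R : realType.
Implicit Types (f g w : R[i] -> R[i]) (z k c : R[i]) (x y : R).

Lemma cisDpi x : cis (x + pi) = - cis x.
Proof. by rewrite cisD cis_pi mulrN1. Qed.

(** Take m-th roots in X ^ m <= K ^ m * exp (L / sin (pi / 2m)) and let m grow:
    m * sin (pi / 2m) tends to pi / 2. *)
Lemma pi_mean_limit (X K L : R) : 0 <= X -> 0 < K -> 0 <= L ->
  (forall m : nat, (0 < m)%N -> exists2 s : R, X ^+ m <= K ^+ m * expR (L * s) &
     s * sin (pi / m%:R / 2) <= 1) ->
  X <= K * expR (L * (2 / pi)).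
Proof.
move=> X0 K0 L0 h; have p0 : 0 < pi :> R := pi_gt0 R.
rewrite leNgt; apply/negP => hX.
have Xp : 0 < X by rewrite (lt_trans _ hX)// mulr_gt0// expR_gt0.
set d := ln (X / K) - L * (2 / pi).
have d0 : 0 < d.
  rewrite subr_gt0 -ltr_expR lnK ?posrE ?divr_gt0//.
  by rewrite ltr_pdivlMr// mulrC.
(* the hypothesis fails for m with m * d > pi * L; taking also m >= 4 keeps
   pi / 2m in the range where sin is nearly linear *)
have [m0 hm] : exists m : nat, pi * L / d < m%:R.
  exists (Num.truncn `|pi * L / d|).+1; rewrite (le_lt_trans (ler_norm _))//.
  by rewrite truncnS_gt.
pose m := (m0 + 4)%N.
have mp : (0 < m)%N by rewrite /m addn_gt0 orbT.
have mR : 0 < m%:R :> R by rewrite ltr0n.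
have m4 : 4 <= m%:R :> R by rewrite ler_nat /m leq_addl.
have [s hs1 hs2] := h m mp.
have hs3 : m%:R * ln (X / K) <= L * s.
  rewrite -ler_expR expRM_natl lnK ?posrE ?divr_gt0//.
  by rewrite expr_div_n ler_pdivrMr ?exprn_gt0// mulrC.
pose u := pi / m%:R / 2 : R.
have u0 : 0 < u by rewrite !divr_gt0.
have pi4 : pi <= 4 :> R by have := @pihalf_lt2 R; lra.
have u1 : u <= 1 / 2.
  by rewrite /u ler_pM2r// ler_pdivrMr// mul1r (le_trans pi4).
have us : u - u ^+ 3 / 6 <= sin u by apply: sin_ge_cubic; exact: ltW.
have su : 1 - u ^+ 2 / 6 <= sin u / u.
  by rewrite ler_pdivlMr// (le_trans _ us)//; lra.
have u2 : 0 <= u ^+ 2 by exact: sqr_ge0.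
have u4 : u ^+ 2 <= 1 / 4 by nra.
have s0 : 0 < sin u.
  rewrite (lt_le_trans _ us)// (_ : u - _ = u * (1 - u ^+ 2 / 6)); last by field.
  by rewrite mulr_gt0//; lra.
(* s <= 1 / sin u <= (1 + u^2) / u *)
have su2 : s * u <= 1 + u ^+ 2.
  have [sn|sp] := leP s 0; first by nra.
  have : s * (u * (1 - u ^+ 2 / 6)) <= 1.
    rewrite (le_trans _ hs2)// ler_wpM2l ?(ltW sp)//.
    by rewrite (le_trans _ us)//; lra.
  set a := s * u; rewrite mulrA -/a => ha.
  have a0 : 0 < a by rewrite mulr_gt0.
  nra.
have mu : m%:R * u = pi / 2 by rewrite /u; field; rewrite gt_eqF.
have e1 : ln (X / K) = d + L * (2 / pi) by rewrite /d subrK.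
clearbody d u.
have : m%:R * u * (d + L * (2 / pi)) <= L * (1 + u ^+ 2).
  rewrite -e1 mulrAC (le_trans (ler_wpM2r (ltW u0) hs3))//.
  by rewrite -mulrA ler_wpM2l.
rewrite mu.
have cancel_pi (p : R) : p != 0 -> p / 2 * (d + L * (2 / p)) = p / 2 * d + L.
  by move=> pn; field.
rewrite cancel_pi ?gt_eqF//.
move=> h1.
have h2 : pi / 2 * d <= L * u ^+ 2 by lra.
have h3 : pi / 2 * d * m%:R <= L * u * (pi / 2).
  have -> : L * u * (pi / 2) = L * u ^+ 2 * m%:R by rewrite -mu; ring.
  by rewrite ler_wpM2r// ltW.
have h4 : pi * L < m%:R * d.
  rewrite -ltr_pdivrMr// (lt_le_trans hm)// ler_nat leq_addr//.
have h5 : d * m%:R <= L * u.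
  rewrite -(@ler_pM2l _ (pi / 2)) ?divr_gt0//.
  by rewrite mulrA (le_trans h3)// mulrC.
have Lu : L * u <= L by nra.
have pL : 2 * L <= pi * L by rewrite ler_wpM2r// pi_ge2.
by rewrite mulrC in h5; lra.
Qed.

(** Jensen's inequality. The logarithmic mean of the modulus of w over a circle
    is replaced by its mean over the vertices of a regular polygon: the product
    of the copies of a function rotated by these vertices is entire, and the
    maximum principle for this product bounds its value at the centre. The
    hypothesis is on antipodal pairs because for a function that grows
    exponentially on one side only, the rates at t and t + pi add up to a
    multiple of |sin t|. *)
Theorem jensen_inequality w g (s : seq R[i]) c (r rad K L : R) :
  entire g -> (forall k, w k = \prod_(a <- s) (k - a) * g k) ->
  0 < r < rad -> (forall a, a \in s -> normc (a - c) <= r) ->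
  0 < K -> 0 <= L ->
  (forall t, normc (w (c + rad%:C * cis t)) * normc (w (c - rad%:C * cis t)) <=
     K * expR (L * `|sin t|)) ->
  normc (w c) ^+ 2 * (rad / r) ^+ (2 * size s) <= K * expR (L * (2 / pi)).
Proof.
move=> hg wE /andP[r0 rrad] hs K0 L0 hw.
have rad0 : 0 < rad := lt_trans r0 rrad.
(* Blaschke: the factors k - a are replaced by factors of the same modulus on
   the circle that have no zeros in the disk *)
pose h z := \prod_(a <- s) (rad%:C - (a - c)^*%C / rad%:C * z) * g (c + z).
have hh : entire h.
  apply: entireM.
    apply: entire_prod => a.
    apply: (entire_ext _ (entireD (entire_cst rad%:C) (entireM (entire_cst (- ((a - c)^*%C / rad%:C))) (@entire_id R)))) => k.
    by rewrite mulNr.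
  by apply: (entire_ext _ (entire_affine c 1 hg)) => k; rewrite mul1r.
have radC : rad%:C != 0 :> R[i] by apply/eqP => -[] /eqP; rewrite gt_eqF.
have h_circle t : normc (h (rad%:C * cis t)) = normc (w (c + rad%:C * cis t)).
  rewrite /h wE !normcM !normc_prod; congr (_ * _); apply: eq_bigr => a _.
  rewrite mulrA divfK//.
  have -> : c + rad%:C * cis t - a = rad%:C * cis t - (a - c) by ring.
  case: (a - c) => u v; rewrite /cis/=; congr Num.sqrt.
  by have := cos2Dsin2 t; nra.
have h_center : normc (w c) * (rad / r) ^+ size s <= normc (h 0).
  rewrite /h wE addr0 !normcM !normc_prod mulrAC ler_wpM2r ?normc_ge0//.
  elim: s hs {h hh wE h_circle} => [|a s ih] hs.
    by rewrite !big_nil expr0 mulr1.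
  rewrite !big_cons /= exprS mulr0 subr0 normc_real (gtr0_norm rad0).
  rewrite mulrACA ler_pM ?mulr_ge0 ?divr_ge0 ?normc_ge0 ?(ltW rad0) ?(ltW r0)//.
  - by rewrite invr_ge0 ltW.
  - by apply: prodr_ge0 => b _; exact: normc_ge0.
  - by apply: exprn_ge0; rewrite divr_ge0// ltW.
  - rewrite mulrCA ger_pMr// ler_pdivrMr// mul1r normcBC.
    by rewrite hs// mem_head.
  - by apply: ih => b bs; apply: hs; rewrite inE bs orbT.
have X0 : 0 <= normc (h 0) ^+ 2 by exact: sqr_ge0.
apply: (@le_trans _ _ (normc (h 0) ^+ 2)).
  rewrite mulnC exprM -exprMn ler_pXn2r// ?nnegrE ?normc_ge0//.
  by rewrite mulr_ge0 ?normc_ge0// exprn_ge0// divr_ge0// ltW.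
apply: pi_mean_limit => // m m0.
pose F t := \prod_(j < m) (h (cis (j%:R * (pi / m%:R)) * t) * h (- cis (j%:R * (pi / m%:R)) * t)).
have hF : entire F.
  apply: entire_prod => j; apply: entireM.
    by apply: (entire_ext _ (entire_affine 0 (cis (j%:R * (pi / m%:R))) hh)) => k; rewrite add0r.
  by apply: (entire_ext _ (entire_affine 0 (- cis (j%:R * (pi / m%:R))) hh)) => k; rewrite add0r.
have F0 : normc (F 0) = (normc (h 0) ^+ 2) ^+ m.
  rewrite /F normc_prod -[in RHS](card_ord m) -prodr_const; apply: eq_bigr => j _.
  by rewrite !mulr0 normcM.
have s0 : 0 < sin (pi / m%:R / 2) :> R.
  apply: sin_gt0_pi; rewrite !divr_gt0 ?pi_gt0 ?ltr0n//=.
  rewrite ltr_pdivrMr// ltr_pdivrMr ?ltr0n//.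
  rewrite -mulrA ltr_pMr ?pi_gt0// -natrM ltr1n; case: m m0 {F hF F0} => // m _.
  by rewrite mulnS.
exists (sin (pi / m%:R / 2))^-1; last by rewrite mulVf ?gt_eqF.
rewrite -F0; apply: (entire_max_principle (r := rad) hF) => t; rewrite add0r.
rewrite /F normc_prod.
apply: (@le_trans _ _ (\prod_(j < m) (K * expR (L * `|sin (t + j%:R * (pi / m%:R))|)))).
  apply: ler_prod => j _; rewrite normc_ge0/= normcM.
  have -> : cis (j%:R * (pi / m%:R)) * (rad%:C * cis t) = rad%:C * cis (t + j%:R * (pi / m%:R)).
    by rewrite cisD; ring.
  have -> : - cis (j%:R * (pi / m%:R)) * (rad%:C * cis t) = rad%:C * cis (t + j%:R * (pi / m%:R) + pi).
    by rewrite cisDpi (cisD t); ring.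
  rewrite !h_circle (le_trans _ (hw _))//.
  by rewrite cisDpi mulrN.
rewrite big_split/= prodr_const card_ord ler_pM2l ?exprn_gt0//.
rewrite -expR_sum -mulr_sumr ler_expR ler_wpM2l//.
rewrite -[leRHS]mul1r ler_pdivlMr//.
exact: sum_abs_sin.
Qed.

End Jensen.

(** * Integration of complex-valued functions *)

Section ComplexIntegral.
Variable R : realType.
Local Notation mu := (@lebesgue_measure R).
Local Notation measurable D := (measurable (D : set (measurableTypeR R))).
Implicit Types (f g q h : R -> R[i]) (a b x y u v : R) (z k c : R[i]) (D : set R).

Lemma integrable_ext D (F G : R -> \bar R) : mu.-integrable D F -> F =1 G ->
  mu.-integrable D G.
Proof. by move=> h /funext <-. Qed.

Lemma cintegrableD D f g : measurable D -> cintegrable D f -> cintegrable D g ->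
  cintegrable D (fun x => f x + g x).
Proof.
move=> mD [f1 f2] [g1 g2]; split.
  apply: (integrable_ext (integrableD mD f1 g1)) => x /=.
  by rewrite /re_part cReD.
apply: (integrable_ext (integrableD mD f2 g2)) => x /=.
by rewrite /im_part cImD.
Qed.

Lemma cintegrableZ D f c : measurable D -> cintegrable D f ->
  cintegrable D (fun x => c * f x).
Proof.
move=> mD [f1 f2]; split.
  apply: (integrable_ext (integrableB mD (integrableZl mD (complex.Re c) f1) (integrableZl mD (complex.Im c) f2))) => x /=.
  by rewrite /re_part cReM.
apply: (integrable_ext (integrableD mD (integrableZl mD (complex.Re c) f2) (integrableZl mD (complex.Im c) f1))) => x /=.
by rewrite /im_part cImM.
Qed.

Lemma cintegrableS D E f : measurable D -> measurable E -> D `<=` E ->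
  cintegrable E f -> cintegrable D f.
Proof. by move=> mD mE DE [f1 f2]; split; [exact: integrableS f1|exact: integrableS f2]. Qed.

Lemma cintegralD D f g : measurable D -> cintegrable D f -> cintegrable D g ->
  cintegral D (fun x => f x + g x) = cintegral D f + cintegral D g.
Proof.
move=> mD [f1 f2] [g1 g2]; apply: complex_eq; rewrite ?cReD ?cImD/=.
  by rewrite -RintegralD//; apply: eq_Rintegral => x _; rewrite /re_part cReD.
by rewrite -RintegralD//; apply: eq_Rintegral => x _; rewrite /im_part cImD.
Qed.

Lemma cintegralZ D f c : measurable D -> cintegrable D f ->
  cintegral D (fun x => c * f x) = c * cintegral D f.
Proof.
have hZ r (u : R -> R) : measurable D -> mu.-integrable D (EFin \o u) ->
    mu.-integrable D (EFin \o (fun x => r * u x)).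
  move=> mD iu; apply: (integrable_ext (integrableZl mD r iu)) => x /=.
  by rewrite EFinM.
move=> mD [f1 f2]; apply: complex_eq; rewrite ?cReM ?cImM/=.
  rewrite -!RintegralZl// -RintegralB; [|by []|exact: hZ|exact: hZ].
  by apply: eq_Rintegral => x _; rewrite /re_part cReM.
rewrite -!RintegralZl// -RintegralD; [|by []|exact: hZ|exact: hZ].
by apply: eq_Rintegral => x _; rewrite /im_part cImM.
Qed.

Lemma measurable_normc D f : measurable D -> cintegrable D f ->
  measurable_fun D (fun x => normc (f x)).
Proof.
move=> mD [/integrableP[/measurable_EFinP f1 _] /integrableP[/measurable_EFinP f2 _]].
have -> : (fun x => normc (f x)) =
    (@Num.sqrt R) \o (fun x => re_part f x ^+ 2 + im_part f x ^+ 2).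
  by apply/funext => x /=; rewrite /re_part /im_part; case: (f x).
apply: measurableT_comp; first exact: continuous_measurable_fun (@sqrt_continuous R).
by apply: measurable_funD; exact: measurable_funX.
Qed.

Lemma integrable_normc D f : measurable D -> cintegrable D f ->
  mu.-integrable D (EFin \o (fun x => normc (f x))).
Proof.
move=> mD fi; have [f1 f2] := fi.
apply: (le_integrable mD _ _ (integrableD mD (integrable_norm f1) (integrable_norm f2))).
  by apply/measurable_EFinP; exact: measurable_normc.
move=> x Dx /=; rewrite lee_fin (ger0_norm (normc_ge0 _)).
by rewrite (le_trans (normc_leD _))// ler_norm.
Qed.

(** Rotate the value of the integral onto the positive axis. *)
Lemma normc_cintegral_le D f : measurable D -> cintegrable D f ->
  normc (cintegral D f) <= Rintegral mu D (fun x => normc (f x)).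
Proof.
move=> mD fi; set I := cintegral D f.
have [->|I0] := eqVneq I 0.
  by rewrite normc0 Rintegral_ge0// => x _; exact: normc_ge0.
have nI : 0 < normc I by rewrite normc_gt0.
pose u := I^*%C / (normc I)%:C.
have nu : normc u = 1.
  rewrite /u normcM normcV normc_real ger0_norm ?normc_ge0//.
  have -> : normc I^*%C = normc I by case: (I) => x y /=; rewrite sqrrN.
  by rewrite divff// gt_eqF.
have uI : u * I = (normc I)%:C.
  have nc : (normc I)%:C != 0 by apply/eqP => -[] /eqP; rewrite gt_eqF.
  apply: (mulIf nc); rewrite /u mulrAC divfK//.
  have := sqr_normc I.
  move: (normc I) => r; case: (I) => x y /= e; apply: complex_eq => /=.
    have -> : x * x - - y * y = x ^+ 2 + y ^+ 2 by ring.
    by rewrite -e; ring.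
  by ring.
have -> : normc I = complex.Re (cintegral D (fun x => u * f x)).
  by rewrite cintegralZ// uI.
have [i1 i2] := cintegrableZ u mD fi.
apply: le_Rintegral => //; first exact: integrable_normc.
move=> x Dx; rewrite /re_part (le_trans (ler_norm _))// (le_trans (normc_Re _))//.
by rewrite normcM nu mul1r.
Qed.

Lemma Rintegral_itv_split (u : R -> R) a b x : a <= b -> b <= x ->
  mu.-integrable `[a, x] (EFin \o u) ->
  Rintegral mu `[a, x] u = Rintegral mu `[a, b] u + Rintegral mu `[b, x] u.
Proof.
move=> ab bx iu.
have e := @Rintegral_itvB R u (BLeft a) (BRight x) b iu.
rewrite -[LHS](subrK (Rintegral mu `[a, b] u)) e ?bnd_simp// addrC.
rewrite Rintegral_itv_obnd_cbnd//; apply: integrableS iu => //.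
by apply: subset_itvr; rewrite bnd_simp.
Qed.

Lemma cintegral_itv_split f a b x : a <= b -> b <= x -> cintegrable `[a, x] f ->
  cintegral `[a, x] f = cintegral `[a, b] f + cintegral `[b, x] f.
Proof.
move=> ab bx [f1 f2]; apply: complex_eq; rewrite ?cReD ?cImD/=;
  exact: Rintegral_itv_split.
Qed.

Lemma Rintegral_itv1 (u : R -> R) a : Rintegral mu `[a, a] u = 0.
Proof. by rewrite set_itv1 Rintegral_set1. Qed.

Lemma cintegral_itv1 f a : cintegral `[a, a] f = 0.
Proof. by apply: complex_eq; rewrite /= Rintegral_itv1. Qed.

Lemma Rintegral_cst_itv a b (r : R) : a <= b -> Rintegral mu `[a, b] (fun=> r) = r * (b - a).
Proof.
move=> ab; rewrite Rintegral_cst//; congr (_ * _).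
rewrite [X in fine X](_ : _ = (b - a)%:E)//.
apply: (etrans (lebesgue_measure_itv `[a, b])) => /=.
move: ab; rewrite le_eqVlt => /predU1P[->|ab]; first by rewrite lte_fin ltxx subrr.
by rewrite lte_fin ab -EFinB.
Qed.

Definition ccontinuous f := continuous (re_part f) /\ continuous (im_part f).

Lemma continuous_bounded_itv (u : R -> R) a b : continuous u ->
  [bounded u x | x in `[a, b]%classic].
Proof.
move=> cu; have : compact (u @` `[a, b]).
  by apply: continuous_compact; [exact: continuous_subspaceT|exact: segment_compact].
by move=> /compact_bounded[M [Mr h]]; exists M; split=> // x Mx y /= aby; apply: h => //; exists y.
Qed.

Lemma integrable_mul_continuous (u v : R -> R) a b :
  mu.-integrable `[a, b] (EFin \o u) -> continuous v ->
  mu.-integrable `[a, b] (EFin \o (fun x => u x * v x)).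
Proof.
move=> iu cv.
have mv : measurable_fun (`[a, b] : set (measurableTypeR R)) v by apply: measurable_funTS; exact: continuous_measurable_fun.
have h := @integrableMl _ (measurableTypeR R) R mu `[a, b] (measurable_itv _) _ _ iu mv (continuous_bounded_itv a b cv).
by apply: (integrable_ext h).
Qed.

Lemma cintegrable_mul_continuous q h a b : cintegrable `[a, b] q -> ccontinuous h ->
  cintegrable `[a, b] (fun x => q x * h x).
Proof.
move=> [q1 q2] [h1 h2].
have mI : measurable `[a, b] by exact: measurable_itv.
split.
  apply: (integrable_ext (integrableB mI (integrable_mul_continuous q1 h1) (integrable_mul_continuous q2 h2))) => x /=.
  by rewrite /re_part cReM.
apply: (integrable_ext (integrableD mI (integrable_mul_continuous q1 h2) (integrable_mul_continuous q2 h1))) => x /=.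
by rewrite /im_part cImM.
Qed.

Lemma cintegrable_continuous h a b : ccontinuous h -> cintegrable `[a, b] h.
Proof.
by move=> [h1 h2]; split; apply: (@continuous_compact_integrable R _ `[a, b]);
  by [exact: segment_compact|exact: continuous_subspaceT].
Qed.

Lemma normc_cintegral_mul_le q h a b (M : R) : cintegrable `[a, b] q -> ccontinuous h ->
  (forall x, a <= x <= b -> normc (h x) <= M) ->
  normc (cintegral `[a, b] (fun x => q x * h x)) <=
    Rintegral mu `[a, b] (fun x => normc (q x)) * M.
Proof.
move=> iq ch hM; have mI : measurable `[a, b] by exact: measurable_itv.
have iqh := cintegrable_mul_continuous iq ch.
rewrite (le_trans (normc_cintegral_le _ iqh))//.
rewrite -RintegralZr//; last exact: integrable_normc.
apply: le_Rintegral => //; first exact: integrable_normc.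
  by apply: (integrable_ext (integrableZr mI M (integrable_normc mI iq))) => x /=.
by move=> x /=; rewrite in_itv/= => xab; rewrite normcM ler_wpM2l ?normc_ge0 ?hM.
Qed.

Lemma normc_cintegral_continuous_le h a b (M : R) : a <= b -> ccontinuous h ->
  (forall x, a <= x <= b -> normc (h x) <= M) ->
  normc (cintegral `[a, b] h) <= (b - a) * M.
Proof.
move=> ab ch hM; have ih := cintegrable_continuous a b ch.
rewrite (le_trans (normc_cintegral_le _ ih))// mulrC -Rintegral_cst_itv//.
apply: le_Rintegral => //; first exact: integrable_normc.
  apply: (@continuous_compact_integrable R _ `[a, b]); first exact: segment_compact.
  by apply: continuous_subspaceT => x; exact: cst_continuous.
Qed.

Lemma cintegral_cst a b c : a <= b -> cintegral `[a, b] (fun=> c) = (b - a)%:C * c.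
Proof.
move=> ab; apply: complex_eq; rewrite ?cReM ?cImM/= /re_part /im_part Rintegral_cst_itv//;
 ring.
Qed.

Lemma aeS (P Q : R -> Prop) : (forall x, P x -> Q x) ->
  {ae mu, forall x, P x} -> {ae mu, forall x, Q x}.
Proof. by move=> PQ; apply: (@filterS _ _ (ae_filter_ringOfSetsType mu)). Qed.

Lemma aeI (P Q : R -> Prop) : {ae mu, forall x, P x} -> {ae mu, forall x, Q x} ->
  {ae mu, forall x, P x /\ Q x}.
Proof. exact: (@filterI _ _ (ae_filter_ringOfSetsType mu)). Qed.

Lemma ae_eq_cintegral D f g : measurable D -> cintegrable D f -> cintegrable D g ->
  {ae mu, forall x, D x -> f x = g x} -> cintegral D f = cintegral D g.
Proof.
move=> mD [f1 f2] [g1 g2] h; apply: complex_eq => /=; congr fine.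
  apply: ae_eq_integral => //; [exact: measurable_int f1|exact: measurable_int g1|].
  by apply: aeS h => x h Dx; rewrite /re_part h.
apply: ae_eq_integral => //; [exact: measurable_int f2|exact: measurable_int g2|].
by apply: aeS h => x h Dx; rewrite /im_part h.
Qed.

Lemma ccontinuousD f g : ccontinuous f -> ccontinuous g -> ccontinuous (fun x => f x + g x).
Proof.
move=> [f1 f2] [g1 g2]; split=> x.
  have -> : re_part (fun x => f x + g x) = (re_part f + re_part g).
    by apply/funext => y; rewrite /re_part cReD.
  by apply: cvgD; [exact: f1|exact: g1].
have -> : im_part (fun x => f x + g x) = (im_part f + im_part g).
  by apply/funext => y; rewrite /im_part cImD.
by apply: cvgD; [exact: f2|exact: g2].
Qed.

Lemma ccontinuousM f g : ccontinuous f -> ccontinuous g -> ccontinuous (fun x => f x * g x).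
Proof.
move=> [f1 f2] [g1 g2]; split=> x.
  have -> : re_part (fun x => f x * g x) = (re_part f * re_part g - im_part f * im_part g).
    by apply/funext => y; rewrite /re_part cReM.
  by apply: cvgB; apply: cvgM; [exact: f1|exact: g1|exact: f2|exact: g2].
have -> : im_part (fun x => f x * g x) = (re_part f * im_part g + im_part f * re_part g).
  by apply/funext => y; rewrite /im_part cImM.
by apply: cvgD; apply: cvgM; [exact: f1|exact: g2|exact: f2|exact: g1].
Qed.

Lemma ccontinuous_cst c : ccontinuous (fun=> c).
Proof. by split; exact: cst_continuous. Qed.

Lemma re_part_cexp u v :
  re_part (fun x => cexp ((u +i* v) * x%:C)) = (fun x => expR (u * x) * cos (v * x)).
Proof. by apply/funext => y; rewrite /re_part /cexp cReM/= !mulr0 subr0 add0r mul0r subr0. Qed.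

Lemma im_part_cexp u v :
  im_part (fun x => cexp ((u +i* v) * x%:C)) = (fun x => expR (u * x) * sin (v * x)).
Proof. by apply/funext => y; rewrite /im_part /cexp cImM/= !mulr0 subr0 add0r mul0r addr0. Qed.

Lemma ccontinuous_cexp c : ccontinuous (fun x => cexp (c * x%:C)).
Proof.
have lin (r : R) : continuous (fun x : R => r * x).
  by move=> x; apply: cvgMr; exact: cvg_id.
case: c => u v; split=> x.
  rewrite re_part_cexp; apply: cvgM; apply: continuous_comp; [exact: lin|exact: continuous_expR|exact: lin|exact: continuous_cos].
rewrite im_part_cexp; apply: cvgM; apply: continuous_comp; [exact: lin|exact: continuous_expR|exact: lin|exact: continuous_sin].
Qed.

Lemma continuous_normc f : ccontinuous f -> continuous (fun x => normc (f x)).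
Proof.
move=> [f1 f2] x.
have -> : (fun x => normc (f x)) =
    (@Num.sqrt R) \o (fun x => re_part f x ^+ 2 + im_part f x ^+ 2).
  by apply/funext => y /=; rewrite /re_part /im_part; case: (f y).
apply: continuous_comp; last exact: sqrt_continuous.
apply: cvgD.
  exact: (continuous_comp (f1 x) (@exprn_continuous R 2 (re_part f x))).
exact: (continuous_comp (f2 x) (@exprn_continuous R 2 (im_part f x))).
Qed.

Lemma ccontinuous_bounded h a b : ccontinuous h ->
  exists2 F, 0 <= F & forall x, a <= x <= b -> normc (h x) <= F.
Proof.
move=> ch; have [ab|ba] := leP a b; last first.
  by exists 0 => // x /andP[ax xb]; have := le_trans ax xb; rewrite leNgt ba.
have [c _ hc] := EVT_max ab (continuous_subspaceT (continuous_normc ch)).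
by exists (normc (h c)); [exact: normc_ge0|move=> x xab; apply: hc; rewrite in_itv].
Qed.

End ComplexIntegral.

(** * Solutions of the equation - f'' + q f = k ^ 2 f *)

Section Solutions.
Variable R : realType.
Local Notation mu := (@lebesgue_measure R).
Implicit Types (f g q h e : R -> R[i]) (a b s t x y : R) (z k c l : R[i]).

Lemma cexp_taylor1 z : normc z <= 1 / 2 -> normc (cexp z - 1 - z) <= 4 * normc z ^+ 2.
Proof.
move=> z1; rewrite sqr_normc; apply: (le_trans (normc_leD _)).
have := le_trans (normc_Re z) z1; have := le_trans (normc_Im z) z1.
case: z {z1} => a b /= hb ha.
have /andP[a1 a2] : - (1 / 2) <= a <= 1 / 2 by rewrite -ler_norml.
have ea1 : 1 + a <= expR a := expR_ge1Dx a.
have ea0 := expR_gt0 a.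
have ea2 : expR a <= 1 + a + 2 * a ^+ 2.
  have : expR a * (1 - a) <= 1.
    rewrite -[leRHS](_ : expR a * expR (- a) = 1); last by rewrite -expRD subrr expR0.
    by rewrite ler_pM2l// expR_ge1Dx.
  have : 0 <= a ^+ 2 * (1 - 2 * a) by rewrite mulr_ge0 ?sqr_ge0//; lra.
  by move=> h1 h2; rewrite -(ler_pM2r (_ : 0 < 1 - a)); nra.
have ea3 : expR a <= 2 by nra.
have c1 : 1 - b ^+ 2 / 2 <= cos b.
  by rewrite -cos_norm -[b in b ^+ 2]mulr1 -real_normK ?num_real// mulr1 cos_ge_parabola.
have c2 := cos_le1 b.
have sb : `|sin b - b| <= b ^+ 2.
  wlog b0 : b hb {c1 c2} / 0 <= b.
    move=> H; have [|b0] := leP 0 b; first exact: H.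
    have := H (- b); rewrite normrN sinN sqrrN -opprD normrN; apply=> //.
    by rewrite oppr_ge0 ltW.
  have := sin_le_id b0; have := sin_ge_cubic b0; rewrite ger0_norm// in hb.
  by move=> h1 h2; rewrite ler0_norm ?subr_le0//; nra.
have sb2 : `|sin b| <= 1 := sin_max b.
have sb3 : `|sin b| <= `|b| + b ^+ 2.
  by rewrite -[sin b](subrK b) addrC (le_trans (ler_normD _ _))// lerD2l.
rewrite !mul0r subr0 !addr0 subr0.
have h1 : `|expR a * cos b - 1 - a| <= 2 * a ^+ 2 + b ^+ 2.
  rewrite ler_norml; apply/andP; split; nra.
have h2 : `|expR a * sin b - b| <= 2 * `|a| * (`|b| + b ^+ 2) + b ^+ 2.
  have -> : expR a * sin b - b = (expR a - 1) * sin b + (sin b - b) by ring.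
  rewrite (le_trans (ler_normD _ _))// lerD// normrM ler_pM//.
  have [a0|a0] := leP 0 a.
    by rewrite (ger0_norm a0) ger0_norm; [nra|lra].
  by rewrite (ltr0_norm a0) ler_norml; apply/andP; split; nra.
rewrite (le_trans (lerD h1 h2))//.
have -> : b ^+ 2 = `|b| ^+ 2 by rewrite real_normK ?num_real.
have -> : a ^+ 2 = `|a| ^+ 2 by rewrite real_normK ?num_real.
move: hb (normr_ge0 a) (normr_ge0 b); set A := `|a|; set B := `|b| => hB A0 B0.
have AB : 0 <= A * B * (1 / 2 - B) by rewrite !mulr_ge0// subr_ge0.
have sq : 0 <= (A - B) ^+ 2 := sqr_ge0 _.
have := sqr_ge0 A; have := sqr_ge0 B; lra.
Qed.

(** On a subdivision of mesh h the increments add up to at most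
    C * h * (v b - v a). This serves instead of integration by parts, since the
    derivative of a solution is merely absolutely continuous. *)
Lemma constant_of_increments (J : R -> R[i]) (v : R -> R) a b (C d : R) : a <= b -> 0 < d ->
  (forall s t, a <= s -> s <= t -> t <= b -> t - s <= d ->
     normc (J t - J s) <= C * (t - s) * (v t - v s)) ->
  J b = J a.
Proof.
move=> ab d0 h; apply/eqP; rewrite -subr_eq0; apply/eqP.
apply: normc_arbitrarily_small => eps eps0.
pose K := `|C * (b - a) * (v b - v a)|.
have [n0 hn] : exists n : nat, (b - a) / d + K / eps < n%:R.
  exists (Num.truncn `|(b - a) / d + K / eps|).+1; rewrite (le_lt_trans (ler_norm _))//.
  by rewrite truncnS_gt.
have ba : 0 <= (b - a) / d by rewrite divr_ge0 ?subr_ge0// ltW.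
have Ke : 0 <= K / eps by rewrite divr_ge0 ?normr_ge0// ltW.
have nR : 0 < n0%:R :> R by lra.
pose p (i : nat) := a + i%:R * ((b - a) / n0%:R).
have st0 : 0 <= (b - a) / n0%:R by rewrite divr_ge0 ?subr_ge0// ltW.
have pS i : p i.+1 = p i + (b - a) / n0%:R by rewrite /p -natr1; ring.
have pa : p 0%N = a by rewrite /p mul0r addr0.
have pb : p n0 = b by rewrite /p mulrC divfK ?gt_eqF// addrC subrK.
have ple i : (i <= n0)%N -> p i <= b.
  move=> i0; rewrite -pb /p lerD2l ler_wpM2r// ler_nat//.
have age i : a <= p i by rewrite /p lerDl mulr_ge0.
have hS i : (i < n0)%N -> normc (J (p i.+1) - J (p i)) <= C * ((b - a) / n0%:R) * (v (p i.+1) - v (p i)).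
  have pd : p i.+1 - p i = (b - a) / n0%:R by rewrite pS; ring.
  move=> i0; rewrite -pd; apply: h => //; [by rewrite pS lerDl|exact: ple|].
  by rewrite pd ler_pdivrMr// mulrC -ler_pdivrMr//; lra.
have : forall m, (m <= n0)%N -> normc (J (p m) - J a) <= C * ((b - a) / n0%:R) * (v (p m) - v a).
  elim=> [_|m ih m0]; first by rewrite pa !subrr normc0 mulr0.
  have -> : J (p m.+1) - J a = (J (p m.+1) - J (p m)) + (J (p m) - J a) by ring.
  rewrite (le_trans (normcD _ _))// (le_trans (lerD (hS _ m0) (ih (ltnW m0))))//.
  by rewrite le_eqVlt; apply/orP; left; apply/eqP; ring.
move/(_ n0 (leqnn _)); rewrite pb => /le_trans; apply.
rewrite (le_trans (ler_norm _))//.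
have -> : C * ((b - a) / n0%:R) * (v b - v a) = (C * (b - a) * (v b - v a)) / n0%:R by field; rewrite gt_eqF.
rewrite normrM normfV (gtr0_norm nR) -/K ler_pdivrMr// mulrC -ler_pdivrMr//; lra.
Qed.

(** The constant c is subtracted first: with c = u' (b) this is a bound on the
    deviation of u from its tangent. *)
Lemma real_mvt_bound (u : R -> R) (c M : R) a b : a <= b ->
  (forall x, derivable u x 1) ->
  (forall x, a <= x <= b -> `|derive1 u x - c| <= M) ->
  `|u b - u a - (b - a) * c| <= (b - a) * M.
Proof.
move=> ab du hM; move: ab; rewrite le_eqVlt => /predU1P[<-|ab].
  by rewrite !subrr !mul0r subr0 normr0.
have [||x xab ->] := @MVT R u (derive1 u) a b ab.
- by move=> x _; rewrite derive1E; apply: derivableP.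
- by apply: derivable_within_continuous => x _; exact: du.
- have -> : derive1 u x * (b - a) - (b - a) * c = (b - a) * (derive1 u x - c) by ring.
  rewrite normrM gtr0_norm ?subr_gt0//; apply: ler_wpM2l; first by rewrite subr_ge0 ltW.
  by apply: hM; move: xab; rewrite in_itv/= => /andP[? ?]; rewrite !ltW.
Qed.

(** The factor 2 comes from treating the real and imaginary parts separately. *)
Lemma mean_value_bound f c a b (M : R) : a <= b -> (forall x, cderivable f x) ->
  (forall x, a <= x <= b -> normc (cderive f x - c) <= M) ->
  normc (f b - f a - (b - a)%:C * c) <= 2 * (b - a) * M.
Proof.
move=> ab df hM.
have h1 := @real_mvt_bound (re_part f) (complex.Re c) M a b ab (fun x => (df x).1).
have h2 := @real_mvt_bound (im_part f) (complex.Im c) M a b ab (fun x => (df x).2).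
rewrite (le_trans (normc_leD _))//.
have -> : 2 * (b - a) * M = (b - a) * M + (b - a) * M by ring.
rewrite !cReD !cImD !cReN !cImN cReM cImM/= !mul0r subr0 addr0.
apply: lerD.
  apply: h1 => x xab; rewrite (le_trans _ (hM x xab))//.
  by rewrite (le_trans _ (normc_Re _))// cReD cReN.
apply: h2 => x xab; rewrite (le_trans _ (hM x xab))//.
by rewrite (le_trans _ (normc_Im _))// cImD cImN.
Qed.

Lemma cderivable_continuous f : (forall x, cderivable f x) -> ccontinuous f.
Proof.
move=> df; split=> x; apply: differentiable_continuous; apply/derivable1_diffP.
  exact: (df x).1.
exact: (df x).2.
Qed.

Lemma locally_integrable_itv (u : R -> R) a b : locally_integrable setT u ->
  mu.-integrable `[a, b] (EFin \o u).
Proof.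
move=> [mu_ _ h]; apply/integrableP; split.
  by apply/measurable_EFinP; exact: measurable_funTS.
have := h `[a, b]%classic (@subsetT _ _) (@segment_compact R a b).
by apply: le_lt_trans; rewrite le_eqVlt; apply/orP; left; apply/eqP; apply: eq_integral.
Qed.

Section OneSolution.
Variables (q : R -> R[i]) (k : R[i]) (f : R -> R[i]).
Hypothesis iq : cintegrable setT q.
Hypothesis sf : schrodinger_solution q k f.

Lemma cintegrable_itv a b : cintegrable `[a, b] q.
Proof. by apply: cintegrableS iq => //; exact: measurableT. Qed.

Lemma solution_continuous : ccontinuous f.
Proof. by apply: cderivable_continuous; case: sf. Qed.

Lemma solution_derivative_increment a b : a <= b ->
  cderive f b - cderive f a =
    cintegral `[a, b] (fun x => q x * f x) - k ^+ 2 * cintegral `[a, b] f.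
Proof.
move=> ab; have [_ [f2 [[l1 l2] inc ae]]] := sf.
have mI : measurable (`[a, b] : set (measurableTypeR R)) by exact: measurable_itv.
have cf := solution_continuous.
have i1 := cintegrable_mul_continuous (cintegrable_itv a b) cf.
have i2 := cintegrableZ (- k ^+ 2) mI (cintegrable_continuous a b cf).
rewrite inc// -mulNr -cintegralZ//; last exact: cintegrable_continuous.
rewrite -cintegralD//; apply: ae_eq_cintegral => //.
- by split; exact: locally_integrable_itv.
- exact: cintegrableD.
- apply: aeS ae => x e _; rewrite mulNr -e; ring.
Qed.

Definition qmass s t := Rintegral mu `[s, t] (fun x => normc (q x)).

Lemma qmass_ge0 s t : 0 <= qmass s t.
Proof. by apply: Rintegral_ge0 => x _; exact: normc_ge0. Qed.

Lemma qmass_split a b s : a <= b -> b <= s -> qmass a s = qmass a b + qmass b s.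
Proof.
move=> ab bs; apply: Rintegral_itv_split => //.
by apply: integrable_normc => //; exact: cintegrable_itv.
Qed.

Lemma solution_derivative_osc a b (F : R) :
  (forall x, a <= x <= b -> normc (f x) <= F) ->
  forall s t, a <= s -> s <= t -> t <= b ->
  normc (cderive f t - cderive f s) <= (qmass a b + normc k ^+ 2 * (b - a)) * F.
Proof.
move=> hF s t as_ st tb.
have F0 : 0 <= F by rewrite (le_trans (normc_ge0 (f s)))// hF// as_ (le_trans st).
rewrite solution_derivative_increment// (le_trans (normcB _ _))// mulrDl lerD//.
  apply: (@le_trans _ _ (qmass s t * F)).
    apply: normc_cintegral_mul_le; [exact: cintegrable_itv|exact: solution_continuous|].
    by move=> x /andP[sx xt]; rewrite hF// (le_trans as_)//= (le_trans xt).
  rewrite ler_wpM2r//.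
  rewrite (@qmass_split a s b)// ?(le_trans st)// (@qmass_split s t b)//.
  by have := qmass_ge0 a s; have := qmass_ge0 t b; lra.
have k0 : 0 <= normc k ^+ 2 by exact: sqr_ge0.
have -> : normc k ^+ 2 * (b - a) * F = normc k ^+ 2 * ((b - a) * F) by ring.
rewrite normcM normcX; apply: ler_wpM2l => //.
apply: (@le_trans _ _ ((t - s) * F)).
  apply: normc_cintegral_continuous_le => //; first exact: solution_continuous.
  by move=> x /andP[sx xt]; rewrite hF// (le_trans as_)//= (le_trans xt).
by rewrite ler_wpM2r// lerB.
Qed.

Lemma solution_derivative_bounded a b :
  exists2 G, 0 <= G & forall x, a <= x <= b -> normc (cderive f x) <= G.
Proof.
have [ab|ba] := leP a b; last first.
  by exists 0 => // x /andP[ax xb]; have := le_trans ax xb; rewrite leNgt ba.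
have [F F0 hF] := ccontinuous_bounded a b solution_continuous.
exists ((qmass a b + normc k ^+ 2 * (b - a)) * F + normc (cderive f b)).
  by rewrite addr_ge0 ?normc_ge0// mulr_ge0// addr_ge0 ?qmass_ge0// mulr_ge0 ?sqr_ge0// subr_ge0.
move=> x /andP[ax xb]; rewrite -(subrK (cderive f b) (cderive f x)).
by rewrite (le_trans (normcD _ _))// lerD2r normcBC (solution_derivative_osc hF).
Qed.

End OneSolution.

End Solutions.

(** * Solutions tested against exponentials *)

Section ExpIdentity.
Variable R : realType.
Local Notation mu := (@lebesgue_measure R).
Implicit Types (f g h e : R -> R[i]) (a b s t x y : R) (z k c l : R[i]).

Lemma cexp_increment l s t : s <= t -> normc l * (t - s) <= 1 / 2 ->
  normc (cexp (l * t%:C) - cexp (l * s%:C) - cexp (l * s%:C) * l * (t - s)%:C) <=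
  normc (cexp (l * s%:C)) * (4 * (normc l * (t - s)) ^+ 2).
Proof.
move=> st h.
have -> : cexp (l * t%:C) = cexp (l * s%:C) * cexp (l * (t - s)%:C).
  by rewrite -cexpD -mulrDr -rmorphD/= addrC subrK.
set E := cexp (l * s%:C).
have -> : E * cexp (l * (t - s)%:C) - E - E * l * (t - s)%:C =
  E * (cexp (l * (t - s)%:C) - 1 - l * (t - s)%:C) by ring.
have nl : normc (l * (t - s)%:C) = normc l * (t - s).
  by rewrite normcM normc_real ger0_norm// subr_ge0.
by rewrite normcM ler_wpM2l ?normc_ge0// -nl cexp_taylor1// nl.
Qed.

Variables (q : R -> R[i]) (k : R[i]) (f : R -> R[i]).
Hypothesis iq : cintegrable setT q.
Hypothesis sf : schrodinger_solution q k f.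

Let iqI a b : cintegrable `[a, b] q.
Proof. exact: cintegrable_itv. Qed.

(** The equation tested against a solution e of the free equation, with
    e (f' - l f) as primitive of q f e: the difference of the two sides has
    increments of second order, so it is constant. *)
Lemma solution_exp_identity l a b : l ^+ 2 = - k ^+ 2 -> a <= b ->
  cexp (l * b%:C) * (cderive f b - l * f b) - cexp (l * a%:C) * (cderive f a - l * f a) =
  cintegral `[a, b] (fun x => q x * (f x * cexp (l * x%:C))).
Proof.
move=> lk ab.
pose e x : R[i] := cexp (l * x%:C); pose u x := cderive f x - l * f x.
have ce : ccontinuous e by exact: ccontinuous_cexp.
have cf : ccontinuous f by exact: solution_continuous sf.
have cfe : ccontinuous (fun x => f x * e x) by exact: ccontinuousM.
have iqfe s t : cintegrable `[s, t] (fun x => q x * (f x * e x)).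
  by apply: cintegrable_mul_continuous.
pose J x := e x * u x - cintegral `[a, x] (fun x => q x * (f x * e x)).
suff : J b = J a.
  by rewrite /J cintegral_itv1 subr0 => <-; rewrite opprB addrCA subrr addr0.
have [F F0 hF] := ccontinuous_bounded a b cf.
have [G G0 hG] := solution_derivative_bounded iq sf a b.
have [E E0 hE] := ccontinuous_bounded a b ce.
set L := normc l; have L0 : 0 <= L := normc_ge0 l.
set K := normc k ^+ 2; have K0 : 0 <= K by exact: sqr_ge0.
pose v x := qmass q a x + x.
pose C := 4 * E * L ^+ 2 * (G + L * F) + 2 * E * L * F * (1 + K) + 2 * E * L ^+ 2 * G + 3 * F * E * L.
pose d := (2 * (L + 1))^-1.
have d0 : 0 < d by rewrite invr_gt0 mulr_gt0//; lra.
apply: (@constant_of_increments _ J v a b C d) => // s t as_ st tb tsd.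
have h0 : 0 <= t - s by rewrite subr_ge0.
have Ld : L * (t - s) <= 1 / 2.
  apply: (@le_trans _ _ (L * d)); first by rewrite ler_wpM2l.
  by rewrite /d ler_pdivrMr ?mulr_gt0//; lra.
have sub x : s <= x <= t -> a <= x <= b.
  by move=> /andP[sx xt]; rewrite (le_trans as_)//= (le_trans xt).
have qm0 : 0 <= qmass q s t by exact: qmass_ge0.
have hv : v t - v s = qmass q s t + (t - s).
  by rewrite /v (qmass_split iq as_ st); ring.
have hgs x : s <= x <= t -> normc (cderive f x - cderive f t) <= (qmass q s t + K * (t - s)) * F.
  move=> /andP[sx xt]; rewrite normcBC.
  by apply: (solution_derivative_osc iq sf (a := s) (b := t)) => // y /sub; exact: hF.
have sa : a <= s <= b by rewrite as_ (le_trans st).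
have ta : a <= t <= b by rewrite (le_trans as_).
have hst : s <= s <= t by rewrite lexx.
have htt : s <= t <= t by rewrite lexx andbT.
pose h := (t - s)%:C : R[i].
pose r := e t - e s - e s * l * h.
have r_le : normc r <= E * (4 * (L * (t - s)) ^+ 2).
  rewrite (le_trans (cexp_increment st Ld))// ler_wpM2r ?hE//.
  by rewrite mulr_ge0// sqr_ge0.
have e_le x : s <= x <= t -> normc (e x - e s) <= E * (3 * (L * (t - s))).
  move=> /andP[sx xt]; have xs0 : 0 <= x - s by rewrite subr_ge0.
  have Lx : L * (x - s) <= L * (t - s) by rewrite ler_wpM2l// lerB.
  have Lx0 : 0 <= L * (x - s) by rewrite mulr_ge0.
  have h1 := cexp_increment sx (le_trans Lx Ld).
  have -> : e x - e s = (e x - e s - e s * l * (x - s)%:C) + e s * l * (x - s)%:C by rewrite subrK.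
  rewrite (le_trans (normcD _ _))// (le_trans (lerD h1 (lexx _)))//.
  have -> : normc (e s * l * (x - s)%:C) = normc (e s) * (L * (x - s)).
    by rewrite !normcM (normc_real (x - s)) (ger0_norm xs0) mulrA.
  rewrite -mulrDr ler_pM ?normc_ge0 ?hE//.
    by rewrite addr_ge0// mulr_ge0// sqr_ge0.
  have : L * (x - s) * (L * (x - s)) <= L * (x - s) * (1 / 2).
    by rewrite ler_wpM2l// (le_trans Lx).
  rewrite -/L expr2; lra.
have df := sf.1.
have m1 : normc (f t - f s - h * cderive f t) <= 2 * (t - s) * ((qmass q s t + K * (t - s)) * F).
  exact: mean_value_bound.
have m2 : normc (cintegral `[s, t] f - h * f t) <= (t - s) * (2 * (t - s) * G).
  have cft : ccontinuous (fun x => f x + - f t).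
    by apply: ccontinuousD => //; exact: ccontinuous_cst.
  have <- : cintegral `[s, t] (fun x => f x + - f t) = cintegral `[s, t] f - h * f t.
    rewrite cintegralD//; last 2 first.
    - exact: cintegrable_continuous.
    - by apply: cintegrable_continuous; exact: ccontinuous_cst.
    by rewrite cintegral_cst// mulrN.
  apply: normc_cintegral_continuous_le => // x /andP[sx xt].
  have := @mean_value_bound R f 0 x t G xt df.
  rewrite mulr0 subr0 => /(_ _)/le_trans.
  rewrite -normc_opp opprB; apply.
    move=> y /andP[xy yt]; rewrite subr0 hG// sub// yt (le_trans sx)//.
  by rewrite ler_wpM2r// ler_wpM2l// lerB.
have m3 : normc (cintegral `[s, t] (fun x => q x * (f x * (e s - e x)))) <=
    qmass q s t * (F * (E * (3 * (L * (t - s))))).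
  apply: normc_cintegral_mul_le => //.
    apply: ccontinuousM => //.
    have -> : (fun x => e s - e x) = (fun x => e s + (-1) * e x).
      by apply/funext => x; rewrite mulN1r.
    apply: ccontinuousD; first exact: ccontinuous_cst.
    by apply: ccontinuousM => //; exact: ccontinuous_cst.
  by move=> x xst; rewrite normcM ler_pM ?normc_ge0// ?hF ?sub// normcBC e_le.
have key : J t - J s = r * u t - e s * l * (f t - f s - h * cderive f t) +
    e s * l ^+ 2 * (cintegral `[s, t] f - h * f t) +
    cintegral `[s, t] (fun x => q x * (f x * (e s - e x))).
  rewrite /J (cintegral_itv_split as_ st (iqfe a t)).
  have iqf := cintegrable_mul_continuous (iqI s t) cf.
  have -> : cintegral `[s, t] (fun x => q x * (f x * (e s - e x))) =
     e s * cintegral `[s, t] (fun x => q x * f x) - cintegral `[s, t] (fun x => q x * (f x * e x)).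
    rewrite -mulN1r -!cintegralZ// -cintegralD//; last 2 first.
    - exact: cintegrableZ.
    - exact: cintegrableZ.
    by congr cintegral; apply/funext => x; ring.
  have inc := solution_derivative_increment iq sf st.
  have -> : cintegral `[s, t] (fun x => q x * f x) = cderive f t - cderive f s + k ^+ 2 * cintegral `[s, t] f.
    by rewrite inc subrK.
  have kl : k ^+ 2 = - l ^+ 2 by rewrite lk opprK.
  rewrite kl /r /u; ring.
rewrite hv key (le_trans (normcD _ _))// (le_trans (lerD (normcD _ _) m3))//.
rewrite (le_trans (lerD (lerD (normcB _ _) (lexx _)) (lexx _)))//.
rewrite (normcM r) (normcM (e s * l)) (normcM (e s)) (normcM (e s * l ^+ 2)) (normcM (e s)) normcX -/L.
have u_le : normc (u t) <= G + L * F.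
  by rewrite /u (le_trans (normcB _ _))// normcM lerD ?hG// ler_wpM2l ?hF.
have es := hE s sa.
have t1 : normc r * normc (u t) <= E * (4 * (L * (t - s)) ^+ 2) * (G + L * F).
  by rewrite ler_pM ?normc_ge0.
have t2 : normc (e s) * L * normc (f t - f s - h * cderive f t) <=
    E * L * (2 * (t - s) * ((qmass q s t + K * (t - s)) * F)).
  by rewrite ler_pM ?normc_ge0 ?mulr_ge0 ?normc_ge0// ler_wpM2r.
have t3 : normc (e s) * L ^+ 2 * normc (cintegral `[s, t] f - h * f t) <=
   E * L ^+ 2 * ((t - s) * (2 * (t - s) * G)).
  by rewrite ler_pM ?normc_ge0 ?mulr_ge0 ?normc_ge0 ?sqr_ge0// ler_wpM2r ?sqr_ge0.
rewrite (le_trans (lerD (lerD (lerD t1 t2) t3) (lexx _)))// -subr_ge0.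
set Q := qmass q s t in qm0 *; set H := t - s in h0 *.
have -> : C * H * (Q + H) - (E * (4 * (L * H) ^+ 2) * (G + L * F) +
    E * L * (2 * H * ((Q + K * H) * F)) + E * L ^+ 2 * (H * (2 * H * G)) +
    Q * (F * (E * (3 * (L * H))))) =
  4 * E * L ^+ 2 * (G + L * F) * H * Q + 2 * E * L * F * H * (K * Q + H)
  + 2 * E * L ^+ 2 * G * H * Q + 3 * F * E * L * H * H.
  rewrite /C; ring.
have LL : 0 <= L ^+ 2 := sqr_ge0 L.
by repeat first [exact: LL | assumption | exact: ler0n | apply: addr_ge0 | apply: mulr_ge0].
Qed.

(** Where q vanishes both exp (l x) (f' - l f) and exp (- l x) (f' + l f) are
    constant, which determines f and f'. When l = 0 these coincide and give f' = 0
    only; then f is constant by the mean value inequality. *)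
Lemma solution_free_region l x0 x1 : l ^+ 2 = - k ^+ 2 ->
  {ae mu, forall x, Num.min x0 x1 <= x <= Num.max x0 x1 -> q x = 0} ->
  f x0 = cexp (l * x0%:C) -> cderive f x0 = l * cexp (l * x0%:C) ->
  f x1 = cexp (l * x1%:C) /\ cderive f x1 = l * cexp (l * x1%:C).
Proof.
move=> lk q0 f0 g0.
set m := Num.min x0 x1 in q0; set M := Num.max x0 x1 in q0.
have x0i : m <= x0 <= M by rewrite ge_min le_max lexx.
have x1i : m <= x1 <= M by rewrite ge_min le_max lexx !orbT.
have const2 (l' : R[i]) a b : l' ^+ 2 = - k ^+ 2 -> m <= a -> a <= b -> b <= M ->
    cexp (l' * b%:C) * (cderive f b - l' * f b) = cexp (l' * a%:C) * (cderive f a - l' * f a).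
  move=> lk' ma ab bM; have := solution_exp_identity lk' ab.
  have -> : cintegral `[a, b] (fun x => q x * (f x * cexp (l' * x%:C))) = 0.
    have -> : 0 = cintegral `[a, b] (fun=> 0 : R[i]) by rewrite cintegral_cst// mulr0.
    apply: ae_eq_cintegral => //.
    - apply: cintegrable_mul_continuous => //; apply: ccontinuousM; last exact: ccontinuous_cexp.
      exact: solution_continuous sf.
    - by apply: cintegrable_continuous; exact: ccontinuous_cst.
    - apply: aeS q0 => x h /=; rewrite in_itv/= => /andP[ax xb].
      by rewrite h ?mul0r// (le_trans ma ax) (le_trans xb).
  by move/eqP; rewrite subr_eq0 => /eqP.
have const (l' : R[i]) x : l' ^+ 2 = - k ^+ 2 -> m <= x <= M ->
    cexp (l' * x%:C) * (cderive f x - l' * f x) = cexp (l' * x0%:C) * (cderive f x0 - l' * f x0).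
  move=> lk' /andP[mx xM]; case/andP: x0i => mx0 x0M; have [xx0|xx0] := leP x x0.
    by rewrite -(const2 _ x x0).
  by rewrite (const2 _ x0 x)// ltW.
have g1 x : m <= x <= M -> cderive f x = l * f x.
  move=> xi; move: (const l x lk xi); rewrite f0 g0 subrr mulr0 => /eqP.
  by rewrite mulf_eq0 (negbTE (cexp_neq0 _))/= subr_eq0 => /eqP.
suff f1 : f x1 = cexp (l * x1%:C) by rewrite g1// f1.
have [l0|l0] := eqVneq l 0.
  have f_const a b : m <= a -> a <= b -> b <= M -> f b = f a.
    move=> ma ab bM; have := @mean_value_bound R f 0 a b 0 ab sf.1.
    rewrite !mulr0 subr0 => h; apply/eqP; rewrite -subr_eq0 -normc_eq0.
    rewrite eq_le normc_ge0 andbT h// => x /andP[ax xb].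
    by rewrite subr0 g1 ?l0 ?mul0r ?normc0// (le_trans ma ax) (le_trans xb).
  have -> : f x1 = f x0.
    case/andP: x0i => mx0 x0M; case/andP: x1i => mx1 x1M.
    by have [x10|/ltW x10] := leP x1 x0; [rewrite (f_const x1 x0)|rewrite (f_const x0 x1)].
  by rewrite f0 l0 !mul0r.
have e1 : cexp (l * x1%:C) * cexp (- l * x1%:C) = 1 by rewrite mulNr cexpN.
have e0 : cexp (l * x0%:C) * cexp (- l * x0%:C) = 1 by rewrite mulNr cexpN.
have h := const (- l) x1; rewrite sqrrN in h; have {}h := h lk x1i.
rewrite g1// g0 f0 in h.
have l2 : l *+ 2 != 0 by rewrite mulrn_eq0.
apply: (mulfI l2).
transitivity (cexp (l * x1%:C) * (cexp (- l * x1%:C) * (l * f x1 - - l * f x1))).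
  by rewrite mulrA e1; ring.
rewrite h.
have -> : cexp (- l * x0%:C) * (l * cexp (l * x0%:C) - - l * cexp (l * x0%:C)) =
  l *+ 2 * (cexp (l * x0%:C) * cexp (- l * x0%:C)) by ring.
by rewrite e0 mulr1 mulrC.
Qed.

Lemma derive_cexp l x : cderive (fun x => cexp (l * x%:C)) x = l * cexp (l * x%:C).
Proof.
case: l => u v.
rewrite /cderive re_part_cexp im_part_cexp !derive1E.
have d1 : is_derive x 1 (fun x => expR (u * x) * cos (v * x))
   (u * (expR (u * x) * cos (v * x)) - v * (expR (u * x) * sin (v * x))).
  apply: is_derive_eq.
  by rewrite /GRing.scale/=; ring.
have d2 : is_derive x 1 (fun x => expR (u * x) * sin (v * x))
   (u * (expR (u * x) * sin (v * x)) + v * (expR (u * x) * cos (v * x))).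
  apply: is_derive_eq.
  by rewrite /GRing.scale/=; ring.
rewrite (@derive_val _ _ _ _ _ _ _ d1) (@derive_val _ _ _ _ _ _ _ d2) /cexp cReM cImM/=.
by rewrite !mulr0 subr0 add0r; apply: complex_eq => /=; ring.
Qed.

End ExpIdentity.

(** * Vanishing outside the support *)

Section Support.
Variable R : realType.
Local Notation mu := (@lebesgue_measure R).
Implicit Types (q : R -> R[i]) (x y : R).

(** A point outside the support has a rational interval around it on which q
    vanishes almost everywhere, and there are countably many such intervals. *)
Lemma ae_zero_outside_supp q (K : set R) : ess_supp q `<=` K ->
  {ae mu, forall x, ~ K x -> q x = 0}.
Proof.
move=> qK.
pose null (rs : rat * rat) := {ae mu, forall y, ratr rs.1 < y < ratr rs.2 -> q y = 0}.
pose P (n : nat) y := forall rs : rat * rat, unpickle n = Some rs -> null rs ->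
  ratr rs.1 < y < ratr rs.2 -> q y = 0.
have : {ae mu, forall y, forall n, P n y}.
  apply: ae_foralln => n; rewrite /P.
  case: (unpickle n) => [rs|]; last by apply: aeW => y rs.
  have [h|h] := pselect (null rs); last by apply: aeW => y rs' [<-].
  by apply: aeS h => y h rs' [<-].
apply: aeS => x h nKx.
have : ~ ess_supp q x by move/qK.
rewrite /ess_supp/= => /contrapT[U [oU Ux qU]].
have /nbhs_ballP[e /= e0 heU] : nbhs x U by apply: open_nbhs_nbhs; split.
have [r] : exists r, x - e < ratr r < x.
  by have := @rat_in_itvoo R (x - e) x; rewrite ltrBlDr ltrDl => /(_ e0)[r]; exists r; rewrite in_itv/= in p *.
move=> /andP[r1 r2].
have [s] : exists s, x < ratr s < x + e.
  by have := @rat_in_itvoo R x (x + e); rewrite ltrDl => /(_ e0)[s]; exists s; rewrite in_itv/= in p *.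
move=> /andP[s1 s2].
apply: (h (pickle (r, s)) (r, s)); first exact: pickleK.
  apply: aeS qU => y hy /= /andP[y1 y2]; apply: hy; apply: heU.
  by rewrite /ball/= ltr_norml; apply/andP; split; lra.
by rewrite /= r2.
Qed.

End Support.

(** * Jost solutions and the Wronskian *)

Section Jost.
Variable R : realType.
Local Notation mu := (@lebesgue_measure R).
Implicit Types (f g h e : R -> R[i]) (a b s t x y : R) (z k c l : R[i]).
Variables (q : R -> R[i]) (gamma : R).
Hypothesis iq : cintegrable setT q.
Hypothesis gamma0 : 0 < gamma.
Hypothesis supp_q : ess_supp q `<=` `[0, gamma].

Lemma qmass_le_L1norm a b : qmass q a b <= L1norm q.
Proof.
have inq := integrable_normc measurableT iq.
rewrite /qmass /L1norm /Rintegral fine_le//.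
- apply: integrable_fin_num => //.
  by apply: integrable_normc => //; exact: cintegrable_itv.
- exact: integrable_fin_num.
- apply: ge0_subset_integral => //.
  + exact: measurable_int inq.
  + by move=> x _; rewrite lee_fin normc_ge0.
Qed.

Lemma L1norm_ge0 : 0 <= L1norm q.
Proof. by apply: Rintegral_ge0 => x _; exact: normc_ge0. Qed.

Lemma cderive_near f g x : (\forall y \near x, f y = g y) -> cderive f x = cderive g x.
Proof.
move=> fg; rewrite /cderive !derive1E; congr (_ +i* _); apply: near_eq_derive;
  by apply: filterS fg => y; rewrite /re_part /im_part => ->.
Qed.

Lemma ae_neq_point (c : R) : {ae mu, forall x, x <> c}.
Proof.
exists [set c]; split; [exact: measurable_set1|exact: lebesgue_measure_set1|].
by move=> x /= /contrapT.
Qed.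

(** The end points of the support are of measure zero. *)
Lemma ae_zero_left x : x <= 0 ->
  {ae mu, forall y, Num.min x 0 <= y <= Num.max x 0 -> q y = 0}.
Proof.
move=> x0; apply: aeS (aeI (ae_zero_outside_supp supp_q) (ae_neq_point 0)) => y [h1 h2].
rewrite (min_idPl x0) (max_idPr x0) => /andP[xy y0]; apply: h1 => /=.
rewrite in_itv/= => /andP[y0' _]; apply: h2; apply/eqP.
by rewrite eq_le y0.
Qed.

Lemma ae_zero_right x : gamma <= x ->
  {ae mu, forall y, Num.min x gamma <= y <= Num.max x gamma -> q y = 0}.
Proof.
move=> x0; apply: aeS (aeI (ae_zero_outside_supp supp_q) (ae_neq_point gamma)) => y [h1 h2].
rewrite (min_idPr x0) (max_idPl x0) => /andP[xy y0]; apply: h1 => /=.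
rewrite in_itv/= => /andP[_ y0']; apply: h2; apply/eqP.
by rewrite eq_le y0'.
Qed.

Lemma jost_exponent k x : (0 +i* x) * k = 'i * k * x%:C :> R[i].
Proof. by case: k => u v; apply: complex_eq => /=; ring. Qed.

Lemma jost_plus_data k f : jost_plus q k f ->
  f gamma = cexp ('i * k * gamma%:C) /\ cderive f gamma = 'i * k * cexp ('i * k * gamma%:C).
Proof.
move=> [sf [X [_ hX]]].
pose x0 := Num.max (X + 1) gamma.
have gx : gamma <= x0 by rewrite le_max lexx orbT.
have Xx : X < x0 by rewrite lt_max ltrDl ltr01.
apply: (@solution_free_region R q k f iq sf ('i * k) x0 gamma).
- by rewrite exprMn sqr_i mulN1r.
- exact: ae_zero_right.
- by rewrite hX// jost_exponent.
- rewrite -derive_cexp; apply: cderive_near.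
  have := @near_in_itvoy R X x0; rewrite in_itv/= andbT => /(_ Xx).
  apply: filterS => y; rewrite in_itv/= andbT => Xy.
  by rewrite hX// jost_exponent.
Qed.

Lemma jost_minus_data k f : jost_minus q k f ->
  f 0 = 1 /\ cderive f 0 = - ('i * k).
Proof.
move=> [sf [X [_ hX]]].
pose x0 := Num.min (X - 1) 0.
have gx : x0 <= 0 by rewrite ge_min lexx orbT.
have Xx : x0 < X by rewrite gt_min ltrBlDr ltrDl ltr01.
have [] := @solution_free_region R q k f iq sf (- ('i * k)) x0 0.
- by rewrite sqrrN exprMn sqr_i mulN1r.
- exact: ae_zero_left.
- by rewrite hX// jost_exponent mulNr.
- rewrite -derive_cexp; apply: cderive_near.
  apply: filterS (lt_nbhsl Xx) => y yX.
  by rewrite hX// jost_exponent mulNr.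
by rewrite mulr0 cexp0 mulr1.
Qed.

Section FixedEnergy.
Variables (k : R[i]) (f : R -> R[i]).
Hypothesis jf : jost_plus q k f.
Let sf : schrodinger_solution q k f := jf.1.
Let cf : ccontinuous f := solution_continuous sf.
Local Notation ep x := (cexp ('i * k * x%:C)).
Local Notation em x := (cexp (- ('i * k) * x%:C)).

Lemma normc_2ik : 2 * normc k = normc (2 * ('i * k)).
Proof.
rewrite (normcM 2) (normcM 'i) normc_nat (_ : normc 'i = 1) ?mul1r//.
by rewrite /normc expr0n add0r expr1n sqrtr1.
Qed.

Lemma normc_ep x : normc (ep x) = expR (- complex.Im k * x).
Proof. by rewrite normc_cexp; congr expR; case: k => u v /=; ring. Qed.

Lemma normc_em x : normc (em x) = expR (complex.Im k * x).
Proof. by rewrite normc_cexp; congr expR; case: k => u v /=; ring. Qed.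

Lemma ep_em x : ep x * em x = 1.
Proof. by rewrite mulNr cexpN. Qed.

(** The amplitudes of the waves exp (i k x) and exp (- i k x) scattered by q on
    [a, b]. *)
Definition outgoing a b := cintegral `[a, b] (fun x => q x * (f x * em x)).
Definition incoming a b := cintegral `[a, b] (fun x => q x * (f x * ep x)).

Lemma outgoing_identity x : x <= gamma ->
  em x * (cderive f x + 'i * k * f x) = 2 * ('i * k) - outgoing x gamma.
Proof.
move=> xg; have [f1 f2] := jost_plus_data jf.
have := solution_exp_identity iq sf (l := - ('i * k)) _ xg.
rewrite sqrrN exprMn sqr_i mulN1r -/(outgoing x gamma) => <-//.
rewrite f1 f2.
have -> : em gamma * ('i * k * ep gamma - - ('i * k) * ep gamma) = 2 * ('i * k) * (ep gamma * em gamma) by ring.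
by rewrite ep_em; ring.
Qed.

Lemma incoming_identity x : x <= gamma ->
  ep x * (cderive f x - 'i * k * f x) = - incoming x gamma.
Proof.
move=> xg; have [f1 f2] := jost_plus_data jf.
have := solution_exp_identity iq sf (l := 'i * k) _ xg.
rewrite exprMn sqr_i mulN1r -/(incoming x gamma) => <-//.
by rewrite f1 f2 subrr mulr0 sub0r opprK.
Qed.

(** Variation of constants. *)
Lemma volterra x : x <= gamma -> 2 * ('i * k) * f x =
  ep x * (2 * ('i * k) - outgoing x gamma) + em x * incoming x gamma.
Proof.
move=> xg; rewrite -outgoing_identity//.
rewrite -[incoming x gamma]opprK -incoming_identity//.
have -> : ep x * (em x * (cderive f x + 'i * k * f x)) + em x * - (ep x * (cderive f x - 'i * k * f x)) =
  (ep x * em x) * (2 * ('i * k) * f x) by ring.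
by rewrite ep_em mul1r.
Qed.

Lemma normc_outgoing a b (M : R) : (forall t, a <= t <= b -> normc (f t * em t) <= M) ->
  normc (outgoing a b) <= qmass q a b * M.
Proof.
move=> h; apply: normc_cintegral_mul_le => //; first exact: cintegrable_itv.
by apply: ccontinuousM => //; exact: ccontinuous_cexp.
Qed.

Lemma normc_incoming a b (M : R) : (forall t, a <= t <= b -> normc (f t * ep t) <= M) ->
  normc (incoming a b) <= qmass q a b * M.
Proof.
move=> h; apply: normc_cintegral_mul_le => //; first exact: cintegrable_itv.
by apply: ccontinuousM => //; exact: ccontinuous_cexp.
Qed.

(** Let M be the supremum of |f exp (- i k x)| exp (2 eta x). Since - Im k <= eta,
    the weighted kernel of the Volterra equation is bounded by 1 / |k|, so the
    equation gives |f exp (- i k x) - 1| <= beta M exp (- 2 eta x), whence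
    M (1 - beta) <= exp (2 eta gamma). *)
Lemma normc_outgoing_total (beta eta : R) : k != 0 -> 0 <= beta < 1 ->
  L1norm q <= beta * normc k -> 0 <= eta -> - complex.Im k <= eta ->
  normc (outgoing 0 gamma) <= L1norm q * (1 + beta * expR (2 * eta * gamma) / (1 - beta)).
Proof.
move=> k0 /andP[b0 b1] Qb eta0 keta.
have nk : 0 < normc k by rewrite normc_gt0.
have Q0 := L1norm_ge0.
pose phi x := f x * em x.
have cphi : ccontinuous phi by apply: ccontinuousM => //; exact: ccontinuous_cexp.
have cw : continuous (fun x => normc (phi x) * expR (2 * eta * x)).
  move=> x; apply: cvgM; first exact: continuous_normc.
  apply: (continuous_comp (f := fun x => 2 * eta * x)); last exact: continuous_expR.
  by apply: cvgMr; exact: cvg_id.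
have [xs xsJ hM] := EVT_max (ltW gamma0) (continuous_subspaceT cw).
have /andP[xs0 xsg] : 0 <= xs <= gamma by move: xsJ; rewrite in_itv.
set M := normc (phi xs) * expR (2 * eta * xs) in hM.
have M0 : 0 <= M by rewrite mulr_ge0 ?normc_ge0 ?expR_ge0.
have ME1 : M = normc (phi xs) * expR (2 * eta * xs) by [].
clearbody M.
have ME y : 0 <= M * expR y by rewrite mulr_ge0 ?expR_ge0.
have phiM t : 0 <= t <= gamma -> normc (phi t) <= M * expR (- (2 * eta * t)).
  by move=> h; rewrite expRN ler_pdivlMr ?expR_gt0// hM// in_itv.
have dec t x : x <= t -> expR (- (2 * eta * t)) <= expR (- (2 * eta * x)).
  by move=> xt; rewrite ler_expR lerN2 ler_wpM2l// mulr_ge0.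
have key x : 0 <= x <= gamma -> normc (phi x - 1) <= beta * (M * expR (- (2 * eta * x))).
  move=> /andP[x0 xg].
  have e : 2 * ('i * k) * (phi x - 1) = em x * em x * incoming x gamma - outgoing x gamma.
    have := volterra xg; rewrite /phi => h.
    have -> : 2 * ('i * k) * (f x * em x - 1) = em x * (2 * ('i * k) * f x) - 2 * ('i * k) by ring.
    rewrite h.
    have -> : em x * (ep x * (2 * ('i * k) - outgoing x gamma) + em x * incoming x gamma) - 2 * ('i * k)
      = (ep x * em x) * (2 * ('i * k) - outgoing x gamma) + em x * em x * incoming x gamma - 2 * ('i * k) by ring.
    by rewrite ep_em; ring.
  have h1 : normc (outgoing x gamma) <= L1norm q * (M * expR (- (2 * eta * x))).
    apply: (@le_trans _ _ (qmass q x gamma * (M * expR (- (2 * eta * x))))).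
      apply: normc_outgoing => t /andP[xt tg].
      rewrite (le_trans (phiM t _)) ?(le_trans x0)//= ler_wpM2l// dec//.
    by rewrite ler_wpM2r// qmass_le_L1norm.
  have h2 : normc (em x * em x * incoming x gamma) <= L1norm q * (M * expR (- (2 * eta * x))).
    pose W := expR (complex.Im k * x) * expR (complex.Im k * x).
    have W0 : 0 < W by rewrite mulr_gt0 ?expR_gt0.
    rewrite (normcM (em x * em x)) (normcM (em x)) normc_em -/W -ler_pdivlMl//.
    rewrite (le_trans (normc_incoming (M := W^-1 * (M * expR (- (2 * eta * x)))) _))//; last first.
      by rewrite mulrCA ler_wpM2l ?invr_ge0 ?(ltW W0)// ler_wpM2r// qmass_le_L1norm.
    move=> t /andP[xt tg].
    have -> : f t * ep t = phi t * (ep t * ep t).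
      by rewrite /phi -[f t in LHS]mulr1 -(ep_em t); ring.
    rewrite (normcM (phi t)) (normcM (ep t)) normc_ep.
    have tI : 0 <= t <= gamma by rewrite (le_trans x0).
    rewrite (le_trans (ler_wpM2r _ (phiM t tI))) ?mulr_ge0 ?expR_ge0//.
    have hW : expR (- (2 * eta * t)) * (expR (- complex.Im k * t) * expR (- complex.Im k * t)) <=
        W^-1 * expR (- (2 * eta * x)).
      rewrite /W -!expRD -expRN -expRD ler_expR.
      have : 0 <= (t - x) * (eta + complex.Im k) by rewrite mulr_ge0// ?subr_ge0//; lra.
      lra.
    by rewrite -(mulrA M) (mulrCA W^-1 M); exact: ler_wpM2l.
  have h3 : 2 * normc k * normc (phi x - 1) <= 2 * (L1norm q * (M * expR (- (2 * eta * x)))).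
    have -> : 2 * normc k = normc (2 * ('i * k)).
      exact: normc_2ik.
    rewrite -normcM e (le_trans (normcB _ _))//; lra.
  have h4 : 2 * (L1norm q * (M * expR (- (2 * eta * x)))) <= 2 * normc k * (beta * (M * expR (- (2 * eta * x)))).
    have := ler_wpM2r (ME (- (2 * eta * x))) Qb.
    by move: (M * _) => z; lra.
  by have := le_trans h3 h4; rewrite ler_pM2l// mulr_gt0.
have xsI : 0 <= xs <= gamma by rewrite xs0.
have M_le : M <= expR (2 * eta * gamma) / (1 - beta).
  rewrite ler_pdivlMr ?subr_gt0// mulrBr mulr1 lerBlDr.
  have h : normc (phi xs) <= 1 + beta * (M * expR (- (2 * eta * xs))).
    by rewrite -(subrK 1 (phi xs)) (le_trans (normcD _ _))// normc1 addrC lerD2l key.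
  rewrite {1}ME1 (le_trans (ler_wpM2r (expR_ge0 _) h))// mulrDl mul1r lerD//.
    by rewrite ler_expR ler_wpM2l// mulr_ge0.
  have e1 : expR (- (2 * eta * xs)) * expR (2 * eta * xs) = 1 by rewrite -expRD addNr expR0.
  have reassoc (x y z t : R) : z * t = 1 -> x * (y * z) * t = y * x.
    by move=> zt; rewrite -mulrA -(mulrA y) zt mulr1 mulrC.
  by rewrite (reassoc _ _ _ _ e1).
apply: (@le_trans _ _ (qmass q 0 gamma * (1 + beta * expR (2 * eta * gamma) / (1 - beta)))).
  apply: normc_outgoing => t tI.
  rewrite -(subrK 1 (f t * em t)) (le_trans (normcD _ _))// normc1 addrC lerD2l.
  rewrite (le_trans (key t tI))// -(mulrA beta) ler_wpM2l// (le_trans _ M_le)//.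
  rewrite ler_piMr// -expR0 ler_expR oppr_le0 !mulr_ge0//.
  by case/andP: tI.
rewrite ler_wpM2r ?qmass_le_L1norm// addr_ge0// !mulr_ge0 ?expR_ge0// invr_ge0; lra.
Qed.

(** If the component exp (i k x) of f vanishes to the left of the support, f
    satisfies the integral equation with kernel exp (i k |x - t|) / (2 i k), which is bounded by
    1 / (2 |k|) for Im k >= 0; evaluate it where |f| is maximal. *)
Lemma resonance_upper_half_plane : k != 0 -> 0 <= complex.Im k ->
  outgoing 0 gamma = 2 * ('i * k) -> 2 * normc k <= L1norm q.
Proof.
move=> k0 ik res.
have [xs xsJ hS] := EVT_max (ltW gamma0) (continuous_subspaceT (continuous_normc cf)).
have /andP[xs0 xsg] : 0 <= xs <= gamma by move: xsJ; rewrite in_itv.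
set S := normc (f xs) in hS.
have S0 : 0 < S.
  have : normc (f gamma) <= S by apply: hS; rewrite in_itv/= lexx ltW.
  apply: lt_le_trans; rewrite normc_gt0 (jost_plus_data jf).1.
  exact: cexp_neq0.
have fS t : 0 <= t <= gamma -> normc (f t) <= S by move=> h; apply: hS; rewrite in_itv.
have split : outgoing 0 gamma = outgoing 0 xs + outgoing xs gamma.
  apply: cintegral_itv_split => //.
  apply: cintegrable_mul_continuous; first exact: cintegrable_itv.
  by apply: ccontinuousM => //; exact: ccontinuous_cexp.
have e : 2 * ('i * k) * f xs = ep xs * outgoing 0 xs + em xs * incoming xs gamma.
  rewrite (volterra xsg) -res split; ring.
have e1 : expR (- complex.Im k * xs) * expR (complex.Im k * xs) = 1.
  by rewrite -expRD mulNr addNr expR0.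
have h1 : normc (ep xs * outgoing 0 xs) <= qmass q 0 xs * S.
  rewrite (normcM (ep xs)) normc_ep.
  rewrite (le_trans (ler_wpM2l (expR_ge0 _) (normc_outgoing (M := S * expR (complex.Im k * xs)) _)))//.
    move=> t /andP[t0 txs]; rewrite (normcM (f t)) normc_em ler_pM ?normc_ge0 ?expR_ge0//.
      by rewrite fS// t0 (le_trans txs).
    by rewrite ler_expR ler_wpM2l.
  by rewrite mulrCA (mulrCA _ S) e1 mulr1.
have h2 : normc (em xs * incoming xs gamma) <= qmass q xs gamma * S.
  rewrite (normcM (em xs)) normc_em.
  rewrite (le_trans (ler_wpM2l (expR_ge0 _) (normc_incoming (M := S * expR (- complex.Im k * xs)) _)))//.
    move=> t /andP[t0 txs]; rewrite (normcM (f t)) normc_ep ler_pM ?normc_ge0 ?expR_ge0//.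
      by rewrite fS// txs (le_trans xs0).
    by rewrite ler_expR ler_wnM2l// oppr_le0.
  by rewrite mulrCA (mulrCA _ S) [expR _ * expR _]mulrC e1 mulr1.
have : 2 * normc k * S <= L1norm q * S.
  have -> : 2 * normc k = normc (2 * ('i * k)).
    exact: normc_2ik.
  rewrite -normcM e (le_trans (normcD _ _))// (le_trans (lerD h1 h2))//.
  rewrite -mulrDl -qmass_split// ler_wpM2r ?qmass_le_L1norm// ltW//.
by rewrite ler_pM2r.
Qed.

End FixedEnergy.

Variables (fm fp : R -> R[i] -> R[i]).
Hypothesis jm : forall k, jost_minus q k (fm ^~ k).
Hypothesis jp : forall k, jost_plus q k (fp ^~ k).
Local Notation w := (jost_wronskian fm fp).

Lemma wronskian_at_zero k : w k = cderive (fp ^~ k) 0 + 'i * k * fp 0 k.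
Proof.
rewrite /jost_wronskian; have [-> ->] := jost_minus_data (jm k).
by rewrite mul1r mulNr opprK.
Qed.

Lemma wronskian_outgoing k : w k = 2 * ('i * k) - outgoing k (fp ^~ k) 0 gamma.
Proof.
rewrite wronskian_at_zero -(outgoing_identity (jp k) (ltW gamma0)).
by rewrite mulr0 cexp0 mul1r.
Qed.

Theorem wronskian_bound k (beta eta : R) : k != 0 -> 0 <= beta < 1 ->
  L1norm q <= beta * normc k -> 0 <= eta -> - complex.Im k <= eta ->
  normc (w k - 2 * ('i * k)) <= L1norm q * (1 + beta * expR (2 * eta * gamma) / (1 - beta)).
Proof.
move=> k0 b01 Qb e0 ke; rewrite wronskian_outgoing addrC addKr normc_opp.
exact: normc_outgoing_total (jp k) _ _ k0 b01 Qb e0 ke.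
Qed.

Theorem zeros_upper_half_plane k : 0 <= complex.Im k -> w k = 0 -> 2 * normc k <= L1norm q.
Proof.
move=> ik wk; have [->|k0] := eqVneq k 0; first by rewrite normc0 mulr0 L1norm_ge0.
apply: (resonance_upper_half_plane (jp k)) => //.
by move/eqP: wk; rewrite wronskian_outgoing subr_eq0 => /eqP.
Qed.

End Jost.

(** * The exponential is entire *)

Section EntireExponential.
Variable R : realType.
Implicit Types (z k c : R[i]) (x y r : R).

Lemma normc_powB z w (K : R) n : 1 <= K -> normc z <= K -> normc w <= K ->
  normc (z ^+ n - w ^+ n) <= n%:R * K ^+ n * normc (z - w).
Proof.
move=> K1 zK wK; have K0 : 0 <= K by lra.
elim: n => [|n ih]; first by rewrite !expr0 subrr normc0 !mul0r.
have -> : z ^+ n.+1 - w ^+ n.+1 = z * (z ^+ n - w ^+ n) + (z - w) * w ^+ n by rewrite !exprS; ring.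
rewrite (le_trans (normcD _ _))// (normcM z) (normcM (z - w)) normcX.
have wn : normc w ^+ n <= K * K ^+ n.
  apply: (@le_trans _ _ (K ^+ n)); first by rewrite lerXn2r ?nnegrE ?normc_ge0.
  by rewrite ler_peMl// exprn_ge0.
have h1 : normc z * normc (z ^+ n - w ^+ n) <= K * (n%:R * K ^+ n * normc (z - w)).
  by rewrite ler_pM ?normc_ge0.
have h2 : normc (z - w) * normc w ^+ n <= normc (z - w) * (K * K ^+ n).
  by rewrite ler_wpM2l ?normc_ge0.
rewrite (le_trans (lerD h1 h2))// le_eqVlt; apply/orP; left; apply/eqP.
by rewrite exprS -natr1; ring.
Qed.

(** The polynomials are (1 + z / n) ^ n: this is an n-th power, as is exp z, and
    the bases differ by O(1 / n ^ 2). *)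
Lemma entire_cexp : entire (@cexp R).
Proof.
move=> r0 e e0; pose r := `|r0|.
have r00 : 0 <= r by exact: normr_ge0.
have [n n0 hn] := arch_bound (2 * r + 4 * r ^+ 2 * expR r / e).
have nR : 0 < n%:R :> R by rewrite ltr0n.
have t1 : 0 <= 4 * r ^+ 2 * expR r / e by rewrite !mulr_ge0 ?sqr_ge0 ?expR_ge0// invr_ge0 ltW.
exists ((1 + n%:R^-1%:C *: 'X) ^+ n) => z zr0.
have zr : normc z <= r by rewrite (le_trans zr0)// ler_norm.
rewrite horner_exp !hornerE.
set u := n%:R^-1%:C * z.
have nu : normc u = normc z / n%:R.
  by rewrite /u (normcM _ z) normc_real ger0_norm ?invr_ge0 ?ler0n// mulrC.
have -> : cexp z = cexp u ^+ n.
  rewrite -cexpMn; congr cexp.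
  rewrite /u -mulrnAl -(rmorphMn (real_complex R))/= -[_ *+ n]mulr_natr mulVf ?gt_eqF//.
  by rewrite mul1r.
have u1 : normc u <= 1 / 2.
  rewrite nu ler_pdivrMr//; lra.
have K1 : 1 <= expR (normc u) by rewrite -expR0 ler_expR normc_ge0.
have h1 : normc (cexp u) <= expR (normc u).
  by rewrite normc_cexp ler_expR (le_trans (ler_norm _))// normc_Re.
have h2 : normc (1 + u) <= expR (normc u).
  by rewrite (le_trans (normcD _ _))// normc1 expR_ge1Dx.
rewrite (le_trans (normc_powB n K1 h1 h2))//.
have -> : expR (normc u) ^+ n = expR (normc z).
  by rewrite -expRM_natl nu; congr expR; rewrite mulrC divfK ?gt_eqF.
rewrite opprD addrA.
have h3 := cexp_taylor1 u1.
have h4 : n%:R * expR (normc z) * normc (cexp u - 1 - u) <= n%:R * expR r * (4 * (r / n%:R) ^+ 2).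
  rewrite ler_pM ?mulr_ge0 ?normc_ge0 ?expR_ge0 ?ler0n//.
    by rewrite ler_wpM2l ?ler0n// ler_expR.
  rewrite (le_trans h3)// ler_wpM2l// ler_pXn2r ?nnegrE ?normc_ge0 ?divr_ge0 ?ler0n//.
  by rewrite nu ler_wpM2r// invr_ge0 ler0n.
rewrite (le_trans h4)//.
have -> : n%:R * expR r * (4 * (r / n%:R) ^+ 2) = 4 * r ^+ 2 * expR r / n%:R.
  by field; rewrite gt_eqF.
rewrite ler_pdivrMr// [leRHS]mulrC -ler_pdivrMr//; lra.
Qed.

End EntireExponential.

(** * The Wronskian is entire *)

Section EulerScheme.
Variable R : realType.
Local Notation mu := (@lebesgue_measure R).
Implicit Types (f g h e : R -> R[i]) (a b s t x y : R) (z k c l : R[i]).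
Variables (q : R -> R[i]) (gamma : R).
Hypothesis iq : cintegrable setT q.
Hypothesis gamma0 : 0 < gamma.
Hypothesis supp_q : ess_supp q `<=` `[0, gamma].

Lemma qmass_small (d h0 : R) : 0 < d -> 0 < h0 -> exists n : nat,
  [/\ (0 < n)%N, gamma / n%:R <= h0 & forall s, qmass q s (s + gamma / n%:R) <= d].
Proof.
move=> d0 h00; have inq := integrable_normc measurableT iq.
have [dl [dl0 h]] := integral_normr_continuous inq d0.
have [n n0 hn] := arch_bound (gamma / dl + 1 + gamma / h0).
have nR : 0 < n%:R :> R by rewrite ltr0n.
have q1 : 0 <= gamma / dl by rewrite divr_ge0// ltW.
have q2 : 0 <= gamma / h0 by rewrite divr_ge0// ltW.
exists n; split => // [|s]; first by rewrite ler_pdivrMr// [leRHS]mulrC -ler_pdivrMr//; lra.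
have := h `[s, (s + gamma / n%:R)]%classic (measurable_itv _).
have -> : qmass q s (s + gamma / n%:R) = \int[mu]_(x in `[s, (s + gamma / n%:R)]) `|normc (q x)|.
  by apply: eq_Rintegral => x _; rewrite ger0_norm ?normc_ge0.
move=> h1; apply: ltW; apply: h1.
have := @lebesgue_measure_itv R `[s, (s + gamma / n%:R)] => /= ->.
rewrite lte_fin ltrDl divr_gt0// -EFinB lte_fin addrC addKr.
by rewrite ltr_pdivrMr// [ltRHS]mulrC -ltr_pdivrMr//; lra.
Qed.

Section OneEnergy.
Variables (k : R[i]) (f : R -> R[i]).
Hypothesis sf : schrodinger_solution q k f.
Local Notation g := (cderive f).
Local Notation m x := (normc (f x) + normc (g x)).

(** Backward Gronwall estimate on an interval of small mass: f' oscillates by at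
    most half of the supremum of |f|, and f by at most half of that of |f'|, so
    that both suprema are controlled by the values at the right end point. *)
Lemma solution_step_bound s t : s <= t -> t - s <= 1 / 4 ->
  qmass q s t + normc k ^+ 2 * (t - s) <= 1 / 2 ->
  forall x, s <= x <= t -> m x <= 2 * m t.
Proof.
move=> st ts small x xst.
have cf := solution_continuous sf.
have [xs xsJ hF] := EVT_max st (continuous_subspaceT (continuous_normc cf)).
have /andP[sx xt] : s <= xs <= t by move: xsJ; rewrite in_itv.
set F := normc (f xs) in hF.
have F0 : 0 <= F by exact: normc_ge0.
have hF' y : s <= y <= t -> normc (f y) <= F by move=> h; apply: hF; rewrite in_itv.
have gb y : s <= y <= t -> normc (g y) <= normc (g t) + 1 / 2 * F.
  move=> /andP[sy yt]; rewrite -(subrK (g t) (g y)) (le_trans (normcD _ _))// addrC lerD2l normcBC.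
  rewrite (le_trans (solution_derivative_osc iq sf hF' sy yt (lexx t)))//.
  by rewrite ler_wpM2r.
have hFt : F <= normc (f t) + 1 / 2 * (normc (g t) + 1 / 2 * F).
  have h : forall y, xs <= y <= t -> normc (g y - 0) <= normc (g t) + 1 / 2 * F.
    by move=> y /andP[y1 y2]; rewrite subr0 gb// y2 (le_trans sx).
  have := mean_value_bound xt sf.1 h; rewrite mulr0 subr0 => h1.
  have h2 : F <= normc (f t) + normc (f t - f xs).
    by rewrite /F -{1}(subrK (f t) (f xs)) (le_trans (normcD _ _))// addrC lerD2l normcBC.
  have h3 : 2 * (t - xs) * (normc (g t) + 1 / 2 * F) <= 1 / 2 * (normc (g t) + 1 / 2 * F).
    rewrite ler_wpM2r ?addr_ge0 ?normc_ge0 ?mulr_ge0//; lra.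
  lra.
have := hF' x xst; have := gb x xst; have := normc_ge0 (g t); lra.
Qed.

Lemma solution_uniform_bound (r : R) (n : nat) (C0 : R) : (0 < n)%N ->
  gamma / n%:R <= 1 / 4 -> (forall s, qmass q s (s + gamma / n%:R) + r ^+ 2 * (gamma / n%:R) <= 1 / 2) ->
  normc k <= r -> m gamma <= C0 ->
  forall x, 0 <= x <= gamma -> m x <= C0 * 2 ^+ n.
Proof.
move=> n0 h4 hs kr m0.
have nR : 0 < n%:R :> R by rewrite ltr0n.
set h := gamma / n%:R in h4 hs.
have hp : 0 < h by rewrite divr_gt0.
have C00 : 0 <= C0 by rewrite (le_trans _ m0)// addr_ge0 ?normc_ge0.
have nh : n%:R * h = gamma by rewrite mulrC divfK ?gt_eqF.
suff step i x : gamma - i%:R * h <= x <= gamma -> m x <= C0 * 2 ^+ i.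
  by move=> x /andP[x0 xg]; apply: step; rewrite nh subrr x0.
elim: i x => [|i ih] x /andP[x1 x2].
  by rewrite expr0 mulr1; move: x1; rewrite mul0r subr0 => x1; rewrite (_ : x = gamma)//; apply/eqP; rewrite eq_le x2.
have [xt|xt] := leP (gamma - i%:R * h) x.
  rewrite (le_trans (ih x _)) ?xt// ler_wpM2l// exprS ler_peMl ?exprn_ge0//; lra.
pose t := gamma - i%:R * h; pose s := gamma - i.+1%:R * h.
have st : t = s + h by rewrite /t /s -natr1; ring.
have tg : t <= gamma by rewrite /t lerBlDr lerDl mulr_ge0// ltW.
have s_le : s <= t by rewrite st lerDl ltW.
have ts : t - s = h by rewrite st; ring.
have := @solution_step_bound s t s_le; rewrite ts => /(_ h4).
have small : qmass q s t + normc k ^+ 2 * h <= 1 / 2.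
  rewrite (le_trans _ (hs s))// -st lerD2l ler_wpM2r ?(ltW hp)//.
  by rewrite ler_pXn2r ?nnegrE ?normc_ge0// (le_trans _ kr) ?normc_ge0.
move=> /(_ small x) hx; rewrite (le_trans (hx _))//.
  by rewrite x1 ltW.
rewrite exprS mulrCA ler_wpM2l// ih// /t lexx/=.
by rewrite /t lerBlDr lerDl mulr_ge0// ltW.
Qed.

(** The error of a backward Euler step is the length of the step times the
    variation of f' for f, and the mass of q - k ^ 2 on the step times the
    variation of f for f'. *)
Lemma euler_local_error s t (M : R) : s <= t ->
  (forall x, s <= x <= t -> m x <= M) ->
  normc (f s - (f t - (t - s)%:C * g t)) <= 2 * (t - s) * ((qmass q s t + normc k ^+ 2 * (t - s)) * M) /\
  normc (g s - (g t - (cintegral `[s, t] q - (t - s)%:C * k ^+ 2) * f t)) <=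
     2 * (t - s) * ((qmass q s t + normc k ^+ 2 * (t - s)) * M).
Proof.
move=> st hM.
have cf := solution_continuous sf.
have iqI : cintegrable `[s, t] q by exact: cintegrable_itv.
have fM x : s <= x <= t -> normc (f x) <= M.
  by move=> /hM; apply: le_trans; rewrite lerDl normc_ge0.
have gM x : s <= x <= t -> normc (g x) <= M.
  by move=> /hM; apply: le_trans; rewrite lerDr normc_ge0.
have M0 : 0 <= M by rewrite (le_trans _ (fM s _)) ?normc_ge0// lexx.
have h0 : 0 <= t - s by rewrite subr_ge0.
split.
  rewrite normcBC (_ : f t - _ - f s = f t - f s - (t - s)%:C * g t); last by ring.
  apply: mean_value_bound => //; first exact: sf.1.
  by move=> x /andP[sx xt]; rewrite normcBC (solution_derivative_osc iq sf fM).
have cd : ccontinuous (fun x => f t + (-1) * f x).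
  apply: ccontinuousD; first exact: ccontinuous_cst.
  by apply: ccontinuousM => //; exact: ccontinuous_cst.
have ch : ccontinuous (fun=> f t) by exact: ccontinuous_cst.
have fd x : s <= x <= t -> normc (f t + (-1) * f x) <= 2 * (t - s) * M.
  move=> /andP[sx xt]; have := @mean_value_bound R f 0 x t M xt sf.1.
  rewrite mulr0 subr0 mulN1r => /(_ _)/le_trans; apply.
    by move=> y /andP[xy yt]; rewrite subr0 gM// yt (le_trans sx).
  by rewrite ler_wpM2r// ler_wpM2l// lerB.
have -> : g s - (g t - (cintegral `[s, t] q - (t - s)%:C * k ^+ 2) * f t) =
    cintegral `[s, t] (fun x => q x * (f t + (-1) * f x)) -
    k ^+ 2 * cintegral `[s, t] (fun x => f t + (-1) * f x).
  have mI : measurable (`[s, t] : set (measurableTypeR R)) by exact: measurable_itv.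
  have iqf := cintegrable_mul_continuous iqI cf.
  have ifc := cintegrable_continuous s t cf.
  have -> : cintegral `[s, t] (fun x => q x * (f t + (-1) * f x)) =
      f t * cintegral `[s, t] q + (-1) * cintegral `[s, t] (fun x => q x * f x).
    rewrite -!cintegralZ// -cintegralD//; last 2 first.
    - exact: cintegrableZ.
    - exact: cintegrableZ.
    by congr cintegral; apply/funext => x; ring.
  rewrite cintegralD//; last 2 first.
  - exact: cintegrable_continuous.
  - exact: cintegrableZ.
  rewrite cintegralZ// cintegral_cst//.
  have inc := solution_derivative_increment iq sf st.
  have -> : g s = g t - (cintegral `[s, t] (fun x => q x * f x) - k ^+ 2 * cintegral `[s, t] f).
    by rewrite -inc; ring.
  ring.
rewrite (le_trans (normcB _ _))//.
have b1 := normc_cintegral_mul_le iqI cd fd.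
have b2 := normc_cintegral_continuous_le st cd fd.
rewrite (normcM (k ^+ 2)) normcX.
have := ler_wpM2l (sqr_ge0 (normc k)) b2.
rewrite -/(qmass q s t) in b1; lra.
Qed.

End OneEnergy.

(** The Euler scheme for (f, f') on the subdivision of [0, gamma] in n steps, run
    from the right end point. The integrals of q over the steps do not depend on
    k, so each step maps polynomials in k to polynomials in k. *)
Fixpoint euler (n : nat) (p0 : {poly R[i]} * {poly R[i]}) (i : nat) :=
  if i is j.+1 then
    let p := euler n p0 j in
    let h := gamma / n%:R in
    let Q := cintegral `[gamma - j.+1%:R * h, gamma - j%:R * h] q in
    (p.1 - h%:C *: p.2, p.2 - (Q%:P - h%:C *: 'X ^+ 2) * p.1)
  else p0.

(** Discrete Gronwall: the local errors are summable because the total mass of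
    |q| is finite, and they carry a factor gamma / n. *)
Lemma euler_error (n : nat) p0 (k : R[i]) f (r M d : R) : (0 < n)%N ->
  schrodinger_solution q k f -> normc k <= r ->
  (forall x, 0 <= x <= gamma -> normc (f x) + normc (cderive f x) <= M) ->
  normc (f gamma - p0.1.[k]) + normc (cderive f gamma - p0.2.[k]) <= d ->
  normc (f 0 - (euler n p0 n).1.[k]) + normc (cderive f 0 - (euler n p0 n).2.[k]) <=
    (d + 4 * (gamma / n%:R) * M) * expR ((1 + r ^+ 2) * gamma + L1norm q).
Proof.
move=> n0 sf kr hM hd.
have nR : 0 < n%:R :> R by rewrite ltr0n.
set h := gamma / n%:R.
have hp : 0 < h by rewrite divr_gt0.
have nh : n%:R * h = gamma by rewrite mulrC divfK ?gt_eqF.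
have M0 : 0 <= M by rewrite (le_trans _ (hM 0 _)) ?addr_ge0 ?normc_ge0// lexx ltW.
have kr2 : normc k ^+ 2 <= r ^+ 2.
  by rewrite ler_pXn2r ?nnegrE ?normc_ge0// (le_trans _ kr) ?normc_ge0.
pose t i := gamma - i%:R * h.
pose E i := normc (f (t i) - (euler n p0 i).1.[k]) + normc (cderive f (t i) - (euler n p0 i).2.[k]).
pose c := 4 * h * M.
have c0 : 0 <= c by rewrite !mulr_ge0// ltW.
have E0 i : 0 <= E i by rewrite addr_ge0 ?normc_ge0.
have t0 : t 0%N = gamma by rewrite /t mul0r subr0.
have tn : t n = 0 by rewrite /t nh subrr.
have tS i : t i = t i.+1 + h by rewrite /t -natr1; ring.
have tI i : (i <= n)%N -> 0 <= t i <= gamma.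
  move=> i_n; rewrite /t subr_ge0 -{1}nh ler_wpM2r ?ler_nat ?(ltW hp)//=.
  by rewrite lerBlDr lerDl mulr_ge0// ltW.
pose a i := h + (qmass q (t i.+1) (t i) + r ^+ 2 * h).
have step i : (i < n)%N -> E i.+1 + c <= (E i + c) * expR (a i).
  move=> i_n.
  have st : t i.+1 <= t i by rewrite (tS i) lerDl ltW.
  have ts : t i - t i.+1 = h by rewrite (tS i); ring.
  have /andP[t1 _] := tI _ i_n; have /andP[_ t2] := tI _ (ltnW i_n).
  have hM' x : t i.+1 <= x <= t i -> normc (f x) + normc (cderive f x) <= M.
    by move=> /andP[x1 x2]; rewrite hM// (le_trans t1)//= (le_trans x2).
  have [e1 e2] := euler_local_error sf st hM'; rewrite ts in e1 e2.
  set Q := cintegral `[t i.+1, t i] q in e2.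
  set qm := qmass q (t i.+1) (t i) in e1 e2.
  have qm0 : 0 <= qm by exact: qmass_ge0.
  have loc : 2 * h * ((qm + normc k ^+ 2 * h) * M) <= 2 * h * ((qm + r ^+ 2 * h) * M).
    have hp' := ltW hp.
    apply: ler_wpM2l; first by rewrite mulr_ge0.
    apply: ler_wpM2r => //; apply: lerD => //; exact: ler_wpM2r.
  have nQ : normc Q <= qm.
    have := @normc_cintegral_le R `[t i.+1, t i]%classic q (measurable_itv _) (cintegrable_itv iq _ _).
    by [].
  have nc : normc (Q - h%:C * k ^+ 2) <= qm + r ^+ 2 * h.
    rewrite (le_trans (normcB _ _))// lerD// (normcM h%:C) normcX normc_real gtr0_norm//.
    by rewrite mulrC ler_wpM2r// ltW.
  set P := euler n p0 i.
  have P1 : (euler n p0 i.+1).1.[k] = P.1.[k] - h%:C * P.2.[k].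
    by rewrite /= -/P -/h !hornerE.
  have P2 : (euler n p0 i.+1).2.[k] = P.2.[k] - (Q - h%:C * k ^+ 2) * P.1.[k].
    by rewrite /= -/P -/h hornerD hornerN hornerM hornerD hornerN hornerC hornerZ hornerXn.
  set x := normc (f (t i) - P.1.[k]); set y := normc (cderive f (t i) - P.2.[k]).
  have x0 : 0 <= x by exact: normc_ge0.
  have y0 : 0 <= y by exact: normc_ge0.
  have b1 : normc (f (t i.+1) - (euler n p0 i.+1).1.[k]) <= 2 * h * ((qm + r ^+ 2 * h) * M) + (x + h * y).
    have -> : f (t i.+1) - (euler n p0 i.+1).1.[k] =
      (f (t i.+1) - (f (t i) - h%:C * cderive f (t i))) +
      ((f (t i) - P.1.[k]) - h%:C * (cderive f (t i) - P.2.[k])) by rewrite P1; ring.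
    rewrite (le_trans (normcD _ _))// lerD ?(le_trans e1)//.
    by rewrite (le_trans (normcB _ _))// (normcM h%:C) normc_real gtr0_norm.
  have b2 : normc (cderive f (t i.+1) - (euler n p0 i.+1).2.[k]) <=
      2 * h * ((qm + r ^+ 2 * h) * M) + (y + (qm + r ^+ 2 * h) * x).
    have -> : cderive f (t i.+1) - (euler n p0 i.+1).2.[k] =
      (cderive f (t i.+1) - (cderive f (t i) - (Q - h%:C * k ^+ 2) * f (t i))) +
      ((cderive f (t i) - P.2.[k]) - (Q - h%:C * k ^+ 2) * (f (t i) - P.1.[k])) by rewrite P2; ring.
    rewrite (le_trans (normcD _ _))// lerD ?(le_trans e2)//.
    rewrite (le_trans (normcB _ _))// lerD2l (normcM (Q - _)).
    by rewrite ler_wpM2r.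
  have ea : 1 + a i <= expR (a i) := expR_ge1Dx _.
  have Ec0 : 0 <= E i + c by rewrite addr_ge0.
  rewrite (le_trans _ (ler_wpM2l Ec0 ea))//.
  have b : E i.+1 <= 4 * h * ((qm + r ^+ 2 * h) * M) + (x + h * y) + (y + (qm + r ^+ 2 * h) * x).
    by rewrite (le_trans (lerD b1 b2))//; lra.
  rewrite (le_trans (lerD b (lexx c)))//.
  have -> : E i = x + y by [].
  have -> : a i = h + (qm + r ^+ 2 * h) by [].
  rewrite /c -subr_ge0.
  set D := qm + r ^+ 2 * h.
  have D0 : 0 <= D := addr_ge0 qm0 (mulr_ge0 (sqr_ge0 r) (ltW hp)).
  have -> : (x + y + 4 * h * M) * (1 + (h + D)) - (4 * h * (D * M) + (x + h * y) + (y + D * x) + 4 * h * M) =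
    h * x + D * y + 4 * h * M * h by ring.
  have hp' := ltW hp.
  exact: addr_ge0 (addr_ge0 (mulr_ge0 hp' x0) (mulr_ge0 D0 y0)) (mulr_ge0 c0 hp').
have total i : (i <= n)%N -> E i + c <= (d + c) * expR (i%:R * (h + r ^+ 2 * h) + qmass q (t i) gamma).
  elim: i => [_|i ih i_n].
    rewrite mul0r add0r t0 /qmass Rintegral_itv1 expR0 mulr1 lerD2r.
    by rewrite /E t0.
  rewrite (le_trans (step i i_n))//.
  rewrite (le_trans (ler_wpM2r (expR_ge0 _) (ih (ltnW i_n))))//.
  rewrite -mulrA -expRD ler_wpM2l//.
    by rewrite addr_ge0// (le_trans _ hd)// addr_ge0 ?normc_ge0.
  have /andP[_ t2] := tI _ (ltnW i_n).
  have st : t i.+1 <= t i by rewrite (tS i) lerDl ltW.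
  by rewrite ler_expR (qmass_split iq st t2) /a -natr1; lra.
have := total n (leqnn _); rewrite tn => h1.
have : E n <= E n + c by rewrite lerDl.
rewrite {1}/E tn => /le_trans; apply; apply: (le_trans h1).
apply: ler_wpM2l; first by rewrite addr_ge0// (le_trans _ hd)// addr_ge0 ?normc_ge0.
rewrite ler_expR lerD ?qmass_le_L1norm//.
by rewrite -nh le_eqVlt; apply/orP; left; apply/eqP; ring.
Qed.

Variables (fm fp : R -> R[i] -> R[i]).
Hypothesis jm : forall k, jost_minus q k (fm ^~ k).
Hypothesis jp : forall k, jost_plus q k (fp ^~ k).

(** To the right of the support the Jost solution is exp (i k x), which is entire
    in k; the Euler scheme started from polynomial approximations of its data at
    gamma gives polynomials in k that converge uniformly on disks to the data at
    0, in terms of which the Wronskian is expressed. *)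
Theorem wronskian_entire : entire (jost_wronskian fm fp).
Proof.
move=> r0 e e0; pose r := `|r0|.
have rp : 0 <= r by exact: normr_ge0.
have hexp : entire (fun k : R[i] => cexp ('i * k * gamma%:C)).
  apply: entire_ext (entire_affine 0 ('i * gamma%:C) (@entire_cexp R)) => k.
  by rewrite add0r mulrAC.
have hexp' : entire (fun k : R[i] => 'i * k * cexp ('i * k * gamma%:C)).
  apply: entire_ext (entireM (entireM (entire_cst 'i) (@entire_id R)) hexp) => k //.
have [K1 K10 hK1] := entire_bounded r hexp.
have [K2 K20 hK2] := entire_bounded r hexp'.
(* a bound on the solutions that is uniform in k, needed for the local errors *)
pose C0 := K1 + K2.
have [M M0 hM] : exists2 M, 0 <= M & forall k, normc k <= r -> forall x, 0 <= x <= gamma ->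
    normc (fp x k) + normc (cderive (fp ^~ k) x) <= M.
  have r2 : 0 <= r ^+ 2 by exact: sqr_ge0.
  have d4 : 0 < 1 / 4 :> R by [].
  have h4 : 0 < (1 / 4) / (1 + r ^+ 2) by rewrite divr_gt0//; lra.
  have [n [n0 hn hq]] := qmass_small d4 h4.
  have nR : 0 < n%:R :> R by rewrite ltr0n.
  have hp : 0 <= gamma / n%:R by rewrite divr_ge0// ltW.
  move: hn; rewrite ler_pdivlMr; last by lra.
  rewrite mulrDr mulr1 => hn.
  have hr : 0 <= gamma / n%:R * r ^+ 2 by rewrite mulr_ge0.
  exists (C0 * 2 ^+ n); first by rewrite mulr_ge0 ?exprn_ge0// addr_ge0.
  move=> k kr x xg; apply: (solution_uniform_bound (jp k).1 n0 _ _ kr _ xg).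
  - lra.
  - by move=> s; have := hq s; lra.
  - have [-> ->] := jost_plus_data iq supp_q (jp k).
    by rewrite lerD ?hK1 ?hK2.
pose S := expR ((1 + r ^+ 2) * gamma + L1norm q).
have S0 : 0 < S by exact: expR_gt0.
pose A := S * (1 + r).
have A0 : 0 < A by rewrite mulr_gt0//; lra.
have [n n0 hn] := arch_bound (8 * gamma * M * A / e).
have nR : 0 < n%:R :> R by rewrite ltr0n.
pose d := e / (4 * A).
have d0 : 0 < d by rewrite divr_gt0// mulr_gt0.
have [p1 hp1] := hexp r _ d0; have [p2 hp2] := hexp' r _ d0.
pose P := euler n (p1, p2) n.
exists (P.2 + 'i *: ('X * P.1)) => k kr0.
have kr : normc k <= r by rewrite (le_trans kr0)// ler_norm.
have [f1 f2] := jost_plus_data iq supp_q (jp k).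
have hd : normc (fp gamma k - (p1, p2).1.[k]) + normc (cderive (fp ^~ k) gamma - (p1, p2).2.[k]) <= d + d.
  by rewrite f1 f2 lerD ?hp1 ?hp2.
have := euler_error n0 (jp k).1 kr (hM k kr) hd.
rewrite -/P -/S => h.
have -> := wronskian_at_zero iq supp_q fp jm k.
rewrite hornerD hornerZ hornerM hornerX.
have -> : cderive (fp^~ k) 0 + 'i * k * fp 0 k - (P.2.[k] + 'i * (k * P.1.[k])) =
   (cderive (fp^~ k) 0 - P.2.[k]) + 'i * k * (fp 0 k - P.1.[k]) by ring.
rewrite (le_trans (normcD _ _))// (normcM ('i * k)) (normcM 'i).
have -> : normc 'i = 1 :> R by rewrite /normc expr0n add0r expr1n sqrtr1.
rewrite mul1r.
set x := normc (fp 0 k - P.1.[k]) in h *; set y := normc (cderive (fp^~ k) 0 - P.2.[k]) in h *.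
have x0 : 0 <= x by exact: normc_ge0.
have y0 : 0 <= y by exact: normc_ge0.
apply: (@le_trans _ _ ((x + y) * (1 + r))).
  have : normc k * x <= r * x by rewrite ler_wpM2r.
  have : 0 <= y * r by rewrite mulr_ge0.
  lra.
have r1 : 0 <= 1 + r by lra.
rewrite (le_trans (ler_wpM2r r1 h))//.
have -> : (d + d + 4 * (gamma / n%:R) * M) * S * (1 + r) = (d * A) * 2 + (8 * gamma * M * A / n%:R) / 2.
  rewrite /A; field; rewrite gt_eqF//.
have -> : d * A = e / 4 by rewrite /d; field; rewrite gt_eqF.
have : 8 * gamma * M * A / n%:R <= e by rewrite ler_pdivrMr// [leRHS]mulrC -ler_pdivrMr.
lra.
Qed.

End EulerScheme.

(** * Counting zeros with multiplicity *)

Section CountingZeros.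
Variable R : realType.
Implicit Types (w g : R[i] -> R[i]) (z k c : R[i]) (D : set R[i]).

Definition repeat_by (m : R[i] -> nat) (F : seq R[i]) := flatten [seq nseq (m z) z | z <- F].

Lemma mem_repeat_by m F a : a \in repeat_by m F -> a \in F.
Proof. by move=> /flatten_mapP[z zF]; rewrite mem_nseq => /andP[_ /eqP->]. Qed.

Lemma size_repeat_by m F : size (repeat_by m F) = (\sum_(z <- F) m z)%N.
Proof.
rewrite size_flatten /shape -map_comp sumnE big_map; apply: eq_bigr => z _.
by rewrite /= size_nseq.
Qed.

Lemma factor_zeros w m F : entire w -> uniq F ->
  (forall z j, z \in F -> (j < m z)%N -> derive1n j (w : R[i]^o -> R[i]^o) z = 0) ->
  exists2 g, entire g & forall k, w k = \prod_(a <- repeat_by m F) (k - a) * g k.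
Proof.
move=> ew; elim: F => [|z F ih] /=.
  by move=> _ _; exists w => // k; rewrite big_nil mul1r.
move=> /andP[zF uF] hd.
have [|g eg hg] := ih uF; first by move=> y j yF; apply: hd; rewrite inE yF orbT.
have [h eh hh] : exists2 h, entire h & w = fun k => (k - z) ^+ m z * h k.
  by apply: entire_divides => // j jm; apply: hd => //; rewrite inE eqxx.
have [||g' eg' hg'] := @entire_divides_prod R g h (repeat_by m F) z (m z) eg eh.
- by apply/negP => /mem_repeat_by; exact/negP.
- by rewrite -hh; apply/funext => k; rewrite hg.
exists g' => // k.
rewrite /repeat_by /= big_cat /= -/(repeat_by m F) big_nseq -Monoid.iteropE /= hg hg'.
by rewrite mulrCA mulrA.
Qed.

Lemma zero_orderE w z n : derive1n n (w : R[i]^o -> R[i]^o) z != 0 ->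
  (forall j, (j < n)%N -> derive1n j (w : R[i]^o -> R[i]^o) z = 0) ->
  zero_order w z = n%:R%:E.
Proof.
move=> dn hlt; apply/eqP; rewrite eq_le; apply/andP; split.
  by apply: ereal_inf_lbound; exists n.
apply: le_ereal_inf_tmp => _ [j /= dj <-]; rewrite lee_fin ler_nat leqNgt.
by apply/negP => /hlt; exact/eqP.
Qed.

(** A zero of order at least m contributes a factor (k - z) ^ m, so that any part
    of the sum of orders is the degree of a polynomial dividing w. Applied to a
    single zero, the bound on these degrees shows that no order is infinite. *)
Lemma nb_zeros_le w D (b : R) : entire w ->
  (forall s g, entire g -> (forall a, a \in s -> D a /\ w a = 0) ->
    (forall k, w k = \prod_(a <- s) (k - a) * g k) -> (size s)%:R <= b) ->
  (nb_zeros w D <= b%:E)%E.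
Proof.
move=> ew hb.
have bound m F : uniq F -> (forall z, z \in F -> D z /\ w z = 0) ->
    (forall z j, z \in F -> (j < m z)%N -> derive1n j (w : R[i]^o -> R[i]^o) z = 0) ->
    (\sum_(z <- F) m z)%N%:R <= b.
  move=> uF FD hd; have [g eg hg] := factor_zeros ew uF hd.
  by rewrite -size_repeat_by; apply: (hb _ g) => // a /mem_repeat_by; exact: FD.
pose m z := Num.truncn (fine (zero_order w z)).
have fin z : D z -> w z = 0 -> zero_order w z = (m z)%:R%:E /\
    forall j, (j < m z)%N -> derive1n j (w : R[i]^o -> R[i]^o) z = 0.
  move=> Dz wz.
  have ex : exists n, derive1n n (w : R[i]^o -> R[i]^o) z != 0.
    apply: contrapT => /forallNP h.
    pose n := (Num.truncn `|b|).+1.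
    have : (\sum_(y <- [:: z]) n)%N%:R <= b.
      apply: (bound (fun=> n)) => // [y|y j]; rewrite ?inE => /eqP-> //.
      by move=> _; have /negP := h j; rewrite negbK => /eqP.
    rewrite big_seq1 leNgt => /negP; apply.
    by rewrite (le_lt_trans (ler_norm _))// truncnS_gt.
  case: (ex_minnP ex) => n dn hmin.
  have hlt j : (j < n)%N -> derive1n j (w : R[i]^o -> R[i]^o) z = 0.
    move=> jn; apply/eqP; apply: contraLR jn => /hmin; by rewrite -leqNgt.
  have zo := zero_orderE dn hlt.
  by have -> : m z = n by rewrite /m zo /= natrK.
apply: ge_ereal_sup => _ [A [finA AS] <-].
rewrite fsbig_finite//=.
have FS z : z \in finmap.enum_fset (fset_set A) -> D z /\ w z = 0.
  by rewrite in_fset_set// => /set_mem /AS.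
rewrite (eq_big_seq (fun z => (m z)%:R%:E)); last first.
  by move=> z /FS[Dz wz]; have [-> _] := fin z Dz wz.
rewrite sumEFin lee_fin -natr_sum; apply: bound; [exact: finmap.fset_uniq|exact: FS|].
by move=> z j /FS[Dz wz]; have [_] := fin z Dz wz; apply.
Qed.

End CountingZeros.

(** * Jensen's inequality for the Wronskian *)

Section JensenWronskian.
Variable R : realType.
Implicit Types (w g : R[i] -> R[i]) (z k c : R[i]).

(** Lengths are measured in units of rho, with b = |q|_1 / rho and a = gamma rho.
    On the circle of radius rad around i y one has |k| >= rad - y, and there
    |w k| <= 2 |k| * amplitude * growth ^ s, where s vanishes on the upper half of
    the circle and equals |sin t| on the lower half; at the centre
    |w (i y)| >= 2 * center_value. *)
Definition amplitude (b y rad : R) := 1 + b / (2 * (rad - y - b)).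
Definition coupling (b y rad : R) := b ^+ 2 / ((rad - y) * (rad - y - b)).
Definition growth (a b y rad : R) :=
  1 + coupling b y rad / (2 * amplitude b y rad) * (expR (2 * a * rad) - 1).
Definition center_value (b y : R) := y * (1 - b / (2 * (y - b))).

Lemma product_antipodal c z : normc (c + z) * normc (c - z) <= normc c ^+ 2 + normc z ^+ 2.
Proof.
rewrite -normcM (_ : (c + z) * (c - z) = c ^+ 2 - z ^+ 2); last by ring.
by rewrite (le_trans (normcB _ _))// !normcX.
Qed.

Variables (q : R -> R[i]) (gamma : R).
Hypothesis iq : cintegrable setT q.
Hypothesis gamma0 : 0 < gamma.
Hypothesis supp_q : ess_supp q `<=` `[0, gamma].
Variables (fm fp : R -> R[i] -> R[i]).
Hypothesis jm : forall k, jost_minus q k (fm ^~ k).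
Hypothesis jp : forall k, jost_plus q k (fp ^~ k).
Local Notation w := (jost_wronskian fm fp).

Section Circle.
Variables (rho b y rad : R).
Hypothesis rho0 : 0 < rho.
Hypothesis Qb : L1norm q = b * rho.
Hypothesis b0 : 0 <= b.
Hypothesis by_ : b < y.
Hypothesis ybR : y + b < rad.
Local Notation c := (0 +i* (y * rho)).
Local Notation a := (gamma * rho).
Local Notation A := (amplitude b y rad).
Local Notation kap := (coupling b y rad).
Local Notation B := (growth a b y rad).

Let A1 : 1 <= A.
Proof.
by rewrite /amplitude lerDl divr_ge0// mulr_ge0//; move: ybR; lra.
Qed.

Let kap0 : 0 <= kap.
Proof.
have [hr hb hby hyb] := And4 rho0 b0 by_ ybR.
by rewrite /coupling divr_ge0 ?sqr_ge0// mulr_ge0//; lra.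
Qed.

Let p01 : 0 <= kap / (2 * A) <= 1.
Proof.
have [hr hb hby hyb] := And4 rho0 b0 by_ ybR.
have A0 : 0 < 2 * A by move: A1; lra.
rewrite divr_ge0 ?(ltW A0)//= ler_pdivrMr// mul1r /coupling /amplitude.
have d1 : 0 < rad - y by lra.
have d2 : 0 < rad - y - b by lra.
have -> : 2 * (1 + b / (2 * (rad - y - b))) = (2 * (rad - y - b) + b) / (rad - y - b).
  by field; rewrite gt_eqF.
rewrite invfM mulrA ler_wpM2r ?invr_ge0 ?(ltW d2)//.
rewrite ler_pdivrMr//; nra.
Qed.

Lemma growth_ge1 : 1 <= B.
Proof.
have [hr hb hby hyb] := And4 rho0 b0 by_ ybR.
have /andP[p0 _] := p01; rewrite /growth lerDl mulr_ge0// subr_ge0 -expR0 ler_expR.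
rewrite !mulr_ge0 ?(ltW gamma0) ?(ltW rho0)//; lra.
Qed.

(** With eta = rad * rho * s, where s is the negative part of sin t, the bound on
    |w| is 2 |k| times the amplitude times a convex combination of 1 and
    exp (2 eta gamma), to which the chord inequality applies. *)
Lemma wronskian_circle_bound t (z := (rad * rho)%:C * cis t) :
  normc (w (c + z)) <= normc (c + z) * (2 * A * expR ((`|sin t| - sin t) / 2 * ln B)).
Proof.
have [hr hb hby hyb] := And4 rho0 b0 by_ ybR.
have r0 : 0 < rad - y by lra.
have d2 : 0 < rad - y - b by lra.
pose beta := b / (rad - y).
have b01 : 0 <= beta < 1 by rewrite /beta divr_ge0 ?(ltW r0)//= ltr_pdivrMr//; lra.
have nz : normc z = rad * rho.
  by rewrite /z (normcM _%:C) normc_real normc_cis mulr1 ger0_norm// mulr_ge0 ?(ltW rho0)//; lra.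
have nc : normc c = y * rho.
  by rewrite normc_imag ger0_norm// mulr_ge0 ?(ltW rho0)//; lra.
have lk : (rad - y) * rho <= normc (c + z).
  have := normcB_ge z (- c).
  by rewrite opprK (normc_opp c) (addrC z c) nz nc mulrBl.
have lk0 : 0 < normc (c + z) by rewrite (lt_le_trans _ lk)// mulr_gt0.
have k0 : c + z != 0 by rewrite -normc_eq0 gt_eqF.
set s := (`|sin t| - sin t) / 2.
have s01 : 0 <= s <= 1.
  have := sin_max t; rewrite ler_norml => /andP[h1 h2]; rewrite /s.
  have [h|h] := ger0P (sin t); lra.
have /andP[s0 s1] := s01.
pose eta := rad * rho * s.
have rad0 : 0 <= rad by lra.
have e0 : 0 <= eta := mulr_ge0 (mulr_ge0 rad0 (ltW rho0)) s0.
have Qbeta : L1norm q <= beta * normc (c + z).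
  apply: (@le_trans _ _ (beta * ((rad - y) * rho))).
    by rewrite mulrA /beta divfK ?gt_eqF// Qb.
  by rewrite ler_wpM2l//; case/andP: b01.
have ke : - complex.Im (c + z) <= eta.
  have -> : complex.Im (c + z) = y * rho + rad * rho * sin t by rewrite /z /cis /=; ring.
  rewrite /eta /s; have yr : 0 <= y * rho by rewrite mulr_ge0 ?(ltW rho0)//; lra.
  have rr : 0 <= rad * rho by rewrite mulr_ge0 ?(ltW rho0)//; lra.
  have [h|h] := ger0P (sin t).
    by have := mulr_ge0 rr h; lra.
  by lra.
have := wronskian_bound iq gamma0 supp_q jm jp k0 b01 Qbeta e0 ke.
set k := c + z in k0 lk lk0 Qbeta *; set x := expR _ => h.
have nw : normc (w k) <= normc (2 * ('i * k)) + normc (w k - 2 * ('i * k)).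
  by rewrite -{1}(subrK (2 * ('i * k)) (w k)) (le_trans (normcD _ _))// addrC.
have n2 : normc (2 * ('i * k)) = 2 * normc k.
  rewrite (normcM 2) (normcM 'i).
  have -> : normc 'i = 1 :> R by rewrite /normc expr0n add0r expr1n sqrtr1.
  by rewrite mul1r; congr (_ * _); rewrite normc_nat.
have x0 : 0 <= x by exact: expR_ge0.
have h2 : L1norm q * (1 + beta * x / (1 - beta)) <= beta * normc k * (1 + beta * x / (1 - beta)).
  rewrite ler_wpM2r//; case/andP: b01 => h3 h4.
  have h5 : 0 <= 1 - beta by lra.
  exact: addr_ge0 ler01 (divr_ge0 (mulr_ge0 h3 x0) h5).
have key : 2 * normc k + beta * normc k * (1 + beta * x / (1 - beta)) =
    normc k * (2 * A * (1 + kap / (2 * A) * (x - 1))).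
  have A0 : A != 0 by rewrite gt_eqF//; move: A1; lra.
  have -> : 2 * A * (1 + kap / (2 * A) * (x - 1)) = 2 * A + kap * (x - 1).
    by move: A0; move: A kap => u v A0; field.
  by rewrite /beta /amplitude /coupling; field; rewrite !gt_eqF.
have xe : x = expR (s * (2 * a * rad)) by rewrite /x /eta; congr expR; ring.
have ee : 0 <= 2 * a * rad by rewrite !mulr_ge0 ?(ltW rho0) ?(ltW gamma0)//; lra.
have ch := log_mean_exp_chord s01 p01 ee.
rewrite (le_trans nw)// n2 (le_trans (lerD (lexx _) (le_trans h h2)))// key.
rewrite ler_wpM2l ?(ltW lk0)// ler_wpM2l//; last by rewrite xe.
by move: A1; lra.
Qed.

Theorem wronskian_jensen g (s : seq R[i]) (r : R) : entire g ->
  (forall k, w k = \prod_(z <- s) (k - z) * g k) ->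
  0 < r < rad -> (forall z, z \in s -> normc (z - c) <= r * rho) ->
  0 <= center_value b y ->
  center_value b y ^+ 2 * (rad / r) ^+ (2 * size s) <=
    (y ^+ 2 + rad ^+ 2) * A ^+ 2 * expR (ln B * (2 / pi)).
Proof.
have [hr hb hby hyb] := And4 rho0 b0 by_ ybR.
move=> eg hg /andP[r0 rR] hs G0.
have rad0 : 0 < rad by lra.
have rr : 0 < rad * rho by rewrite mulr_gt0.
pose K := 4 * ((y * rho) ^+ 2 + (rad * rho) ^+ 2) * A ^+ 2.
have A0 : 0 < A by move: A1; lra.
have K0 : 0 < K.
  by rewrite /K mulr_gt0 ?exprn_gt0// mulr_gt0// ltr_wpDl ?sqr_ge0// exprn_gt0.
have L0 : 0 <= ln B by rewrite ln_ge0// growth_ge1.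
have nc : normc c = y * rho.
  by rewrite normc_imag ger0_norm// mulr_ge0 ?(ltW rho0)//; lra.
have bound t : normc (w (c + (rad * rho)%:C * cis t)) * normc (w (c - (rad * rho)%:C * cis t)) <=
    K * expR (ln B * `|sin t|).
  have h1 := wronskian_circle_bound t.
  have := wronskian_circle_bound (t + pi); rewrite cisDpi sinDpi normrN mulrN opprK => h2.
  rewrite (le_trans (ler_pM (normc_ge0 _) (normc_ge0 _) h1 h2))//.
  set u := normc (c + _); set v := normc (c - _).
  set e1 := expR _; set e2 := expR _.
  have -> : u * (2 * A * e1) * (v * (2 * A * e2)) = 4 * (u * v) * A ^+ 2 * (e1 * e2) by ring.
  rewrite /e1 /e2 -expRD -mulrDl.
  have -> : (`|sin t| - sin t) / 2 + (`|sin t| + sin t) / 2 = `|sin t| by field.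
  rewrite (mulrC `|sin t|) ler_wpM2r ?expR_ge0// /K ler_wpM2r ?sqr_ge0// ler_wpM2l//.
  rewrite /u /v (le_trans (product_antipodal _ _))// nc (normcM _%:C) normc_real normc_cis mulr1.
  by rewrite gtr0_norm.
have := jensen_inequality eg hg _ _ K0 L0 bound (r := r * rho).
have -> : 0 < r * rho < rad * rho by rewrite mulr_gt0//= ltr_pM2r.
have -> : rad * rho / (r * rho) = rad / r by field; rewrite !gt_eqF.
move=> /(_ isT hs) h.
have cw : 2 * rho * center_value b y <= normc (w c).
  have y0 : 0 < y by lra.
  have yb0 : 0 < y - b by lra.
  have c0 : c != 0 by rewrite -normc_eq0 nc gt_eqF// mulr_gt0.
  have b01 : 0 <= b / y < 1 by rewrite divr_ge0 ?(ltW y0)//= ltr_pdivrMr// mul1r.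
  have Qc : L1norm q <= b / y * normc c by rewrite nc mulrA divfK ?gt_eqF// Qb.
  have imc : - complex.Im c <= 0 by rewrite /= oppr_le0 mulr_ge0 ?ltW.
  have := wronskian_bound iq gamma0 supp_q jm jp c0 b01 Qc (lexx 0) imc.
  rewrite mulr0 mul0r expR0 => h1.
  have n2 : normc (2 * ('i * c)) = 2 * (y * rho).
    rewrite (normcM 2) (normcM 'i) nc.
    have -> : normc 'i = 1 :> R by rewrite /normc expr0n add0r expr1n sqrtr1.
    by rewrite mul1r; congr (_ * _); rewrite normc_nat.
  have := normcB_ge (2 * ('i * c)) (2 * ('i * c) - w c).
  rewrite subKr n2 normcBC => h3.
  have : 2 * rho * center_value b y = 2 * (y * rho) - L1norm q * (1 + b / y * 1 / (1 - b / y)).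
    by rewrite Qb /center_value; field; rewrite !gt_eqF.
  lra.
have h4 : (2 * rho * center_value b y) ^+ 2 <= normc (w c) ^+ 2.
  have rho2 : 0 <= 2 * rho by rewrite mulr_ge0// ltW.
  by rewrite ler_pXn2r ?nnegrE ?normc_ge0// mulr_ge0.
have R0 : 0 <= (rad / r) ^+ (2 * size s) by rewrite exprn_ge0// divr_ge0// ltW.
have := le_trans (ler_wpM2r R0 h4) h.
have -> : K * expR (ln B * (2 / pi)) =
  (2 * rho) ^+ 2 * ((y ^+ 2 + rad ^+ 2) * A ^+ 2 * expR (ln B * (2 / pi))).
  by rewrite /K; move: (expR _) => u; ring.
by rewrite (exprMn _ _ (center_value b y)) -(mulrA (_ ^+ 2)) ler_pM2l// exprn_gt0// mulr_gt0.
Qed.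

End Circle.
End JensenWronskian.

(** * Bounds for pi and ln 2 *)

Section Constants.
Variable R : realType.
Local Notation pi := (@pi R).

(** With s = sin (pi / 6), the triple angle formula for sin (pi / 2) = 1 reads
    (s + 1) (2 s - 1) ^ 2 = 0. *)
Lemma sin_pi6 : sin (pi / 6) = 1 / 2.
Proof.
have p0 := pi_gt0 R.
set s := sin _; pose c := cos (pi / 6).
have s0 : 0 < s by apply: sin_gt0_pihalf; apply/andP; split; lra.
have cs : c ^+ 2 = 1 - s ^+ 2 by rewrite -(cos2Dsin2 (pi / 6)) addrK.
have : sin (pi / 2) = 1 by exact: sin_pihalf.
have -> : pi / 2 = pi / 6 + pi / 6 *+ 2 by move: pi => u; field.
rewrite sinD sin_mulr2n cos_mulr2n -/s -/c => h.
have : (s + 1) * (2 * s - 1) ^+ 2 = 0.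
  have e : s * (c ^+ 2 *+ 2 - 1) + c * ((c * s) *+ 2) = 3 * s - 4 * s ^+ 3.
    rewrite !mulr2n.
    have -> : s * (c ^+ 2 + c ^+ 2 - 1) + c * (c * s + c * s) = s * (4 * c ^+ 2 - 1) by ring.
    by rewrite cs; ring.
  rewrite e in h.
  have -> : (s + 1) * (2 * s - 1) ^+ 2 = 4 * s ^+ 3 - 3 * s + 1 by ring.
  lra.
move/eqP; rewrite mulf_eq0 => /orP[/eqP|]; first by lra.
by rewrite expf_eq0/= => /eqP; lra.
Qed.

(** The Taylor bounds for sin at pi / 6 and at 5 / 9. *)
Lemma pi_ge3 : 3 <= pi.
Proof.
have p0 := pi_gt0 R.
have p6 : 0 <= pi / 6 by lra.
by have := sin_le_id p6; rewrite sin_pi6; lra.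
Qed.

Lemma pi_le_10_3 : pi <= 10 / 3.
Proof.
have p0 := pi_gt0 R.
rewrite leNgt; apply/negP => h.
have x0 : 0 <= 5 / 9 :> R by lra.
have := sin_ge_cubic x0.
have : sin (5 / 9 : R) < sin (pi / 6).
  rewrite ltr_sin ?in_itv/=; first by lra.
  - apply/andP; split; lra.
  - apply/andP; split; lra.
rewrite sin_pi6; lra.
Qed.

Lemma expR_inv_le n : expR (n.+2%:R^-1 : R) <= n.+2%:R / n.+1%:R.
Proof.
have n1 : 0 < n.+1%:R :> R by rewrite ltr0n.
have n2 : 0 < n.+2%:R :> R by rewrite ltr0n.
have e0 := expR_gt0 (n.+2%:R^-1 : R).
have := expR_ge1Dx (- n.+2%:R^-1 : R); rewrite expRN => h.
have : (1 - n.+2%:R^-1) * expR (n.+2%:R^-1 : R) <= 1 by rewrite -ler_pdivlMr// div1r.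
have -> : 1 - n.+2%:R^-1 = n.+1%:R / n.+2%:R :> R.
  have -> : n.+1%:R = n.+2%:R - 1 :> R by rewrite -(natr1 n.+1) addrK.
  by rewrite mulrBl mulfV ?gt_eqF// mul1r.
rewrite mulrAC ler_pdivrMr// mul1r => h1.
by rewrite ler_pdivlMr// mulrC.
Qed.

Lemma expR1_le : expR (1 : R) <= 281 / 100.
Proof.
have -> : (1 : R) = 16%:R * 16%:R^-1 by rewrite divff.
rewrite expRM_natl (le_trans (lerXn2r _ _ _ (expR_inv_le 14))) ?nnegrE ?expR_ge0//.
lra.
Qed.

Lemma ln2_ge : 2 / 3 <= ln (2 : R).
Proof.
rewrite -ler_expR lnK ?posrE//.
have -> : 2 / 3 = 32%:R * 48%:R^-1 :> R by field.
rewrite expRM_natl (le_trans (lerXn2r _ _ _ (expR_inv_le 46))) ?nnegrE ?expR_ge0//.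
lra.
Qed.

Lemma ln2_le : ln (2 : R) <= 7 / 10.
Proof.
rewrite -ler_expR lnK ?posrE//.
have -> : 7 / 10 = 8%:R * (8%:R * (7 / 640)) :> R by field.
rewrite 2!expRM_natl.
have h : 1 + 7 / 640 <= expR (7 / 640 : R) by exact: expR_ge1Dx.
have h1 : 1 + 906 / 10000 <= expR (7 / 640 : R) ^+ 8.
  apply: le_trans (lerXn2r 8 _ (expR_ge0 _) h); last by rewrite nnegrE; lra.
  lra.
apply: le_trans (lerXn2r 8 _ (exprn_ge0 8 (expR_ge0 _)) h1); last by rewrite nnegrE; lra.
lra.
Qed.

End Constants.

(** * From Jensen's inequality to the number of zeros *)

Section Numerics.
Variable R : realType.
Implicit Types (a b y rad r m : R).
Local Notation pi := (@pi R).

(** What Jensen's inequality says about n zeros in the disk of radius rho around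
    2 i |q|_1, for all circles of radius rad rho around i y rho; the condition on
    r places the zeros in the circle of radius r rho with the same centre. *)
Definition jensen_bound a b (n : nat) := forall y rad r,
  b < y -> y + b < rad -> 0 < r < rad -> 1 + `|y - 2 * b| <= r -> 0 <= center_value b y ->
  center_value b y ^+ 2 * (rad / r) ^+ (2 * n) <=
    (y ^+ 2 + rad ^+ 2) * amplitude b y rad ^+ 2 * expR (ln (growth a b y rad) * (2 / pi)).

Lemma amplitude_ge1 b y rad : 0 <= b -> y + b < rad -> 1 <= amplitude b y rad.
Proof. by move=> b0 h; rewrite /amplitude lerDl divr_ge0// mulr_ge0//; lra. Qed.

(** The amplitude, which is at least 1, is dropped from the growth. *)
Lemma growth_bounds a b y rad E : 0 <= a -> 0 <= b -> 0 < y -> y + b < rad ->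
  b ^+ 2 * expR (2 * a * rad) <= E * (2 * ((rad - y) * (rad - y - b))) ->
  1 <= growth a b y rad <= 1 + E.
Proof.
move=> a0 b0 y0 h hE.
have A1 := amplitude_ge1 b0 h.
have D0 : 0 < (rad - y) * (rad - y - b) by rewrite mulr_gt0//; lra.
have k0 : 0 <= coupling b y rad by rewrite /coupling divr_ge0 ?sqr_ge0 ?ltW.
have A0 : 0 < 2 * amplitude b y rad by lra.
have p0 : 0 <= coupling b y rad / (2 * amplitude b y rad) by rewrite divr_ge0// ltW.
have rad0 : 0 <= rad by lra.
have e1 : 0 <= expR (2 * a * rad) - 1.
  by rewrite subr_ge0 -expR0 ler_expR !mulr_ge0.
rewrite /growth lerDl mulr_ge0//= lerD2l.
have pk : coupling b y rad / (2 * amplitude b y rad) <= coupling b y rad / 2.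
  by rewrite ler_wpM2l// lef_pV2 ?posrE//; lra.
rewrite (le_trans (ler_wpM2r e1 pk))//.
apply: (@le_trans _ _ (coupling b y rad / 2 * expR (2 * a * rad))).
  apply: ler_wpM2l; first exact: divr_ge0.
  by rewrite gerBl.
move: D0 hE; rewrite /coupling; set D := (rad - y) * _; move: (expR _) D => e D D0 hE.
have -> : b ^+ 2 / D / 2 * e = b ^+ 2 * e / (2 * D) by field; rewrite gt_eqF.
by rewrite ler_pdivrMr ?mulr_gt0.
Qed.

(** The mean 2 / pi of |sin| is at most 1; the loss is harmless when B is bounded. *)
Lemma expR_ln_mean_le (B E : R) : 1 <= B <= 1 + E -> expR (ln B * (2 / pi)) <= 1 + E.
Proof.
move=> /andP[B1 BE]; apply: le_trans BE.
have p3 := pi_ge3 R; have p0 := pi_gt0 R.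
have B0 : 0 < B by lra.
rewrite -[leRHS]lnK ?posrE// ler_expR.
have h : 2 / pi <= 1 by rewrite ler_pdivrMr//; lra.
by have := ler_wpM2l (ln_ge0 B1) h; rewrite mulr1.
Qed.

(** An upper bound m for a / pi + b forces a to decrease when b increases, and
    b ^ 2 exp (- 100 b / 3) <= (3 / (50 e)) ^ 2 because x <= exp (x - 1) at
    x = 50 b / 3; the slope 100 / 3 is 10 pi with pi <= 10 / 3. *)
Lemma small_regime a b m (N : nat) : 0 <= a -> 0 <= b -> a / pi + b < m ->
  100 / 3 * m - 2 <= N%:R ->
  b ^+ 2 * expR (10 * a) <= 9 / 2500 * (281 / 100) ^+ N.
Proof.
move=> a0 b0 abm mN.
have p0 := pi_gt0 R; have p10 := pi_le_10_3 R.
have ab : 10 * a + 100 / 3 * b <= 100 / 3 * m.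
  have h1 : 0 <= a / pi by rewrite divr_ge0// ltW.
  have -> : a = a / pi * pi by rewrite divfK ?gt_eqF.
  have := ler_wpM2l h1 p10; lra.
have hb : b <= 3 / 50 * expR (50 / 3 * b - 1).
  by have := expR_ge1Dx (50 / 3 * b - 1); lra.
have hb2 : b ^+ 2 <= 9 / 2500 * expR (100 / 3 * b - 2).
  have -> : 100 / 3 * b - 2 = 2%:R * (50 / 3 * b - 1) by ring.
  have := lerXn2r 2 b0 (le_trans b0 hb) hb.
  rewrite exprMn expRM_natl; move/le_trans; apply.
  by rewrite ler_wpM2r ?exprn_ge0 ?expR_ge0//; lra.
apply: le_trans (ler_wpM2r (expR_ge0 _) hb2) _.
rewrite -(mulrA (9 / 2500)) -expRD; apply: ler_wpM2l; first by lra.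
apply: (@le_trans _ _ (expR (N%:R * 1))); first by rewrite ler_expR mulr1; lra.
rewrite expRM_natl; apply: lerXn2r (expR1_le R); rewrite nnegrE; [exact: expR_ge0|lra].
Qed.

(** The circle of radius 5 around i: for b = 0 each zero contributes a factor at
    least (5 / 2) ^ 2 to the left of Jensen's inequality, against 26 on the right.
    The number 28 is a lower bound for 2 (rad - y) (rad - y - b) = 8 (4 - b). *)
Lemma jensen_bound_few a b (n N : nat) (E : R) : jensen_bound a b n -> 0 <= a ->
  0 <= b <= 7 / 20 -> b ^+ 2 * expR (10 * a) <= E * 28 -> (N <= n)%N ->
  2 * (1 - b) ^+ N.+1 <= 2 - 3 * b ->
  (5 / 2) ^+ (2 * N) <= 26 * (1 + b / 7) ^+ 2 * (1 + E).
Proof.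
move=> J a0 /andP[b0 b1] hE Nn hN.
have r0 : 0 < 2 * (1 - b) by lra.
have hG : center_value b 1 = (2 - 3 * b) / (2 * (1 - b)).
  by rewrite /center_value; field; rewrite gt_eqF//; lra.
have G0 : 0 <= center_value b 1 by rewrite hG divr_ge0 ?(ltW r0)//; lra.
have E0 : 0 <= E.
  have : 0 <= b ^+ 2 * expR (10 * a) by rewrite mulr_ge0 ?sqr_ge0 ?expR_ge0.
  lra.
have h5 : 1 + b < 5 by lra.
have q1 : 1 <= 5 / (2 * (1 - b)) by rewrite ler_pdivlMr//; lra.
have hq : (5 / (2 * (1 - b))) ^+ (2 * N) <= (5 / (2 * (1 - b))) ^+ (2 * n).
  by rewrite ler_weXn2l// leq_mul2l.
have hb : (1 - b) ^+ N <= (2 - 3 * b) / (2 * (1 - b)).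
  rewrite ler_pdivlMr//; apply: le_trans hN.
  by rewrite exprS le_eqVlt; apply/orP; left; apply/eqP; ring.
have t0 : 0 < 1 - b by lra.
have -> : (5 / 2) ^+ (2 * N) = ((1 - b) ^+ N) ^+ 2 * (5 / (2 * (1 - b))) ^+ (2 * N) :> R.
  rewrite -exprM (mulnC N) -exprMn; congr (_ ^+ _).
  by field; rewrite gt_eqF.
have q0 : 0 <= (5 / (2 * (1 - b))) ^+ (2 * N) by rewrite exprn_ge0// divr_ge0// ltW.
have hb2 : ((1 - b) ^+ N) ^+ 2 <= ((2 - 3 * b) / (2 * (1 - b))) ^+ 2.
  by rewrite ler_pXn2r// nnegrE; [rewrite exprn_ge0// ltW|rewrite (le_trans _ hb)// exprn_ge0// ltW].
have hB : 1 <= growth a b 1 5 <= 1 + E.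
  apply: growth_bounds => //.
  have -> : 2 * a * 5 = 10 * a by ring.
  apply: (le_trans hE); apply: ler_wpM2l => //; lra.
have A1 := amplitude_ge1 b0 h5.
have A2 : amplitude b 1 5 <= 1 + b / 7.
  by rewrite /amplitude lerD2l ler_wpM2l// lef_pV2 ?posrE//; lra.
have hA : amplitude b 1 5 ^+ 2 <= (1 + b / 7) ^+ 2.
  by rewrite ler_pXn2r// nnegrE; lra.
have he := expR_ln_mean_le hB.
have := J 1 5 (2 * (1 - b)) _ h5 _ _ G0.
have -> : b < 1 by lra.
have -> : 0 < 2 * (1 - b) < 5 by apply/andP; split; lra.
have -> : 1 + `|1 - 2 * b| <= 2 * (1 - b) by rewrite ger0_norm; lra.
move=> /(_ isT isT isT); rewrite hG => h.
apply: le_trans (ler_wpM2r q0 hb2) _.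
apply: le_trans (ler_wpM2l (sqr_ge0 _) hq) _; apply: (le_trans h).
have -> : 1 ^+ 2 + 5 ^+ 2 = 26 :> R by ring.
have b7 : 0 <= 26 * (1 + b / 7) ^+ 2 by rewrite mulr_ge0 ?sqr_ge0.
apply: le_trans (ler_wpM2l _ he) (ler_wpM2r _ _); [|lra|lra].
by rewrite mulr_ge0 ?sqr_ge0.
Qed.

Lemma fewer_than_two a b n : jensen_bound a b n -> 0 <= a -> 0 <= b ->
  a / pi + b < 7 / 40 -> (n < 2)%N.
Proof.
move=> J a0 b0 h; rewrite ltnNge; apply/negP => n2.
have b1 : b <= 7 / 40.
  have : 0 <= a / pi by rewrite divr_ge0// pi_ge0.
  lra.
have h4 : 100 / 3 * (7 / 40) - 2 <= 4%:R :> R by lra.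
have hs := small_regime a0 b0 h h4.
have h28 : b ^+ 2 * expR (10 * a) <= 1 / 100 * 28 by apply: (le_trans hs); lra.
have b35 : 0 <= b <= 7 / 20 by apply/andP; split; lra.
have hb : 2 * (1 - b) ^+ 3 <= 2 - 3 * b by nra.
have := jensen_bound_few J a0 b35 h28 n2 hb.
have : 26 * (1 + b / 7) ^+ 2 * (1 + 1 / 100) <= 26 * (1 + 1 / 40) ^+ 2 * (1 + 1 / 100) :> R.
  apply: ler_wpM2r; first by lra.
  apply: ler_wpM2l => //; rewrite ler_pXn2r// ?nnegrE; lra.
lra.
Qed.

Lemma fewer_than_three a b n : jensen_bound a b n -> 0 <= a -> 0 <= b ->
  a / pi + b < 7 / 20 -> (n < 3)%N.
Proof.
move=> J a0 b0 h; rewrite ltnNge; apply/negP => n3.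
have b1 : b <= 7 / 20.
  have : 0 <= a / pi by rewrite divr_ge0// pi_ge0.
  lra.
have h10 : 100 / 3 * (7 / 20) - 2 <= 10%:R :> R by lra.
have hs := small_regime a0 b0 h h10.
have h28 : b ^+ 2 * expR (10 * a) <= 4 * 28 by apply: (le_trans hs); lra.
have b35 : 0 <= b <= 7 / 20 by apply/andP; split; lra.
have hb : 2 * (1 - b) ^+ 4 <= 2 - 3 * b by nra.
have := jensen_bound_few J a0 b35 h28 n3 hb.
have : 26 * (1 + b / 7) ^+ 2 * (1 + 4) <= 26 * (1 + 1 / 20) ^+ 2 * (1 + 4) :> R.
  apply: ler_wpM2r; first by lra.
  apply: ler_wpM2l => //; rewrite ler_pXn2r// ?nnegrE; lra.
lra.
Qed.

(** The circle of radius 3 around i (2 b + 1 / 3), that is at distance 1 / 3 from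
    the centre of the disk containing the zeros; four zeros contribute (9 / 4) ^ 8
    to Jensen's inequality, while growth is at most 3. *)
Lemma fewer_than_four a b n : jensen_bound a b n -> 0 <= a -> 0 <= b -> b ^+ 2 <= 1 / 2 ->
  b ^+ 2 * expR (6 * a) <= 2 * (294 / 100 - 3 * b) ^+ 2 -> (n < 4)%N.
Proof.
move=> J a0 b0 bh hE; rewrite ltnNge; apply/negP => n4.
have b1 : b <= 71 / 100 by nra.
pose y : R := 2 * b + 1 / 3.
have h1 : b < y by rewrite /y; lra.
have h2 : y + b < 3 by rewrite /y; lra.
have hG : center_value b y = (2 * b + 1 / 3) * (b + 2 / 3) / (2 * (b + 1 / 3)).
  by rewrite /center_value /y; field; rewrite gt_eqF//; lra.
have hG1 : b + 1 / 3 <= center_value b y.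
  rewrite hG ler_pdivlMr; last by lra.
  nra.
have G0 : 0 <= center_value b y by lra.
have hB : 1 <= growth a b y 3 <= 1 + 2.
  apply: growth_bounds => //; first by rewrite /y; lra.
  have -> : 2 * a * 3 = 6 * a by ring.
  apply: (le_trans hE); rewrite /y; nra.
have he := expR_ln_mean_le hB.
have A1 := amplitude_ge1 b0 h2.
have A2 : amplitude b y 3 <= 3 * (b + 1 / 3).
  suff : amplitude b y 3 <= 1 + b by lra.
  rewrite /amplitude lerD2l ler_pdivrMr; last by rewrite /y; lra.
  by rewrite ler_peMr// /y; lra.
have hA : amplitude b y 3 ^+ 2 <= 9 * (b + 1 / 3) ^+ 2.
  have -> : 9 * (b + 1 / 3) ^+ 2 = (3 * (b + 1 / 3)) ^+ 2 by ring.
  by rewrite ler_pXn2r// nnegrE; lra.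
have hY : y ^+ 2 + 3 ^+ 2 <= 13 by rewrite /y; nra.
have hq : (9 / 4) ^+ 8 <= (9 / 4) ^+ (2 * n) :> R.
  by apply: ler_weXn2l; [lra|rewrite (@leq_mul2l 2 4)].
set s := (b + 1 / 3) ^+ 2 in hA.
have s0 : 0 < s by rewrite exprn_gt0//; lra.
have hG2 : s <= center_value b y ^+ 2 by rewrite ler_pXn2r// nnegrE; lra.
have q0 : 0 <= (9 / 4) ^+ 8 :> R by rewrite exprn_ge0//; lra.
have lo : s * (9 / 4) ^+ 8 <= center_value b y ^+ 2 * (9 / 4) ^+ (2 * n).
  by apply: ler_pM => //; exact: ltW.
have hi : (y ^+ 2 + 3 ^+ 2) * amplitude b y 3 ^+ 2 * expR (ln (growth a b y 3) * (2 / pi)) <=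
    13 * (9 * s) * (1 + 2).
  apply: ler_pM => //; first by rewrite mulr_ge0 ?addr_ge0 ?sqr_ge0.
  by apply: ler_pM => //; rewrite ?addr_ge0 ?sqr_ge0.
have := J y 3 (4 / 3) h1 h2 _ _ G0.
have -> : 0 < (4 / 3 : R) < 3 by apply/andP; split; lra.
have -> : 1 + `|y - 2 * b| <= 4 / 3.
  by rewrite (_ : y - 2 * b = 1 / 3); [rewrite ger0_norm; lra|rewrite /y; ring].
move=> /(_ isT isT).
have -> : 3 / (4 / 3) = 9 / 4 :> R by field.
move=> h.
have := le_trans lo (le_trans h hi).
lra.
Qed.

(** The concave function s ^ (2 / pi) lies below its tangent at s = 1 / 32, a point
    chosen because 5 * 2 / pi >= 3, so that 32 ^ (2 / pi) >= 8. *)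
Lemma power_mean_le (s : R) : 0 < s -> expR (2 / pi * ln s) <= 1 / 20 + 8 / 3 * s.
Proof.
move=> s0; have p0 := pi_gt0 R; have p3 := pi_ge3 R; have p10 := pi_le_10_3 R.
set th := 2 / pi.
have th1 : 3 / 5 <= th by rewrite /th ler_pdivlMr//; lra.
have th2 : th <= 2 / 3 by rewrite /th ler_pdivrMr//; lra.
have l2 := ln2_ge R.
have -> : th * ln s = th * ln (32 * s) - 5 * th * ln 2.
  have -> : (32 : R) = 2 ^+ 5 by rewrite -natrX.
  by rewrite lnM ?posrE ?exprn_gt0// lnXn// -mulr_natl; ring.
rewrite expRD.
have e1 : expR (- (5 * th * ln 2)) <= 1 / 8 :> R.
  have -> : 1 / 8 = expR (- (3%:R * ln 2)) :> R.
    by rewrite expRN expRM_natl lnK ?posrE// div1r -natrX.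
  rewrite ler_expR lerN2 ler_wpM2r//; lra.
have e2 : expR (th * ln (32 * s)) <= 1 + th * (32 * s - 1).
  have th01 : 0 <= th <= 1 by apply/andP; split; lra.
  have s32 : 32 * s \is Num.pos by rewrite posrE; lra.
  by have := expR_chord (ln (32 * s)) th01; rewrite lnK//; lra.
have e3 : 1 + th * (32 * s - 1) <= 2 / 5 + 64 / 3 * s.
  by have := ler_wpM2r (ltW s0) th2; lra.
have e4 := le_trans e2 e3.
apply: le_trans (ler_pM (expR_ge0 _) (expR_ge0 _) e4 e1) _; lra.
Qed.

(** The inequality between the factors depending on b, cleared of denominators;
    2 E + b and E / 20 + 8 b / 3 are the amplitude and the tangent bound for
    (b / E) ^ (2 / pi). *)
Lemma polynomial_margin b : 0 <= b <= 71 / 100 -> let E := 294 / 100 - 3 * b in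
  (3 + (2 * b + 3 / 50) ^+ 2 / 6) * (2 * E + b) * (E / 20 + 8 / 3 * b) <
  28 / 5 * (b + 3 / 50) * (1 + 3 * b) ^+ 2 * E ^+ 2.
Proof.
move=> /andP[b0 b1] /=.
have c0 : 0 <= 71 / 100 - b by lra.
(* the difference has positive coefficients in the Bernstein basis of degree 5 *)
have bern (i j : nat) : 0 <= b ^+ i * (71 / 100 - b) ^+ j.
  by rewrite mulr_ge0 ?exprn_ge0.
have := bern 0%N 5; have := bern 1%N 4; have := bern 2 3.
have := bern 3 2; have := bern 4 1%N; have := bern 5 0%N.
lra.
Qed.

(** The circle of radius 3 around i (2 b + 3 / 50). As (3 / 1.06) ^ 2 >= 2 ^ 3, a
    zero contributes exp (3 ln 2), and the growth exp (12 a / pi) of the right-hand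
    side is exactly compensated by the term 4 a / (pi ln 2) of the bound; the
    factors left depend on b only. *)
Lemma many_zeros_bound a b n : jensen_bound a b n -> 0 <= a -> 0 <= b -> b ^+ 2 <= 1 / 2 ->
  2 * (294 / 100 - 3 * b) ^+ 2 < b ^+ 2 * expR (6 * a) ->
  n%:R <= 1 + 4 / ln 2 * (a / pi + b).
Proof.
move=> J a0 b0 bh hE; rewrite leNgt; apply/negP => hn.
have b1 : b <= 71 / 100 by nra.
have l2 := ln2_ge R; have p0 := pi_gt0 R.
have l0 : 0 < ln 2 :> R by lra.
set E := 294 / 100 - 3 * b in hE.
have E0 : 0 < E by rewrite /E; lra.
have bp : 0 < b.
  rewrite lt_neqAle b0 andbT eq_sym; apply/eqP => bz.
  by move: hE; rewrite bz expr0n mul0r; have := sqr_ge0 E; lra.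
pose s := b / E.
have s0 : 0 < s by rewrite divr_gt0.
pose y : R := 2 * b + 3 / 50.
have h1 : b < y by rewrite /y; lra.
have h2 : y + b < 3 by rewrite /y; move: E0; rewrite /E; lra.
have hG : center_value b y = (2 * b + 3 / 50) * (b + 6 / 50) / (2 * (b + 3 / 50)).
  by rewrite /center_value /y; field; rewrite gt_eqF//; lra.
have hG1 : b + 3 / 50 <= center_value b y.
  rewrite hG ler_pdivlMr; last by lra.
  nra.
have G0 : 0 <= center_value b y by lra.
(* (9 / 1.06 ^ 2) ^ n exceeds 8 ^ n, hence 8 ^ (1 + 4 / ln 2 * (a / pi + b)) *)
have lo : 8 * expR (12 * a / pi) * expR (6 * b) ^+ 2 < (3 / (53 / 50)) ^+ (2 * n).
  have h8 : 8 <= (3 / (53 / 50)) ^+ 2 :> R by lra.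
  apply: (@lt_le_trans _ _ (8 ^+ n)); last by rewrite exprM lerXn2r// nnegrE; lra.
  have e8 : (8 : R) = expR (3%:R * ln 2) by rewrite expRM_natl lnK ?posrE// -natrX.
  rewrite e8 -!expRM_natl -!expRD ltr_expR.
  have -> : 3%:R * ln 2 + 12 * a / pi + 2%:R * (6 * b) =
     (3 * ln 2) * (1 + 4 / ln 2 * (a / pi + b)).
    by move: (ln 2) pi l0 p0 => l p l0 p0; field; rewrite !gt_eqF.
  by rewrite (mulrC n%:R) ltr_pM2l// mulr_gt0.
clear hn hG.
have E2 : 0 < E ^+ 2 by rewrite exprn_gt0.
have sE : s ^+ 2 * E ^+ 2 = b ^+ 2 by rewrite /s expr_div_n divfK// gt_eqF.
have big : 2 < s ^+ 2 * expR (6 * a).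
  by rewrite /s expr_div_n mulrAC ltr_pdivlMr.
set x := s ^+ 2 * expR (6 * a) in big.
have hB : 1 <= growth a b y 3 <= 1 + x / 2.
  apply: growth_bounds => //; first by rewrite /y; lra.
  have -> : 2 * a * 3 = 6 * a by ring.
  have -> : (3 - y) * (3 - y - b) = E ^+ 2 + b * E by rewrite /y /E; field.
  rewrite -sE /x; have : 0 <= b * E by rewrite mulr_ge0// ltW.
  have : 0 <= s ^+ 2 * expR (6 * a) by rewrite mulr_ge0 ?sqr_ge0 ?expR_ge0.
  move: (s ^+ 2) (E ^+ 2) (expR _) (b * E) => u v e z ue z0.
  by have := mulr_ge0 ue z0; lra.
have /andP[B1 B2] := hB.
have lnB : ln (growth a b y 3) <= 2 * ln s + 6 * a.
  have -> : 2 * ln s + 6 * a = ln x.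
    by rewrite /x lnM ?posrE ?exprn_gt0 ?expR_gt0// lnXn// expRK mulr_natl.
  have xB : growth a b y 3 <= x by clear - B2 big; lra.
  have x0 : 0 < x by clear - big; lra.
  by rewrite ler_ln// posrE (lt_le_trans ltr01).
set sig := 1 / 20 + 8 / 3 * s.
have he : expR (ln (growth a b y 3) * (2 / pi)) <= sig ^+ 2 * expR (12 * a / pi).
  apply: (@le_trans _ _ (expR ((2 * ln s + 6 * a) * (2 / pi)))).
    by rewrite ler_expR ler_wpM2r// divr_ge0// ltW.
  have -> : (2 * ln s + 6 * a) * (2 / pi) = 2%:R * (2 / pi * ln s) + 12 * a / pi.
    by move: (ln s) pi p0 => u p p0; field; rewrite gt_eqF.
  rewrite expRD ler_wpM2r ?expR_ge0// expRM_natl lerXn2r ?nnegrE ?expR_ge0 ?power_mean_le//.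
  by rewrite /sig; lra.
have A1 := amplitude_ge1 b0 h2.
have hA : amplitude b y 3 = (2 * E + b) / (2 * E).
  rewrite /amplitude; have -> : 3 - y - b = E by rewrite /y /E; field.
  by field; rewrite gt_eqF.
have hY : y ^+ 2 + 3 ^+ 2 <= (3 + y ^+ 2 / 6) ^+ 2.
  have := sqr_ge0 (y ^+ 2 / 6); lra.
have sE2 : sig = (E / 20 + 8 / 3 * b) / E.
  by rewrite /sig /s; field; rewrite gt_eqF.
set X := (3 + y ^+ 2 / 6) * amplitude b y 3 * sig.
have hX : X < 14 / 5 * (b + 3 / 50) * (1 + 3 * b) ^+ 2.
  have b01 : 0 <= b <= 71 / 100 by apply/andP.
  have := polynomial_margin b01; rewrite /= -/E -/y => pm.
  have -> : X = (3 + y ^+ 2 / 6) * (2 * E + b) * (E / 20 + 8 / 3 * b) / (2 * E ^+ 2).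
    by rewrite /X hA sE2; clearbody E y; field; rewrite gt_eqF.
  rewrite ltr_pdivrMr ?mulr_gt0//; apply: (lt_le_trans pm).
  by rewrite le_eqVlt; apply/orP; left; apply/eqP; field.
have X0 : 0 <= X.
  have sig0 : 0 <= sig by rewrite /sig addr_ge0// mulr_ge0// ltW.
  have v0 : 0 <= 3 + y ^+ 2 / 6 by rewrite addr_ge0// divr_ge0 ?sqr_ge0.
  by rewrite /X mulr_ge0// mulr_ge0// (le_trans ler01).
have ea0 := expR_gt0 (12 * a / pi).
have e6 : (1 + 3 * b) ^+ 2 <= expR (6 * b).
  have -> : 6 * b = 2%:R * (3 * b) by ring.
  have b3 : 0 <= 1 + 3 * b by rewrite addr_ge0// mulr_ge0.
  by rewrite expRM_natl lerXn2r ?nnegrE ?expR_ge0 ?expR_ge1Dx.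
have b50' : 0 < b + 3 / 50 by rewrite ltr_pwDr// divr_gt0.
have G2 : (b + 3 / 50) ^+ 2 <= center_value b y ^+ 2.
  by rewrite ler_pXn2r// nnegrE// ltW.
have b50 : 0 < (b + 3 / 50) ^+ 2 by rewrite exprn_gt0.
have := J y 3 (53 / 50) h1 h2 _ _ G0.
have -> : 0 < (53 / 50 : R) < 3 by apply/andP; split; lra.
have -> : 1 + `|y - 2 * b| <= 53 / 50.
  by rewrite (_ : y - 2 * b = 3 / 50); [rewrite ger0_norm; lra|rewrite /y; ring].
move=> /(_ isT isT) h.
have c1 : (b + 3 / 50) ^+ 2 * (8 * expR (12 * a / pi) * expR (6 * b) ^+ 2) <
    X ^+ 2 * expR (12 * a / pi).
  apply: (@lt_le_trans _ _ ((b + 3 / 50) ^+ 2 * (3 / (53 / 50)) ^+ (2 * n))).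
    by rewrite ltr_pM2l.
  apply: (@le_trans _ _ (center_value b y ^+ 2 * (3 / (53 / 50)) ^+ (2 * n))).
    by rewrite ler_wpM2r// exprn_ge0//; lra.
  apply: (le_trans h).
  have -> : X ^+ 2 * expR (12 * a / pi) =
    (3 + y ^+ 2 / 6) ^+ 2 * amplitude b y 3 ^+ 2 * (sig ^+ 2 * expR (12 * a / pi)).
    by rewrite /X; move: (expR _) => e; ring.
  apply: ler_pM => //; first by rewrite mulr_ge0 ?addr_ge0 ?sqr_ge0.
  by rewrite ler_wpM2r ?sqr_ge0.
have c2 : 8 * ((b + 3 / 50) * expR (6 * b)) ^+ 2 < X ^+ 2.
  rewrite -(ltr_pM2r ea0); apply: le_lt_trans c1.
  by rewrite le_eqVlt; apply/orP; left; apply/eqP; move: (expR _) (expR _) => u v; ring.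
set z := (b + 3 / 50) * expR (6 * b) in c2.
(* 14 / 5 is a lower bound for the square root of 8 *)
have z1 : X < 14 / 5 * z.
  apply: (lt_le_trans hX); rewrite -(mulrA (14 / 5)).
  apply: ler_wpM2l; first by rewrite divr_ge0.
  by apply: ler_wpM2l => //; rewrite addr_ge0// divr_ge0.
clear - X0 z1 c2.
have : X ^+ 2 < (14 / 5 * z) ^+ 2 by rewrite ltr_pXn2r// nnegrE; lra.
have := sqr_ge0 z; lra.
Qed.

(** n is an integer: to prove n <= x it suffices to exclude n >= 2 when x < 2 and
    n >= 3 when x < 3. For x >= 3 either n <= 3 or the growth factor is large
    enough for the bound to be attained with matching exponents. *)
Theorem count_le a b n : jensen_bound a b n -> 0 <= a -> 0 <= b -> b ^+ 2 <= 1 / 2 ->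
  n%:R <= 1 + 4 / ln 2 * (a / pi + b).
Proof.
move=> J a0 b0 bh.
have l2 := ln2_ge R; have l2' := ln2_le R; have p0 := pi_gt0 R.
have l0 : 0 < ln 2 :> R by lra.
set u := a / pi + b.
have u0 : 0 <= u by rewrite addr_ge0// divr_ge0// ltW.
have l4 : 0 <= 4 / ln 2 :> R by rewrite divr_ge0// ltW.
have x0 : 0 <= 4 / ln 2 * u by rewrite mulr_ge0.
have [n1|n2] := leqP n 1.
  have : n%:R <= 1%:R :> R by rewrite ler_nat.
  lra.
have reg (m : R) : m <= u -> 40 / 7 * m <= 4 / ln 2 * u.
  move=> mu; have h7 : 40 / 7 <= 4 / ln 2 :> R by rewrite ler_pdivlMr//; lra.
  have := ler_wpM2r u0 h7; lra.
have natle (N : nat) : (n < N.+1)%N -> n%:R <= N%:R :> R by rewrite ltnS ler_nat.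
have [u1|/reg h1] := ltP u (7 / 40).
  by have := fewer_than_two J a0 b0 u1; rewrite ltnNge n2.
have [u2|/reg h2] := ltP u (7 / 20).
  by have := natle 2 (fewer_than_three J a0 b0 u2); lra.
have [hE|hE] := leP (b ^+ 2 * expR (6 * a)) (2 * (294 / 100 - 3 * b) ^+ 2).
  by have := natle 3 (fewer_than_four J a0 b0 bh hE); lra.
exact: many_zeros_bound J a0 b0 bh hE.
Qed.

End Numerics.

(** * Zeros in disks and in the upper half-plane *)

Section Counting.
Variable R : realType.
Variables (q : R -> R[i]) (gamma : R).
Hypothesis iq : cintegrable setT q.
Hypothesis gamma0 : 0 < gamma.
Hypothesis supp_q : ess_supp q `<=` `[0, gamma].
Variables (fm fp : R -> R[i] -> R[i]).
Hypothesis jm : forall k, jost_minus q k (fm ^~ k).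
Hypothesis jp : forall k, jost_plus q k (fp ^~ k).
Local Notation w := (jost_wronskian fm fp).
Local Notation Q := (L1norm q).

(** Stated for a set D of which only the zeros have to lie in the disk, so that it
    applies both to the disk and to the closed upper half-plane. *)
Theorem nb_zeros_within_disk (D : set R[i]) (rho : R) : 0 < rho -> Num.sqrt 2 * Q <= rho ->
  (forall z, D z -> w z = 0 -> normc (z - (0 +i* (2 * Q))) <= rho) ->
  (nb_zeros w D <= (1 + 4 / ln 2 * (gamma * rho / pi + Q / rho))%:E)%E.
Proof.
move=> rho0 Qrho hD.
have ew := wronskian_entire iq gamma0 supp_q jm jp.
apply: nb_zeros_le => // s g eg hs hg.
have Q0 := L1norm_ge0 q.
set b := Q / rho.
have b0 : 0 <= b by rewrite divr_ge0// ltW.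
have Qb : Q = b * rho by rewrite divfK ?gt_eqF.
apply: count_le => //; last 2 first.
- by rewrite mulr_ge0// ltW.
- have s2 : Num.sqrt 2 * b <= 1 by rewrite mulrA ler_pdivrMr// mul1r.
  have : (Num.sqrt 2 * b) ^+ 2 <= 1 by rewrite expr_le1// mulr_ge0 ?sqrtr_ge0.
  by rewrite exprMn sqr_sqrtr//; lra.
move=> y rad r b_y ybR rR yr G0.
apply: (wronskian_jensen iq gamma0 supp_q jm jp rho0 Qb b0 b_y ybR eg hg rR _ G0) => z /hs[Dz wz].
rewrite (le_trans (normc_dist (0 +i* (2 * Q)) _ _))//.
have -> : (0 +i* (2 * Q)) - (0 +i* (y * rho)) = 0 +i* ((2 * b - y) * rho) :> R[i].
  by rewrite Qb; apply/eqP; rewrite eq_complex /= subrr eqxx/=; apply/eqP; ring.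
rewrite normc_imag normrM (gtr0_norm rho0) distrC.
have := hD z Dz wz; have := ler_wpM2r (ltW rho0) yr; lra.
Qed.

(** If |z| <= Q / 2 and Im z >= 0 then |z - 2 i Q| ^ 2 <= |z| ^ 2 + 4 Q ^ 2. *)
Lemma upper_zeros_near z : 0 <= complex.Im z -> w z = 0 ->
  normc (z - (0 +i* (2 * Q))) <= Num.sqrt 17 / 2 * Q.
Proof.
move=> iz wz; have Q0 := L1norm_ge0 q.
have h := zeros_upper_half_plane iq gamma0 supp_q jm jp iz wz.
have r0 : 0 <= Num.sqrt 17 / 2 * Q by rewrite mulr_ge0// divr_ge0// sqrtr_ge0.
suff : normc (z - (0 +i* (2 * Q))) ^+ 2 <= (Num.sqrt 17 / 2 * Q) ^+ 2.
  by rewrite ler_pXn2r// nnegrE normc_ge0.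
have -> : (Num.sqrt 17 / 2 * Q) ^+ 2 = 17 / 4 * Q ^+ 2.
  by rewrite exprMn expr_div_n sqr_sqrtr ?ler0n//; congr (_ * _); field.
have : (2 * normc z) ^+ 2 <= Q ^+ 2 by rewrite ler_pXn2r ?nnegrE ?mulr_ge0 ?normc_ge0.
rewrite exprMn !sqr_normc; case: z iz {wz h} => x y /= iz.
have := mulr_ge0 iz Q0; rewrite !subr0; lra.
Qed.

End Counting.

Theorem theorem1p5 (R : realType) :
  (forall (q : R -> R[i]) (gamma : R) (fm fp : R -> R[i] -> R[i]),
     cintegrable setT q -> 0 < gamma -> ess_supp q `<=` `[0, gamma] ->
     (forall k, jost_minus q k (fm ^~ k)) ->
     (forall k, jost_plus q k (fp ^~ k)) ->
     forall rho : R, 0 < rho -> Num.sqrt 2 * L1norm q <= rho ->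
     (nb_zeros (jost_wronskian fm fp)
        (open_disk (0 +i* (2 * L1norm q))%R rho)
      <= (1 + 4 / ln 2 * (gamma * rho / pi + L1norm q / rho))%:E)%E) /\
  (exists2 delta : R, 0 < delta &
     forall eps1 eps2 : R, 0 < eps1 < delta -> 0 < eps2 < delta ->
     let C1 := 1 + 8 / (Num.sqrt 17 * ln 2) + eps1 in
     let C2 := 2 * Num.sqrt 17 / (pi * ln 2) + eps2 in
     [/\ C1 <= 5, C2 <= 5 &
       forall (q : R -> R[i]) (gamma : R) (fm fp : R -> R[i] -> R[i]),
         cintegrable setT q -> 0 < gamma -> ess_supp q `<=` `[0, gamma] ->
         (forall k, jost_minus q k (fm ^~ k)) ->
         (forall k, jost_plus q k (fp ^~ k)) ->
         (nb_zeros (jost_wronskian fm fp) (closed_upper_half_plane R)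
          <= (C1 + C2 * gamma * L1norm q)%:E)%E]).
Proof.
split.
  move=> q gamma fm fp iq g0 sq jm jp rho rho0 Qrho.
  by apply: (nb_zeros_within_disk iq g0 sq jm jp rho0 Qrho) => z Dz _; exact: ltW.
exists (1 / 10); first by lra.
move=> e1 e2 /andP[e10 e11] /andP[e20 e21] C1 C2.
have l2 := ln2_ge R; have l2' := ln2_le R; have p3 := pi_ge3 R; have p0 := pi_gt0 R.
have l0 : 0 < ln 2 :> R by lra.
have r0 : 0 <= Num.sqrt 17 :> R by exact: sqrtr_ge0.
have r2 : Num.sqrt 17 ^+ 2 = 17 :> R by rewrite sqr_sqrtr.
have r4 : 4 <= Num.sqrt 17 :> R by nra.
have r5 : Num.sqrt 17 <= 413 / 100 :> R by nra.
have rp : 0 < Num.sqrt 17 :> R by lra.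
have d1 : 8 / 3 <= Num.sqrt 17 * ln 2 :> R by nra.
have d2 : 2 <= pi * ln 2 :> R by nra.
have d3 : Num.sqrt 17 * ln 2 <= 8 :> R by nra.
split.
- have : 8 / (Num.sqrt 17 * ln 2) <= 3 :> R by rewrite ler_pdivrMr; lra.
  rewrite /C1; lra.
- have : 2 * Num.sqrt 17 / (pi * ln 2) <= 413 / 100 :> R by rewrite ler_pdivrMr; lra.
  rewrite /C2; lra.
move=> q gamma fm fp iq g0 sq jm jp.
have near := upper_zeros_near iq g0 sq jm jp.
have Q0 := L1norm_ge0 q.
set Q := L1norm q in near Q0 *.
have c1 : 1 <= 8 / (Num.sqrt 17 * ln 2) :> R by rewrite ler_pdivlMr; lra.
have [Qz|Qp] := eqVneq Q 0.
  (* here any radius will do; this one makes the bound equal to 2 *)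
  pose rho := pi * ln 2 / (4 * gamma).
  have rho0 : 0 < rho by rewrite divr_gt0 ?mulr_gt0.
  have Qrho : Num.sqrt 2 * L1norm q <= rho by rewrite -/Q Qz mulr0 ltW.
  have := @nb_zeros_within_disk R q gamma iq g0 sq fm fp jm jp (closed_upper_half_plane R) rho rho0 Qrho _.
  rewrite -/Q Qz !mulr0 mul0r !addr0 => h.
  apply: le_trans (h _) _.
    by move=> z Dz wz; have := near z Dz wz; rewrite Qz !mulr0 => /le_trans; apply; exact: ltW.
  rewrite lee_fin.
  have -> : 4 / ln 2 * (gamma * rho / pi) = 1 :> R.
    by rewrite /rho; move: (ln 2) pi l0 p0 => l p l0 p0; field; rewrite !gt_eqF.
  rewrite /C1; lra.
have {}Qp : 0 < Q by rewrite lt_neqAle eq_sym Qp.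
(* enlarging the radius by s * Q raises the coefficient of gamma * Q by e2 *)
pose s := e2 * pi * ln 2 / 4.
have s0 : 0 < s by rewrite /s divr_gt0 ?mulr_gt0.
pose rho := (Num.sqrt 17 / 2 + s) * Q.
have rho0 : 0 < rho by rewrite mulr_gt0//; lra.
have Qrho : Num.sqrt 2 * L1norm q <= rho.
  have : Num.sqrt 2 <= 2 :> R.
    have : Num.sqrt 2 ^+ 2 = 2 :> R by rewrite sqr_sqrtr.
    have : 0 <= Num.sqrt 2 :> R by exact: sqrtr_ge0.
    nra.
  by move=> h; rewrite ler_wpM2r//; lra.
apply: le_trans (nb_zeros_within_disk iq g0 sq jm jp rho0 Qrho _) _.
  move=> z Dz wz; apply: (le_trans (near z Dz wz)).
  by rewrite /rho ler_wpM2r//; lra.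
rewrite lee_fin -/Q.
have -> : Q / rho = (Num.sqrt 17 / 2 + s)^-1.
  by rewrite /rho invfM mulrCA divff ?mulr1// gt_eqF.
have hs : (Num.sqrt 17 / 2 + s)^-1 <= 2 / Num.sqrt 17.
  have -> : 2 / Num.sqrt 17 = (Num.sqrt 17 / 2)^-1 :> R by rewrite invf_div.
  have r20 : 0 < Num.sqrt 17 / 2 :> R by rewrite divr_gt0.
  by rewrite lef_pV2 ?posrE ?addr_gt0// lerDl ltW.
have l4 : 0 <= 4 / ln 2 :> R by rewrite divr_ge0// ltW.
have := ler_wpM2l l4 hs.
have -> : 4 / ln 2 * (2 / Num.sqrt 17) = 8 / (Num.sqrt 17 * ln 2) :> R.
  by move: (ln 2) (Num.sqrt 17) l0 rp => l r l0 rp; field; rewrite !gt_eqF.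
have : 4 / ln 2 * (gamma * rho / pi) = C2 * gamma * Q.
  rewrite /C2 /rho /s; move: (ln 2) (Num.sqrt 17) pi l0 p0 => l r p l0 p0.
  by field; rewrite !gt_eqF.
rewrite /C1; lra.
Qed.
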